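(* Let $W$ be a graphon, let $d,p\ge1$, let $F=(F_1,\dots,F_d)$ be simple finite graphs with $V(F_m)=[p]$, let $\ell\in\mathcal{M}_p$ with $k=|\ell|$, and assume the Compatibility Condition holds. Then for every $g\in\mathcal{C}^2([0,1]^d)$, $$\sqrt n\big(\Gamma_n^{F,\ell}(g)-\Gamma^{F,\ell}(g)\big)\xrightarrow[n\to\infty]{(d)}\mathcal{N}\big(0,\sigma^{F,\ell}(g)^2\big),$$ where $\sigma^{F,\ell}(g)^2=\mathrm{Var}(\mathcal{U})$, $U$ is uniform on $[0,1]$, and $$\mathcal{U}=\sum_{i=1}^k\int_{[0,1]^k}\hat t_{R_i(x,U)}\Big(g\big(\tilde t_{R_i(x,U)}\big)-g(0)\Big)dx+\sum_{q\in[p]\setminus\{\ell_1,\dots,\ell_k\}}\int_{[0,1]^k}\big\langle t_{xU}(F^{\ell q},W),\nabla g(\tilde t_x)\big\rangle\,dx.$$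
   Context: A graphon is a symmetric measurable $W:[0,1]^2\to[0,1]$. $X=(X_i)_{i\ge1}$ i.i.d. uniform on $[0,1]$; $G_n$ is the random graph on $[n]$ where, conditionally on $X$, each $\{i,j\}$ is an edge independently with probability $W(X_i,X_j)$. $\mathcal{S}_{n,k}$: words of length $k$ with distinct characters in $[n]$; $\mathcal{M}_p=\bigcup_{k\in[p]}\mathcal{S}_{p,k}$. For $\ell\in\mathcal{S}_{p,k}$, $\alpha\in\mathcal{S}_{n,k}$: $\mathcal{S}^{\ell,\alpha}_{n,p}=\{\beta\in\mathcal{S}_{n,p}:\beta_{\ell_i}=\alpha_i\ \forall i\}$ and $t_{\rm inj}(F_m^\ell,G^\alpha)=|\mathcal{S}^{\ell,\alpha}_{n,p}|^{-1}\#\{\beta\in\mathcal{S}^{\ell,\alpha}_{n,p}:\{\beta_i,\beta_j\}\in E(G)\ \forall\{i,j\}\in E(F_m)\}$; $t_{\rm inj}(F^\ell,G^\alpha)$ is the vector over $m\in[d]$. Compatibility Condition: for $m,m'\in[d]$ and $i,i'$ among the labels $\ell_1,\dots,\ell_k$, $\{i,i'\}\in E(F_m)\iff\{i,i'\}\in E(F_{m'})$; $E^{[\ell]}$ is this common set of label–label edges. For $x\in[0,1]^k$: $\hat t_x=\prod_{\{\ell_i,\ell_j\}\in E^{[\ell]}}W(x_i,x_j)$; $\tilde t_x$ is the vector with entries $\int\prod_{\{i,j\}\in E(F_m)\setminus E^{[\ell]}}W(y_i,y_j)\prod_{q\notin\ell}dy_q$ with $y_{\ell_i}=x_i$; $\hat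 t=\int\hat t_x dx$. More generally, for a word $\lambda\in\mathcal{M}_p$ of length $r$ and $z\in[0,1]^r$, $t_z(F_m^\lambda,W)=\int\prod_{\{i,j\}\in E(F_m)}W(y_i,y_j)\prod_{q\notin\lambda}dy_q$ with $y_{\lambda_i}=z_i$, and $t_z(F^\lambda,W)$ is the vector over $m$. $\ell q$ is the word $\ell$ followed by $q$, $xU=(x_1,\dots,x_k,U)$, and $R_i(x,u)$ is $x$ with its $i$-th coordinate replaced by $u$. $\Gamma_n^{F,\ell}(g)=|\mathcal{S}_{n,k}|^{-1}\sum_{\alpha\in\mathcal{S}_{n,k}}g(t_{\rm inj}(F^\ell,G_n^\alpha))$ and $\Gamma^{F,\ell}(g)=\int_{[0,1]^k}\hat t_x g(\tilde t_x)dx+(1-\hat t)g(0)$. *)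

(* Defs.v *)
From HB Require Import structures.
From mathcomp Require Import all_boot all_order all_algebra.
From mathcomp Require Import all_classical all_reals all_analysis.
Set Implicit Arguments. Unset Strict Implicit. Unset Printing Implicit Defensive.
Import Order.TTheory GRing.Theory Num.Theory.
Import numFieldNormedType.Exports.
Local Open Scope classical_set_scope.
Local Open Scope ring_scope.

Section Defs.
Variable R : realType.

Definition setc (x : nat -> R) (n : nat) (u : R) : nat -> R :=
  fun j => if j == n then u else x j.

(* iterated Lebesgue integral over the cube [0,1]^n of a function of the
   coordinates 0..n-1 (the other coordinates are set to 0). *)
Fixpoint cube_int (n : nat) (f : (nat -> R) -> R) : R :=
  match n with
  | 0 => f (fun _ => 0)
  | n'.+1 => Rintegral lebesgue_measure `[0, 1]%classic
               (fun u => cube_int n' (fun x => f (setc x n' u)))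
  end.

Variables (d p : nat) (F : 'I_d -> rel 'I_p) (W : R -> R -> R).

Definition Elab (l : seq 'I_p) (i j : 'I_p) : bool :=
  [&& i \in l, j \in l & [forall m, F m i j]].

Definition free (lam : seq 'I_p) : seq 'I_p := [seq q <- enum 'I_p | q \notin lam].

Definition assign (lam : seq 'I_p) (z w : nat -> R) (q : 'I_p) : R :=
  if q \in lam then z (index q lam) else w (index q (free lam)).

Definition edge_prod (e : rel 'I_p) (y : 'I_p -> R) : R :=
  \prod_(i : 'I_p) \prod_(j : 'I_p | (i < j)%N && e i j) W (y i) (y j).

Definition t_lab (lam : seq 'I_p) (z : nat -> R) (m : 'I_d) : R :=
  cube_int (size (free lam)) (fun w => edge_prod (F m) (assign lam z w)).

Definition hat_t_x (l : seq 'I_p) (x : nat -> R) : R :=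
  edge_prod (Elab l) (fun q => x (index q l)).

Definition tilde_t_x (l : seq 'I_p) (x : nat -> R) : 'rV[R]_d :=
  \row_m cube_int (size (free l))
     (fun w => edge_prod (fun i j => F m i j && ~~ Elab l i j) (assign l x w)).

Definition hat_t (l : seq 'I_p) : R := cube_int (size l) (hat_t_x l).

Definition Gamma_lim (l : seq 'I_p) (g : 'rV[R]_d -> R) : R :=
  cube_int (size l) (fun x => hat_t_x l x * g (tilde_t_x l x))
  + (1 - hat_t l) * g 0.

Definition pderiv (g : 'rV[R]_d -> R) (m : 'I_d) (v : 'rV[R]_d) : R :=
  'D_(delta_mx 0 m) g v.

Definition curlyU (l : seq 'I_p) (g : 'rV[R]_d -> R) (u : R) : R :=
  \sum_(i < size l)
     cube_int (size l) (fun x => hat_t_x l (setc x i u) *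
                                 (g (tilde_t_x l (setc x i u)) - g 0))
  + \sum_(q <- free l)
     cube_int (size l) (fun x =>
        \sum_(m < d) t_lab (rcons l q) (setc x (size l) u) m *
                     pderiv g m (tilde_t_x l x)).

Definition sigma2 (l : seq 'I_p) (g : 'rV[R]_d -> R) : R :=
  Rintegral lebesgue_measure `[0, 1]%classic (fun u => curlyU l g u ^+ 2)
  - (Rintegral lebesgue_measure `[0, 1]%classic (curlyU l g)) ^+ 2.

Definition t_inj (l : seq 'I_p) (n : nat) (G : rel 'I_n)
    (alpha : {ffun 'I_(size l) -> 'I_n}) (m : 'I_d) : R :=
  let S := [set beta : {ffun 'I_p -> 'I_n} | injectiveb beta &&
              [forall i : 'I_(size l), beta (tnth (in_tuple l) i) == alpha i]] in
  #|[set beta in S | [forall i : 'I_p, forall j : 'I_p,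
                        F m i j ==> G (beta i) (beta j)]]|%:R / #|S|%:R.

Definition Gamma_n (l : seq 'I_p) (g : 'rV[R]_d -> R) (n : nat) (G : rel 'I_n) : R :=
  let S := [set alpha : {ffun 'I_(size l) -> 'I_n} | injectiveb alpha] in
  (#|S|%:R)^-1 * \sum_(alpha in S) g (\row_m t_inj G alpha m).

End Defs.

Definition graphon (R : realType) (W : R -> R -> R) : Prop :=
  measurable_fun ((`[0, 1]%classic : set R) `*` (`[0, 1]%classic : set R)) (fun z : R * R => W z.1 z.2)
  /\ (forall x y, 0 <= x <= 1 -> 0 <= y <= 1 -> W x y = W y x)
  /\ (forall x y, 0 <= x <= 1 -> 0 <= y <= 1 -> 0 <= W x y <= 1).

Definition simple_graph (p : nat) (e : rel 'I_p) : Prop :=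
  symmetric e /\ irreflexive e.

Definition compatible (d p : nat) (F : 'I_d -> rel 'I_p) (l : seq 'I_p) : Prop :=
  forall (m m' : 'I_d) (i i' : 'I_p), i \in l -> i' \in l -> F m i i' = F m' i i'.

Definition C2_cube (R : realType) (d : nat) (g : 'rV[R]_d -> R) : Prop :=
  exists U : set 'rV[R]_d, open U /\
    [set v : 'rV[R]_d | forall m, 0 <= v 0 m <= 1] `<=` U /\
    (forall v, U v -> {for v, continuous g}) /\
    (forall (i : 'I_d) v, U v -> derivable g v (delta_mx 0 i)) /\
    (forall (i : 'I_d) v, U v -> {for v, continuous (pderiv g i)}) /\
    (forall (i j : 'I_d) v, U v -> derivable (pderiv g i) v (delta_mx 0 j)) /\
    (forall (i j : 'I_d) v, U v -> {for v, continuous (pderiv (pderiv g i) j)}).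

Definition mutually_independent (R : realType) (dT : measure_display)
    (T : measurableType dT) (P : probability T R) (I : eqType) (A : set I)
    (Z : I -> T -> R) : Prop :=
  forall (J : seq I) (B : I -> set R), uniq J -> (forall j, j \in J -> A j) ->
    (forall j, measurable (B j)) ->
    P (\big[setI/setT]_(j <- J) (Z j @^-1` B j)) =
    (\prod_(j <- J) fine (P (Z j @^-1` B j)))%:E.

Definition uniform01 (R : realType) (dT : measure_display)
    (T : measurableType dT) (P : probability T R) (Z : T -> R) : Prop :=
  measurable_fun setT Z /\
  forall B : set R, measurable B ->
    P (Z @^-1` B) = lebesgue_measure (B `&` `[0, 1]%classic).

Definition Gn (R : realType) (T : Type) (W : R -> R -> R) (X : nat -> T -> R)
    (Y : nat -> nat -> T -> R) (n : nat) (w : T) : rel 'I_n :=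
  fun i j => (i != j) &&
    (Y (minn i j) (maxn i j) w < W (X i w) (X j w)).
Arguments Gn {R T} W X Y n w.

(* convergence in distribution of S_n to N(0, s2) (s2 >= 0; N(0,0) = dirac 0) *)
Definition cvg_normal (R : realType) (dT : measure_display)
    (T : measurableType dT) (P : probability T R) (S : nat -> T -> R) (s2 : R) : Prop :=
  forall h : R -> R, continuous h -> (exists M, forall x, `|h x| <= M) ->
    (fun n => Rintegral P setT (fun w => h (S n w))) @ \oo -->
    Rintegral lebesgue_measure setT
      (fun z => h (Num.sqrt s2 * z) * (expR (- (z ^+ 2) / 2) / Num.sqrt (2 * pi))).

(* Main.v *)
Require Import Defs.
From HB Require Import structures.
From mathcomp Require Import all_boot all_order all_algebra.
From mathcomp Require Import all_classical all_reals all_analysis.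
From mathcomp Require Import measurable_realfun.
From mathcomp Require Import zify ring lra.
Set Implicit Arguments. Unset Strict Implicit. Unset Printing Implicit Defensive.
Import Order.TTheory GRing.Theory Num.Theory.
Import numFieldNormedType.Exports.
Local Open Scope classical_set_scope.
Local Open Scope ring_scope.

(** At the injection [alpha] of the labels, [t_inj] is [I * (theta + J)], where [I] indicates that
    the label-label edges are present, [theta] is [tilde_t_x] at the types of the labelled vertices
    and [J] is a centred average. By a Taylor expansion of [g] at [theta], [Gamma_n - g 0] is, up to
    a remainder of order [1/n] in [L^1], the average over injections of a kernel of the types and
    edges of [p] vertices. The Hoeffding decomposition writes this average as its mean, plus [1/n]
    times a sum over the [n] vertices of [curlyU] minus its mean at their types, plus an average of
    terms orthogonal to each other unless they share two vertices, which is of order [1/n] in [L^2].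
    For the linear part, resampling the types one at a time gives the limit of the expectations of
    cosines; tightness and approximation by trigonometric polynomials (Bernstein polynomials
    composed with a sine) extend it to bounded continuous functions. *)

(** * Expectations of bounded measurable functions *)

(** Every random quantity here is bounded, so [bmeas] alone gives integrability and Fubini. No
    infinite product measure is built: the law of the types and edge variables is pushed to a space
    of functions, and the fact that recombining two independent samples preserves this law
    ([Ex_mix]) serves as conditioning, resampling and Fubini. The kernel is linear in the edge
    indicators because [I] is 0 or 1: [g (I * t) - g 0 = I * (g t - g 0)], so [I] leaves the
    argument of [g]. Orthogonality then concerns types only: two injections sharing at most one
    vertex share no pair, so given the types their edges are independent and may be replaced by
    values of [W]. The remaining pairs of injections have frequency of order [1/n^2], and
    multiplication by [sqrt n] leaves a negligible error. Cosines with a free phase replace complex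
    characteristic functions: the phase absorbs the part of a sum already fixed, and sines are
    included. A graphon is constrained only on the unit square and the types lie in [[0,1]] only
    almost surely, so the statistic may fail to be measurable on a null set; the last step of the
    proof deals with this. *)

Definition bmeas d (T : measurableType d) (R : realType) (f : T -> R) : Prop :=
  measurable_fun setT f /\ exists M : R, forall x, `|f x| <= M.

Section BoundedMeasurable.
Context d (T : measurableType d) (R : realType).
Implicit Types f g : T -> R.

Lemma eq_bmeas f g : f =1 g -> bmeas f -> bmeas g.
Proof. by move=> /funext ->. Qed.

Lemma bmeas_cst (c : R) : bmeas (fun _ : T => c).
Proof. by split; [exact: measurable_cst|exists `|c|]. Qed.

Lemma bmeasD f g : bmeas f -> bmeas g -> bmeas (fun x => f x + g x).
Proof.
move=> [mf [M fM]] [mg [N gN]]; split; first exact: measurable_funD.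
by exists (M + N) => x; apply: le_trans (ler_normD _ _) _; exact: lerD.
Qed.

Lemma bmeasM f g : bmeas f -> bmeas g -> bmeas (fun x => f x * g x).
Proof.
move=> [mf [M fM]] [mg [N gN]]; split; first exact: measurable_funM.
by exists (M * N) => x; rewrite normrM; apply: ler_pM.
Qed.

Lemma bmeasN f : bmeas f -> bmeas (fun x => - f x).
Proof.
by move=> [mf [M fM]]; split; [exact: measurableT_comp|exists M => x; rewrite normrN].
Qed.

Lemma bmeasB f g : bmeas f -> bmeas g -> bmeas (fun x => f x - g x).
Proof. by move=> bf bg; apply: bmeasD => //; exact: bmeasN. Qed.

Lemma bmeas_norm f : bmeas f -> bmeas (fun x => `|f x|).
Proof.
move=> [mf [M fM]]; split; first exact: measurableT_comp.
by exists M => x; rewrite normr_id.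
Qed.

Lemma bmeasX f n : bmeas f -> bmeas (fun x => f x ^+ n).
Proof.
move=> bf; elim: n => [|n IH]; first exact: bmeas_cst.
by under eq_fun do rewrite exprS; exact: bmeasM.
Qed.

Lemma bmeas_sum (I : Type) (s : seq I) (Q : pred I) (F : I -> T -> R) :
  (forall i, Q i -> bmeas (F i)) -> bmeas (fun x => \sum_(i <- s | Q i) F i x).
Proof.
move=> bF; elim: s => [|i s IH].
  by under eq_fun do rewrite big_nil; exact: bmeas_cst.
under eq_fun do rewrite big_cons.
by have [/bF bFi|//] := boolP (Q i); exact: bmeasD.
Qed.

Lemma bmeas_prod (I : Type) (s : seq I) (Q : pred I) (F : I -> T -> R) :
  (forall i, Q i -> bmeas (F i)) -> bmeas (fun x => \prod_(i <- s | Q i) F i x).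
Proof.
move=> bF; elim: s => [|i s IH].
  by under eq_fun do rewrite big_nil; exact: bmeas_cst.
under eq_fun do rewrite big_cons.
by have [/bF bFi|//] := boolP (Q i); exact: bmeasM.
Qed.

Lemma bmeas_comp d' (T' : measurableType d') (phi : T' -> T) f :
  measurable_fun setT phi -> bmeas f -> bmeas (fun x => f (phi x)).
Proof.
move=> mphi [mf [M fM]]; split; last by exists M.
exact: (measurableT_comp mf mphi).
Qed.

End BoundedMeasurable.

Definition Ex d (T : measurableType d) (R : realType) (P : probability T R)
  (f : T -> R) : R := Rintegral P setT f.

Section Expectation.
Context d (T : measurableType d) (R : realType) (P : probability T R).
Implicit Types f g : T -> R.

Lemma bmeas_integrable f : bmeas f -> P.-integrable setT (EFin \o f).
Proof.
move=> [mf [M fM]]; apply: measurable_bounded_integrable => //.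
  by rewrite [X in (X < _)%E](probability_setT P) ltry.
exists M; split; first exact: num_real.
by move=> x Mx y _; apply: le_trans (fM y) (ltW Mx).
Qed.

Lemma Ex_ext f g : f =1 g -> Ex P f = Ex P g.
Proof. by move=> fg; congr Ex; apply/funext. Qed.

Lemma Ex_cst c : Ex P (fun _ => c) = c.
Proof. by rewrite /Ex Rintegral_cst// [X in fine X](probability_setT P) mulr1. Qed.

Lemma ExD f g : bmeas f -> bmeas g -> Ex P (fun x => f x + g x) = Ex P f + Ex P g.
Proof. by move=> bf bg; rewrite /Ex RintegralD//; exact: bmeas_integrable. Qed.

Lemma ExZ c f : bmeas f -> Ex P (fun x => c * f x) = c * Ex P f.
Proof. by move=> bf; rewrite /Ex RintegralZl//; exact: bmeas_integrable. Qed.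

Lemma ExN f : bmeas f -> Ex P (fun x => - f x) = - Ex P f.
Proof.
move=> bf; rewrite -mulN1r -ExZ//; apply: Ex_ext => x.
by rewrite mulN1r.
Qed.

Lemma ExB f g : bmeas f -> bmeas g -> Ex P (fun x => f x - g x) = Ex P f - Ex P g.
Proof. by move=> bf bg; rewrite ExD ?ExN//; exact: bmeasN. Qed.

Lemma Ex_sum (I : Type) (s : seq I) (Q : pred I) (F : I -> T -> R) :
  (forall i, Q i -> bmeas (F i)) ->
  Ex P (fun x => \sum_(i <- s | Q i) F i x) = \sum_(i <- s | Q i) Ex P (F i).
Proof.
move=> bF; elim: s => [|i s IH].
  by rewrite big_nil -[RHS]Ex_cst; apply: Ex_ext => x; rewrite big_nil.
under Ex_ext do rewrite big_cons.
rewrite big_cons; case: ifPn => // Qi; rewrite ExD ?IH//; first exact: bF.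
exact: bmeas_sum.
Qed.

Lemma Ex_le f g : bmeas f -> bmeas g -> (forall x, f x <= g x) -> Ex P f <= Ex P g.
Proof. by move=> bf bg fg; apply: le_Rintegral => //; exact: bmeas_integrable. Qed.

Lemma Ex_ge0 f : (forall x, 0 <= f x) -> 0 <= Ex P f.
Proof. by move=> f0; exact: Rintegral_ge0. Qed.

Lemma Ex_norm_le f : bmeas f -> `|Ex P f| <= Ex P (fun x => `|f x|).
Proof. by move=> bf; apply: le_normr_Rintegral => //; exact: bmeas_integrable. Qed.

Lemma Ex_norm_le_cst f M : bmeas f -> (forall x, `|f x| <= M) -> `|Ex P f| <= M.
Proof.
move=> bf fM; apply: le_trans (Ex_norm_le bf) _; rewrite -[leRHS]Ex_cst.
by apply: Ex_le => //; [exact: bmeas_norm|exact: bmeas_cst].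
Qed.

(** This is the nonnegativity of the variance of [|f|]. *)
Lemma Ex_norm_sqr f : bmeas f -> Ex P (fun x => `|f x|) ^+ 2 <= Ex P (fun x => f x ^+ 2).
Proof.
move=> bf; set a := Ex P _; have ba := bmeas_norm bf.
have : 0 <= Ex P (fun x => (`|f x| - a) ^+ 2) by apply: Ex_ge0 => x; exact: sqr_ge0.
have -> : Ex P (fun x => (`|f x| - a) ^+ 2) =
    Ex P (fun x => f x ^+ 2 + ((- (a *+ 2)) * `|f x| + a ^+ 2)).
  apply: Ex_ext => x; rewrite sqrrB real_normK ?num_real//.
  by rewrite mulrC mulNr mulrnAl addrA.
have b1 : bmeas (fun x => (- (a *+ 2)) * `|f x|) by apply: bmeasM => //; exact: bmeas_cst.
rewrite ExD; [|exact: bmeasX|by apply: bmeasD => //; exact: bmeas_cst].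
rewrite ExD ?Ex_cst ?ExZ//; last exact: bmeas_cst.
rewrite -/a; lra.
Qed.

Lemma Ex_pushforward d' (T' : measurableType d') (P' : probability T' R)
    (phi : T -> T') (f' : T' -> R) : measurable_fun setT phi -> bmeas f' ->
  (forall A, measurable A -> P' A = P (phi @^-1` A)) ->
  Ex P' f' = Ex P (fun x => f' (phi x)).
Proof.
move=> mphi bf' PP'; rewrite /Ex /Rintegral; congr fine.
rewrite (_ : \int[P]_x (f' (phi x))%:E = \int[P]_(x in phi @^-1` setT) ((EFin \o f') \o phi) x)%E.
  rewrite -(integral_pushforward mphi)//=.
- by apply: eq_measure_integral => //= A mA _; exact: PP'.
  - by apply/measurable_EFinP; exact: bf'.1.
  - by rewrite preimage_setT; apply: bmeas_integrable; exact: bmeas_comp.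
by rewrite preimage_setT.
Qed.

End Expectation.

Section FubiniMeasurability.
Context d1 d2 (T1 : measurableType d1) (T2 : measurableType d2) (R : realType).
Variables (P1 : probability T1 R) (P2 : probability T2 R).

Lemma bmeas_slice1 (F : T1 * T2 -> R) x : bmeas F -> bmeas (fun y => F (x, y)).
Proof.
move=> bF; apply: (bmeas_comp (phi := fun y => (x, y))) => //.
by apply: measurable_fun_pair => //; exact: measurable_cst.
Qed.

Lemma bmeas_slice2 (F : T1 * T2 -> R) y : bmeas F -> bmeas (fun x => F (x, y)).
Proof.
move=> bF; apply: (bmeas_comp (phi := fun x => (x, y))) => //.
Qed.

Lemma prod_integrable (F : T1 * T2 -> R) : bmeas F ->
  (P1 \x P2)%E.-integrable setT (EFin \o F).
Proof.
move=> [mF [M FM]]; apply: measurable_bounded_integrable => //.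
  rewrite [X in (X < _)%E](_ : _ = (P1 \x P2)%E (setT `*` setT)); last by rewrite setXTT.
  rewrite product_measure1E//.
  rewrite [X in (X * _)%E](probability_setT P1) [X in (_ * X)%E](probability_setT P2).
  by rewrite mule1 ltry.
exists M; split; first exact: num_real.
by move=> x Mx y _; apply: le_trans (FM y) (ltW Mx).
Qed.

Lemma measurable_slice_integral1 (F : T1 * T2 -> R) : bmeas F ->
  measurable_fun setT (fun x => Ex P2 (fun y => F (x, y))).
Proof.
move=> bF; have mf := measurable_fubini_F (prod_integrable bF).
apply/measurable_EFinP; apply: eq_measurable_fun mf => x _ /=.
rewrite /fubini_F /Ex /Rintegral fineK//.
by apply: integrable_fin_num => //; apply: bmeas_integrable; exact: bmeas_slice1.
Qed.

Lemma measurable_slice_integral2 (F : T1 * T2 -> R) : bmeas F ->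
  measurable_fun setT (fun y => Ex P1 (fun x => F (x, y))).
Proof.
move=> bF; have mf := measurable_fubini_G (prod_integrable bF).
apply/measurable_EFinP; apply: eq_measurable_fun mf => x _ /=.
rewrite /fubini_G /Ex /Rintegral fineK//.
by apply: integrable_fin_num => //; apply: bmeas_integrable; exact: bmeas_slice2.
Qed.

End FubiniMeasurability.

Lemma bmeas_Ex2 d1 d2 (T1 : measurableType d1) (T2 : measurableType d2) (R : realType)
    (P2 : probability T2 R) (F : T1 * T2 -> R) :
  bmeas F -> bmeas (fun x => Ex P2 (fun y => F (x, y))).
Proof.
move=> bF; split; last first.
  have [M FM] := bF.2; exists M => x.
  by apply: Ex_norm_le_cst; [exact: bmeas_slice1|].
(* The product measure behind the Fubini lemma needs a probability on the first factor, although the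
   conclusion does not mention it; a Dirac mass fills the place. *)
exact: (measurable_slice_integral1 (dirac point) P2 bF).
Qed.

Lemma bmeas_Ex1 d1 d2 (T1 : measurableType d1) (T2 : measurableType d2) (R : realType)
    (P1 : probability T1 R) (F : T1 * T2 -> R) :
  bmeas F -> bmeas (fun y => Ex P1 (fun x => F (x, y))).
Proof.
move=> bF; split; last first.
  have [M FM] := bF.2; exists M => x.
  by apply: Ex_norm_le_cst; [exact: bmeas_slice2|].
exact: (measurable_slice_integral2 P1 (dirac point) bF).
Qed.

Section Fubini.
Context d1 d2 (T1 : measurableType d1) (T2 : measurableType d2) (R : realType).
Variables (P1 : probability T1 R) (P2 : probability T2 R).

Let EFin_Ex2 (F : T1 * T2 -> R) : bmeas F ->
  ((Ex P1 (fun x => Ex P2 (fun y => F (x, y))))%:E =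
   \int[P1]_x \int[P2]_y (F (x, y))%:E)%E.
Proof.
move=> bF; rewrite {1}/Ex /Rintegral fineK.
  apply: eq_integral => x _; rewrite /Ex /Rintegral fineK//.
  by apply: integrable_fin_num => //; apply: bmeas_integrable; exact: bmeas_slice1.
by apply: integrable_fin_num => //; apply: bmeas_integrable; exact: bmeas_Ex2.
Qed.

Lemma Ex_pushforward2 d' (T' : measurableType d') (P' : probability T' R)
    (phi : T1 * T2 -> T') (f' : T' -> R) : measurable_fun setT phi -> bmeas f' ->
  (forall A, measurable A -> P' A = (P1 \x P2)%E (phi @^-1` A)) ->
  Ex P' f' = Ex P1 (fun x => Ex P2 (fun y => f' (phi (x, y)))).
Proof.
move=> mphi bf' PP'; have bF := bmeas_comp mphi bf'.
apply: EFin_inj; rewrite (EFin_Ex2 bF)/= /Ex /Rintegral fineK; last first.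
  by apply: integrable_fin_num => //; exact: bmeas_integrable.
rewrite (integral12_prod_meas1 (prod_integrable P1 P2 bF)).
rewrite (_ : \int[P1 \x P2]_z (EFin \o (f' \o phi)) z =
  \int[P1 \x P2]_(x in phi @^-1` setT) ((EFin \o f') \o phi) x)%E; last by rewrite preimage_setT.
rewrite -(integral_pushforward mphi)//=.
- by apply: eq_measure_integral => //= A mA _; exact: PP'.
- by apply/measurable_EFinP; exact: bf'.1.
- by rewrite preimage_setT; exact: (prod_integrable P1 P2 bF).
Qed.

End Fubini.
(** * Families of independent uniform variables *)

Section CoordinateSpace.
Variables (R : realType) (I : eqType).

Definition cylinder (J : seq I) (B : I -> set R) : set (I -> R) :=
  [set x | forall j, j \in J -> B j (x j)].

Definition cylinders : set (set (I -> R)) :=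
  [set A | exists J B, (forall j, measurable (B j)) /\ A = cylinder J B].

(** The index type is arbitrary, and cylinders constrain finitely many coordinates: this is the
    product sigma-algebra on [I -> R]. Probabilities on it arise as image measures. *)
Definition cspace := g_sigma_algebraType cylinders.

Lemma cylinders_setI : setI_closed cylinders.
Proof.
move=> _ _ [J1 [B1 [mB1 ->]]] [J2 [B2 [mB2 ->]]].
exists (J1 ++ J2), (fun j => (if j \in J1 then B1 j else setT) `&`
                            (if j \in J2 then B2 j else setT)); split.
  by move=> j; apply: measurableI; case: ifP.
apply/seteqP; split => x /=.
  move=> [x1 x2] j _; split; first by case: ifP => // jJ; exact: x1.
  by case: ifP => // jJ; exact: x2.
move=> h; split => j jJ.
  by have := (h j); rewrite mem_cat jJ => /(_ isT) [].
by have := (h j); rewrite mem_cat jJ orbT => /(_ isT) [].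
Qed.

Lemma measurable_cylinder J B : (forall j, measurable (B j)) ->
  measurable (cylinder J B : set cspace).
Proof. by move=> mB; apply: sub_sigma_algebra; exists J, B. Qed.

Lemma measurable_coord i : measurable_fun setT (fun x : cspace => x i).
Proof.
move=> _ B mB; rewrite setTI.
rewrite (_ : _ @^-1` _ = cylinder [:: i] (fun => B)).
  exact: measurable_cylinder.
apply/seteqP; split => x /=; first by move=> Bx j; rewrite inE => /eqP ->.
by apply; rewrite inE.
Qed.

Lemma measurable_to_cspace d (T : measurableType d) (f : T -> cspace) :
  (forall i, measurable_fun setT (fun t => f t i)) -> measurable_fun setT f.
Proof.
move=> mf; apply: (@measurability _ _ T cspace setT f cylinders erefl) => // _ [_ [J [B [mB ->]]] <-].
rewrite setTI; elim: J => [|j J IH].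
  by rewrite (_ : _ @^-1` _ = setT)//; apply/seteqP; split.
rewrite (_ : _ @^-1` _ = (fun t => f t j) @^-1` B j `&` f @^-1` cylinder J B).
  by apply: measurableI => //; rewrite -[X in measurable X]setTI; exact: mf.
apply/seteqP; split => t /=.
  move=> h; split; first by apply: h; rewrite inE eqxx.
  by move=> i iJ; apply: h; rewrite inE iJ orbT.
by move=> [h1 h2] i; rewrite inE => /predU1P[->//|]; exact: h2.
Qed.

(** Cylinders form a generating pi-system. Duplicate-free index lists suffice because removing
    repetitions does not change a cylinder; this matters since independence speaks of distinct
    indices. *)
Lemma cspace_measure_unique (m1 m2 : {measure set cspace -> \bar R}) :
  (m1 setT < +oo)%E ->
  (forall J B, uniq J -> (forall j, measurable (B j)) ->
    m1 (cylinder J B) = m2 (cylinder J B)) ->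
  forall A, measurable A -> m1 A = m2 A.
Proof.
move=> m1fin m12; apply: (@measure_unique _ R cspace cylinders (fun => setT) erefl cylinders_setI) => //.
- move=> _; exists [::], (fun => setT); split => //.
  by apply/seteqP; split.
- by apply/seteqP; split => // x _; exists 0.
- move=> _ [J [B [mB ->]]].
  have -> : cylinder J B = cylinder (undup J) B.
    by apply/seteqP; split => x /= h j jJ; apply: h; move: jJ; rewrite mem_undup.
  by apply: m12 => //; exact: undup_uniq.
Qed.

End CoordinateSpace.

Section UniformLaw.
Variable R : realType.

(* The library puts the uniform probability on [measurableTypeR R]; it is moved here
   to [R] with its canonical, convertible measurable structure. *)
Let id_measurable : measurable_fun setT (fun x : measurableTypeR R => x : R).
Proof. by move=> _ B mB; rewrite setTI. Qed.

Definition U01 : probability R R :=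
  distribution (uniform_prob (@ltr01 R))
    (HB.pack_for {mfun measurableTypeR R >-> R} (fun x : measurableTypeR R => x : R)
      (isMeasurableFun.Build _ _ _ _ _ id_measurable)).

Lemma uniform01_prob (B : set R) : measurable B ->
  uniform_prob (@ltr01 R) B = lebesgue_measure (B `&` `[0, 1]%classic).
Proof.
move=> mB; rewrite /uniform_prob integral_uniform_pdf.
rewrite (eq_integral (fun=> 1%E)).
  rewrite integral_cst ?mul1e//; exact: measurableI.
move=> x; rewrite inE/= in_itv/= => -[_ x01].
by rewrite /uniform_pdf x01 subr0 invr1.
Qed.

Lemma Ex_uniform01 (phi : R -> R) : bmeas phi ->
  Ex U01 phi = Rintegral lebesgue_measure `[0, 1]%classic phi.
Proof.
move=> bphi; have [mphi [M phiM]] := bphi.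
transitivity (Ex (uniform_prob (@ltr01 R)) phi).
  exact: (@Ex_pushforward _ (measurableTypeR R) _ (uniform_prob (@ltr01 R)) _ R U01 id).
(* Integration against the uniform law is available for nonnegative functions; adding [M] makes
   [phi] nonnegative, and the constant cancels at the end because both measures give mass 1 to the
   unit interval. *)
have bM : bmeas (fun x : R => phi x + M) by apply: bmeasD => //; exact: bmeas_cst.
have phiM0 x : 0 <= phi x + M by move: (phiM x); rewrite ler_norml => /andP[? _]; lra.
have intS (f : R -> R) : bmeas f -> lebesgue_measure.-integrable `[0, 1] (EFin \o f).
  move=> [mf [N fN]]; apply: measurable_bounded_integrable => //.
  - rewrite [X in (X < _)%E](_ : _ = 1%E) ?ltry//.
    by rewrite [LHS]lebesgue_measure_itv/= lte_fin ltr01 oppr0 adde0.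
  - exact: measurable_funTS.
  - exists N; split; first exact: num_real.
    by move=> x Nx y _; apply: le_trans (fN y) (ltW Nx).
have : Ex (uniform_prob (@ltr01 R)) (fun x => phi x + M) =
    Rintegral lebesgue_measure `[0, 1]%classic (fun x => phi x + M).
  rewrite /Ex /Rintegral integral_uniform ?subr0 ?invr1 ?mul1e//.
  by apply/measurable_EFinP; exact: bM.1.
rewrite ExD//; last exact: bmeas_cst.
rewrite RintegralD//; [|exact: intS|by apply: intS; exact: bmeas_cst].
rewrite Ex_cst Rintegral_cst//= lebesgue_measure_itv/= lte_fin ltr01 oppr0 adde0 mulr1.
exact: addIr.
Qed.

End UniformLaw.

Section IidUniform.
Variables (R : realType) (I : eqType).
Implicit Types (B : I -> set R) (J : seq I).

Definition unif_mass (B : set R) : R := fine (lebesgue_measure (B `&` `[0, 1]%classic)).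

Definition iid_unif (nu : probability (cspace R I) R) : Prop :=
  forall J B, uniq J -> (forall j, measurable (B j)) ->
    nu (cylinder J B) = (\prod_(j <- J) unif_mass (B j))%:E.

Definition mix (D : pred I) (z z' : I -> R) : I -> R := fun j => if D j then z j else z' j.

Definition upd (z : I -> R) (i : I) (u : R) : I -> R := fun j => if j == i then u else z j.

Variable nu : probability (cspace R I) R.
Hypothesis nuP : iid_unif nu.

Lemma measurable_mix D :
  measurable_fun setT (fun zz : cspace R I * cspace R I => mix D zz.1 zz.2 : cspace R I).
Proof.
apply: measurable_to_cspace => i; rewrite /mix; case: (D i).
  exact: (measurableT_comp (measurable_coord i) measurable_fst).
exact: (measurableT_comp (measurable_coord i) measurable_snd).
Qed.

(** The coordinates in [D] of one sample and the others of an independent copy form again an i.i.d.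
    uniform family: on a cylinder the product of masses splits along [D]. The inner expectation is
    thus the conditional expectation given the coordinates in [D]. *)
Lemma Ex_mix D (f : cspace R I -> R) : bmeas f ->
  Ex nu f = Ex nu (fun z => Ex nu (fun z' => f (mix D z z'))).
Proof.
move=> bf; have mm := measurable_mix D.
rewrite (Ex_pushforward2 (P1 := nu) (P2 := nu) mm bf)// => A mA.
have -> : (nu \x nu)%E ((fun zz => mix D zz.1 zz.2) @^-1` A) =
  pushforward (nu \x nu)%E (fun zz => mix D zz.1 zz.2 : cspace R I) A by [].
apply: cspace_measure_unique => //; first by rewrite [X in (X < _)%E](probability_setT nu) ltry.
move=> J B uJ mB /=; rewrite nuP// /pushforward.
rewrite (_ : _ @^-1` _ = cylinder [seq j <- J | D j] B `*` cylinder [seq j <- J | ~~ D j] B).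
  rewrite product_measure1E; [|exact: measurable_cylinder..].
  transitivity ((\prod_(j <- [seq j <- J | D j]) unif_mass (B j))%:E *
     (\prod_(j <- [seq j <- J | ~~ D j]) unif_mass (B j))%:E)%E; last first.
    by rewrite -!nuP// filter_uniq.
  by rewrite -EFinM !big_filter [in LHS](bigID D).
apply/seteqP; split => -[z z'] /=.
  move=> h; split => j; rewrite mem_filter => /andP[Dj jJ].
    by have := h j jJ; rewrite /mix Dj.
  by have := h j jJ; rewrite /mix (negbTE Dj).
move=> [h h'] j jJ; rewrite /mix; case: ifPn => Dj.
  by apply: h; rewrite mem_filter Dj.
by apply: h'; rewrite mem_filter Dj.
Qed.

Lemma unif_massE (B : set R) : measurable B ->
  (unif_mass B)%:E = lebesgue_measure (B `&` `[0, 1]%classic).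
Proof.
move=> mB; rewrite /unif_mass fineK// ge0_fin_numE//.
apply: (@le_lt_trans _ _ (lebesgue_measure (`[0, 1]%classic : set R))).
  by apply: le_measure => //; rewrite inE; [exact: measurableI|].
by rewrite lebesgue_measure_itv/= lte_fin ltr01 ltry.
Qed.

Lemma Ex_coord (phi : R -> R) i : bmeas phi ->
  Ex nu (fun z => phi (z i)) = Rintegral lebesgue_measure `[0, 1]%classic phi.
Proof.
move=> bphi; rewrite -Ex_uniform01//.
apply/esym/(Ex_pushforward (P := nu) (measurable_coord i) bphi) => A mA.
rewrite [LHS](_ : _ = uniform_prob (@ltr01 R) A)//.
rewrite uniform01_prob// -unif_massE// -[in LHS](big_seq1 *%R i (fun=> unif_mass A)).
rewrite -(nuP (B := fun=> A))//; congr (nu _).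
apply/seteqP; split => x /=; first by apply; rewrite inE.
by move=> Bx j; rewrite inE => /eqP ->.
Qed.

Lemma measurable_upd i :
  measurable_fun setT (fun uz : R * cspace R I => upd uz.2 i uz.1 : cspace R I).
Proof.
apply: measurable_to_cspace => j; rewrite /upd; case: (j == i).
  exact: measurable_fst.
exact: (measurableT_comp (measurable_coord j) measurable_snd).
Qed.

(** In [Ex_mix] with [D] the single index [i], the outer sample matters only through its [i]-th
    coordinate, which is uniform. The next lemma takes the complementary [D]. *)
Lemma Ex_resample (f : cspace R I -> R) i : bmeas f ->
  Ex nu f = Rintegral lebesgue_measure `[0, 1]%classic (fun u => Ex nu (fun z => f (upd z i u))).
Proof.
move=> bf; rewrite (Ex_mix (pred1 i))//.
have bF := bmeas_comp (measurable_upd i) bf.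
rewrite -(@Ex_coord (fun u => Ex nu (fun z => f (upd z i u))) i); last exact: (bmeas_Ex2 nu bF).
apply: Ex_ext => z; apply: Ex_ext => z'; congr f; apply/funext => j.
by rewrite /mix /upd/=; case: eqP => [->|].
Qed.

Lemma Ex_resample_inner (f : cspace R I -> R) i : bmeas f ->
  Ex nu f = Ex nu (fun z => Rintegral lebesgue_measure `[0, 1]%classic (fun u => f (upd z i u))).
Proof.
move=> bf; rewrite (Ex_mix (predC1 i))//; apply: Ex_ext => z.
rewrite -(@Ex_coord (fun u => f (upd z i u)) i).
  apply: Ex_ext => z'; congr f; apply/funext => j.
  by rewrite /mix /upd/=; case: eqP => [->|].
have bF := bmeas_comp (measurable_upd i) bf.
exact: (bmeas_slice2 z bF).
Qed.

End IidUniform.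

(** The law of the whole family, as a measure on functions, allows the original probability space to
    be forgotten: any bounded measurable statistic of the family has the same expectation under
    [nu]. *)
Lemma iid_unif_law (R : realType) dT (T : measurableType dT) (P : probability T R)
    (I : eqType) (Z : I -> T -> R) :
  mutually_independent P setT Z -> (forall i, uniform01 P (Z i)) ->
  exists nu : probability (cspace R I) R, iid_unif nu /\
    forall f : cspace R I -> R, bmeas f -> Ex P (fun w => f (fun i => Z i w)) = Ex nu f.
Proof.
move=> indep unif.
have mZ : measurable_fun setT (fun w => (fun i => Z i w) : cspace R I).
  by apply: measurable_to_cspace => i; exact: (unif i).1.
pose X : {mfun T >-> cspace R I} := HB.pack (fun w => (fun i => Z i w) : cspace R I)
  (isMeasurableFun.Build _ _ _ _ _ mZ).
exists (distribution P X); split; last first.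
  by move=> f bf; rewrite (Ex_pushforward (P := P) mZ bf).
move=> J B uJ mB; rewrite /= /distribution /pushforward.
rewrite (_ : _ @^-1` _ = \big[setI/setT]_(j <- J) (Z j @^-1` B j)).
  rewrite indep//; congr (_%:E); apply: eq_bigr => j _.
  by rewrite (unif j).2.
apply/seteqP; split => w.
  move=> /= h; rewrite big_seq; elim/big_ind: _ => // A1 A2 h1 h2; exact: conj.
elim: J {uJ} => [|j J IH]; first by move=> _ j.
rewrite big_cons => -[h1 /IH h2] i; rewrite inE => /predU1P[->//|]; exact: h2.
Qed.

(** * Iterated integrals over the cube as expectations *)

Section CubeIntegral.
Variable R : realType.

Definition incube (x : nat -> R) : Prop := forall j, 0 <= x j <= 1.

Lemma incube_setc x n u : incube x -> 0 <= u <= 1 -> incube (setc x n u).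
Proof. by move=> cx cu j; rewrite /setc; case: ifP. Qed.

Lemma eq_cube_int n (f f' : (nat -> R) -> R) :
  (forall x, incube x -> f x = f' x) -> cube_int n f = cube_int n f'.
Proof.
elim: n f f' => [|n IH] f f' ff' /=.
  (* In dimension 0 both functions are evaluated at the zero sequence, which satisfies [incube]. *)
  by apply: ff' => j; rewrite lexx ler01.
apply: eq_Rintegral => u; rewrite inE/= in_itv/= => u01.
by apply: IH => x cx; apply: ff'; exact: incube_setc.
Qed.

Lemma measurable_setc n d (S : measurableType d) (h : S -> cspace R nat) (k : S -> R) :
  measurable_fun setT h -> measurable_fun setT k ->
  measurable_fun setT (fun s => setc (h s) n (k s) : cspace R nat).
Proof.
move=> mh mk; apply: measurable_to_cspace => j; rewrite /setc.
case: (j == n) => //; exact: (measurableT_comp (measurable_coord j) mh).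
Qed.

(** The parameter space [S] is what makes the induction work: the variable of the outermost integral
    joins the parameter, so the induction hypothesis is used on [S * R]. *)
Lemma bmeas_cube_int d (S : measurableType d) n (f : S -> (nat -> R) -> R) :
  bmeas (fun z : S * cspace R nat => f z.1 z.2) -> bmeas (fun s => cube_int n (f s)).
Proof.
elim: n d S f => [|n IH] d S f bf /=.
  exact: (bmeas_slice2 ((fun=> 0) : cspace R nat) bf).
have bF : bmeas (fun su : S * R => cube_int n (fun x => f su.1 (setc x n su.2))).
  apply: (IH _ _ (fun (su : S * R) x => f su.1 (setc x n su.2))).
  apply: (bmeas_comp (phi := fun sux : (S * R) * cspace R nat =>
    (sux.1.1, setc sux.2 n sux.1.2 : cspace R nat)) _ bf).
  apply: measurable_fun_pair.
    exact: (measurableT_comp measurable_fst measurable_fst).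
  apply: measurable_setc; first exact: measurable_snd.
  exact: (measurableT_comp measurable_snd measurable_fst).
have := bmeas_Ex2 (U01 R) bF; congr bmeas; apply/funext => s.
by rewrite Ex_uniform01//; exact: (bmeas_slice1 s bF).
Qed.

(** The value 0 beyond [n] is the one that [cube_int] gives to the coordinates it does not
    integrate. *)
Definition trunc (n : nat) (x : nat -> R) : nat -> R := fun j => if (j < n)%N then x j else 0.

Lemma measurable_trunc n (I : eqType) (s : nat -> I) :
  measurable_fun setT (fun z : cspace R I => trunc n (z \o s) : cspace R nat).
Proof.
apply: measurable_to_cspace => j; rewrite /trunc; case: (j < n)%N => //.
exact: measurable_coord.
Qed.

(** Any [n] distinct coordinates of the family are independent uniforms. The outermost integral is
    matched with the resampling of coordinate [s n], and injectivity keeps the remaining ones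
    untouched by it. *)
Lemma cube_int_Ex (I : eqType) (nu : probability (cspace R I) R) n (s : nat -> I)
    (f : cspace R nat -> R) :
  iid_unif nu -> {in gtn n &, injective s} -> bmeas f ->
  cube_int n f = Ex nu (fun z => f (trunc n (z \o s))).
Proof.
move=> nuP; elim: n f => [|n IH] f injs bf.
  by rewrite -[LHS](Ex_cst nu); apply: Ex_ext => z; congr f; apply/funext.
rewrite (Ex_resample nuP (s n)) /=; last exact: (bmeas_comp (measurable_trunc n.+1 s)).
apply: eq_Rintegral => u _; rewrite IH.
- apply: Ex_ext => z; congr f; apply/funext => j.
  rewrite /setc /trunc /upd/= ltnS; have [->|jn] := eqVneq j n; first by rewrite leqnn eqxx.
  rewrite ltn_neqAle jn/=; case: ifP => // jn'.
  by case: eqP => // /injs jn''; rewrite jn'' ?eqxx ?inE ?ltnS// in jn.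
- move=> i j; rewrite !inE => ilt jlt; apply: injs; rewrite inE; exact: ltnW.
- apply: (bmeas_comp (phi := fun x : cspace R nat => setc x n u : cspace R nat) _ bf).
  by apply: measurable_setc => //; exact: measurable_id.
Qed.

End CubeIntegral.
(** * Random edges and kernels on the vertices *)

Section RandomEdges.
Variables (R : realType) (W : R -> R -> R).
Hypothesis mW : measurable_fun setT (fun z : R * R => W z.1 z.2).
Hypothesis W01 : forall x y, 0 <= W x y <= 1.

Definition idx : eqType := (nat + nat * nat)%type.

(* The uniform variable of the pair {i, j} sits at the coordinate indexed by its
   smaller element and the gap, so that every index of [idx] is used. *)
Definition eix (i j : nat) : idx := inr (minn i j, (maxn i j - minn i j).-1).

Lemma eix_inj i j i' j' : i != j -> i' != j' -> eix i j = eix i' j' ->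
  (i = i' /\ j = j') \/ (i = j' /\ j = i').
Proof. move=> /eqP ij /eqP ij' [] => h1 h2; lia. Qed.

Definition edge_ind (z : idx -> R) (i j : nat) : R :=
  (z (eix i j) < W (z (inl i)) (z (inl j)))%R%:R.

Lemma bmeas_W d (T : measurableType d) (f g : T -> R) :
  measurable_fun setT f -> measurable_fun setT g -> bmeas (fun t => W (f t) (g t)).
Proof.
move=> mf mg; split.
  exact: (measurableT_comp mW (measurable_fun_pair mf mg)).
by exists 1 => t; have /andP[h1 h2] := W01 (f t) (g t); rewrite ger0_norm.
Qed.

Lemma bmeas_edge_ind i j : bmeas (fun z : cspace R idx => edge_ind z i j).
Proof.
split; last by exists 1 => z; rewrite /edge_ind; case: (_ < _); rewrite ?normr0 ?normr1.
have mb : measurable_fun setT (fun b : bool => b%:R : R) by [].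
apply: (measurableT_comp mb); apply: measurable_fun_ltr; first exact: measurable_coord.
by apply: (bmeas_W _ _).1; exact: measurable_coord.
Qed.

(** Given the types, a pair is an edge with probability [W], independently of the other pairs. The
    uniform variables of the pairs are integrated out one at a time; distinctness of the indices
    ensures that each occurs in a single factor, and [phi] sees none of them. *)
Lemma Ex_edge_prod (nu : probability (cspace R idx) R) (es : seq (nat * nat))
    (phi : cspace R idx -> R) :
  iid_unif nu -> uniq [seq eix e.1 e.2 | e <- es] -> bmeas phi ->
  (forall z e u, phi (upd z (inr e) u) = phi z) ->
  Ex nu (fun z => \prod_(e <- es) edge_ind z e.1 e.2 * phi z) =
  Ex nu (fun z => \prod_(e <- es) W (z (inl e.1)) (z (inl e.2)) * phi z).
Proof.
move=> nuP; elim: es phi => [|e es IH] phi /=.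
  by move=> _ _ _; apply: Ex_ext => z; rewrite !big_nil.
move=> /andP[enes ues] bphi phiE.
have bWe : bmeas (fun z : cspace R idx => W (z (inl e.1)) (z (inl e.2))).
  by apply: bmeas_W; exact: measurable_coord.
(* The factor [W] of the first pair depends on types only, so it can be absorbed into [phi] before
   the induction hypothesis is applied to the other pairs. *)
transitivity (Ex nu (fun z => \prod_(e <- es) edge_ind z e.1 e.2 *
    (W (z (inl e.1)) (z (inl e.2)) * phi z))); last first.
  rewrite IH//; last 2 first.
  - exact: bmeasM.
  - by move=> z e' u; rewrite phiE.
  by apply: Ex_ext => z; rewrite big_cons mulrA; congr (_ * _); rewrite mulrC.
rewrite [LHS](Ex_resample_inner nuP (eix e.1 e.2)); last first.
  apply: bmeasM => //; apply: bmeas_prod => i _; exact: bmeas_edge_ind.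
apply: Ex_ext => z; rewrite -Ex_uniform01; last first.
  apply: (bmeas_comp (phi := fun u => upd z (eix e.1 e.2) u : cspace R idx)
    (f := fun z => \prod_(j <- e :: es) edge_ind z j.1 j.2 * phi z)).
    apply: measurable_to_cspace => j; rewrite /upd; case: (j == _) => //.
  apply: bmeasM => //; apply: bmeas_prod => i _; exact: bmeas_edge_ind.
have E u : \prod_(j <- e :: es) edge_ind (upd z (eix e.1 e.2) u) j.1 j.2 *
    phi (upd z (eix e.1 e.2) u) =
    (\prod_(j <- es) edge_ind z j.1 j.2 * phi z) *
      (u < W (z (inl e.1)) (z (inl e.2)))%R%:R.
  have -> : phi (upd z (eix e.1 e.2) u) = phi z by exact: phiE.
  rewrite big_cons.
  have -> : \prod_(j <- es) edge_ind (upd z (eix e.1 e.2) u) j.1 j.2 =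
            \prod_(j <- es) edge_ind z j.1 j.2.
    rewrite big_seq [RHS]big_seq; apply: eq_bigr => j jes.
    rewrite /edge_ind {1}/upd; case: eqP => // h; exfalso; move/negP: enes; apply.
    by rewrite -h; apply/mapP; exists j.
  by rewrite {1}/edge_ind {1}/upd eqxx/= [RHS]mulrC mulrA.
rewrite (Ex_ext _ E) ExZ; last first.
  set w := W _ _; split.
    apply: (measurableT_comp (f := fun b : bool => b%:R : R)) => //.
    by apply: measurable_fun_ltr => //; exact: measurable_id.
  by exists 1 => u; case: (_ < _); rewrite ?normr0 ?normr1.
rewrite [RHS]mulrCA [RHS]mulrC; congr (_ * _).
set w := W _ _; have /andP[w0 w1] : 0 <= w <= 1 := W01 _ _.
rewrite Ex_uniform01; last first.
  split.
    apply: (measurableT_comp (f := fun b : bool => b%:R : R)) => //.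
    by apply: measurable_fun_ltr => //; exact: measurable_id.
  by exists 1 => u; case: (_ < _); rewrite ?normr0 ?normr1.
rewrite /Rintegral (_ : (fun u => _) = fun u => (\1_(`]-oo, w[%classic : set R) u)%:E).
  rewrite integral_indic//= (_ : _ `&` _ = `[0, w[%classic :> set R).
    rewrite lebesgue_measure_itv/= lte_fin; case: ltP => [|w0']; first by rewrite oppr0 addr0.
    by apply/eqP; rewrite eq_le w0 w0'.
  apply/seteqP; split => u /=; rewrite !in_itv/=; first by move=> [-> /andP[->]].
  by move=> /andP[u0 uw]; split => //; rewrite u0/= (le_trans (ltW uw)).
apply/funext => u; rewrite indicE; congr (_%:R%:E).
case: ltP => uw; first by rewrite mem_set//= in_itv/=.
by rewrite memNset//= in_itv/=; apply/negP; rewrite -leNgt.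
Qed.

End RandomEdges.

(** * Kernels in the types and edge indicators *)

Section Kernels.
Variables (R : realType) (W : R -> R -> R) (p : nat).
Hypothesis mW : measurable_fun setT (fun z : R * R => W z.1 z.2).
Hypothesis W01 : forall x y, 0 <= W x y <= 1.
Variable nu : probability (cspace R idx) R.
Hypothesis nuP : iid_unif nu.
Implicit Types (E : rel 'I_p) (b : 'I_p -> nat) (z : idx -> R).

Definition edges E : seq ('I_p * 'I_p) :=
  [seq ij : 'I_p * 'I_p <- enum {: 'I_p * 'I_p} | (ij.1 < ij.2)%N && E ij.1 ij.2].

Lemma mem_edges E ij : (ij \in edges E) = (ij.1 < ij.2)%N && E ij.1 ij.2.
Proof. by rewrite mem_filter mem_enum andbT. Qed.

Lemma edge_prodE E (y : 'I_p -> R) :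
  edge_prod W E y = \prod_(ij <- edges E) W (y ij.1) (y ij.2).
Proof.
by rewrite /edge_prod pair_big_dep big_filter big_enum_cond.
Qed.

Lemma eq_edge_prod E (y y' : 'I_p -> R) :
  (forall i j, E i j -> W (y i) (y j) = W (y' i) (y' j)) ->
  edge_prod W E y = edge_prod W E y'.
Proof.
move=> yy'; rewrite !edge_prodE big_seq [RHS]big_seq; apply: eq_bigr => ij.
by rewrite mem_edges => /andP[_ /yy'].
Qed.

Definition edge_inds E b z : R :=
  \prod_(ij <- edges E) edge_ind W z (b ij.1) (b ij.2).

Definition at_vertices b z : 'I_p -> R := fun i => z (inl (b i)).

Lemma measurable_at_vertices b :
  measurable_fun setT (fun z : cspace R idx => at_vertices b z : cspace R 'I_p).
Proof. by apply: measurable_to_cspace => i; exact: measurable_coord. Qed.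

Lemma bmeas_edge_prod E : bmeas (fun y : cspace R 'I_p => edge_prod W E y).
Proof.
apply: (@eq_bmeas _ (cspace R 'I_p) R _ _ (fun y => esym (edge_prodE E y))).
by apply: bmeas_prod => ij _; apply: bmeas_W => //; exact: measurable_coord.
Qed.

Lemma bmeas_edge_inds E b : bmeas (fun z : cspace R idx => edge_inds E b z).
Proof. by apply: bmeas_prod => ij _; exact: bmeas_edge_ind. Qed.

Lemma edge_prod_ge0_le1 E (y : 'I_p -> R) : 0 <= edge_prod W E y <= 1.
Proof.
rewrite edge_prodE; elim/big_ind: _ => [|u v|ij _]; first by rewrite ler01 lexx.
  by move=> /andP[u0 u1] /andP[v0 v1]; rewrite mulr_ge0//= mulr_ile1.
exact: W01.
Qed.

Lemma edge_inds_ge0_le1 E b z : 0 <= edge_inds E b z <= 1.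
Proof.
rewrite /edge_inds; elim/big_ind: _ => [|u v|ij _]; first by rewrite ler01 lexx.
  by move=> /andP[u0 u1] /andP[v0 v1]; rewrite mulr_ge0//= mulr_ile1.
by rewrite /edge_ind; case: (_ < _); rewrite ?lexx ?ler01.
Qed.

Lemma edge_inds_eq01 E b z : edge_inds E b z = 0 \/ edge_inds E b z = 1.
Proof.
rewrite /edge_inds; elim/big_ind: _ => [|u v|ij _]; first by right.
  by move=> [->|->] [->|->]; rewrite ?mul0r ?mulr0 ?mulr1; [left|left|left|right].
by rewrite /edge_ind; case: (_ < _); [right|left].
Qed.

(** Finite combinations of products of edge indicators with coefficients depending on the types. For
    injective [b], replacing the indicators by [W], as in [kernW], gives the conditional mean given
    the types. *)
Definition kern (M : finType) (E : M -> rel 'I_p) (c : M -> ('I_p -> R) -> R) b z : R :=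
  \sum_m c m (at_vertices b z) * edge_inds (E m) b z.

Definition kernW (M : finType) (E : M -> rel 'I_p) (c : M -> ('I_p -> R) -> R)
  (y : 'I_p -> R) : R := \sum_m c m y * edge_prod W (E m) y.

Lemma bmeas_kern (M : finType) (E : M -> rel 'I_p) (c : M -> ('I_p -> R) -> R) b :
  (forall m, bmeas (c m : cspace R 'I_p -> R)) ->
  bmeas (fun z : cspace R idx => kern E c b z).
Proof.
move=> bc; apply: bmeas_sum => m _; apply: bmeasM; last exact: bmeas_edge_inds.
exact: (bmeas_comp (measurable_at_vertices b) (bc m)).
Qed.

Lemma bmeas_kernW (M : finType) (E : M -> rel 'I_p) (c : M -> ('I_p -> R) -> R) :
  (forall m, bmeas (c m : cspace R 'I_p -> R)) ->
  bmeas (kernW E c : cspace R 'I_p -> R).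
Proof.
by move=> bc; apply: bmeas_sum => m _; apply: bmeasM => //; exact: bmeas_edge_prod.
Qed.

Let at_vertices_inr b z e u : at_vertices b (upd z (inr e) u) = at_vertices b z.
Proof. by apply/funext => i; rewrite /at_vertices /upd. Qed.

Let pair_idx b E := [seq eix (b ij.1) (b ij.2) | ij <- edges E].

Let uniq_pair_idx b E : injective b -> uniq (pair_idx b E).
Proof.
move=> injb; rewrite map_inj_in_uniq; first by rewrite filter_uniq// enum_uniq.
move=> [i j] [i' j']; rewrite !mem_edges/= => /andP[ij _] /andP[ij' _] /eix_inj.
case; rewrite ?(inj_eq injb); first by rewrite -val_eqE neq_ltn ij.
- by rewrite -val_eqE neq_ltn ij'.
- by case=> /injb -> /injb ->.
- by case=> /injb h1 /injb h2; move: ij ij'; rewrite h1 h2 ltnNge => /negP h /ltnW.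
Qed.

(** With no pair of vertices in common, the two kernels are conditionally independent given the
    types, so each may be replaced by its conditional mean. After expansion, each term is an
    instance of [Ex_edge_prod] for the concatenated list of pairs. *)
Lemma Ex_kern_mul (M M' : finType) (E : M -> rel 'I_p) (E' : M' -> rel 'I_p)
    (c : M -> ('I_p -> R) -> R) (c' : M' -> ('I_p -> R) -> R) b b' :
  injective b -> injective b' ->
  (forall m, bmeas (c m : cspace R 'I_p -> R)) ->
  (forall m, bmeas (c' m : cspace R 'I_p -> R)) ->
  (forall m m' (i j i' j' : 'I_p), (i < j)%N -> E m i j -> (i' < j')%N -> E' m' i' j' ->
     eix (b i) (b j) != eix (b' i') (b' j')) ->
  Ex nu (fun z => kern E c b z * kern E' c' b' z) =
  Ex nu (fun z => kernW E c (at_vertices b z) * kernW E' c' (at_vertices b' z)).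
Proof.
move=> injb injb' bc bc' disj.
have bcb m := bmeas_comp (measurable_at_vertices b) (bc m).
have bcb' m := bmeas_comp (measurable_at_vertices b') (bc' m).
have bcc m m' := bmeasM (bcb m) (bcb' m').
transitivity (\sum_m \sum_m' Ex nu (fun z =>
    (edge_inds (E m) b z * edge_inds (E' m') b' z) *
    (c m (at_vertices b z) * c' m' (at_vertices b' z)))).
  transitivity (Ex nu (fun z => \sum_m \sum_m'
    (edge_inds (E m) b z * edge_inds (E' m') b' z) *
    (c m (at_vertices b z) * c' m' (at_vertices b' z)))).
    apply: Ex_ext => z; rewrite big_distrlr/=; apply: eq_bigr => m _.
    by apply: eq_bigr => m' _; rewrite mulrACA mulrC.
  rewrite Ex_sum.
    apply: eq_bigr => m _; rewrite Ex_sum// => m' _.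
    by apply: bmeasM => //; apply: bmeasM; exact: bmeas_edge_inds.
  move=> m _; apply: bmeas_sum => m' _.
  by apply: bmeasM => //; apply: bmeasM; exact: bmeas_edge_inds.
transitivity (\sum_m \sum_m' Ex nu (fun z =>
    (edge_prod W (E m) (at_vertices b z) * edge_prod W (E' m') (at_vertices b' z)) *
    (c m (at_vertices b z) * c' m' (at_vertices b' z)))); last first.
  have bee m m' : bmeas (fun z : cspace R idx => edge_prod W (E m) (at_vertices b z) *
      edge_prod W (E' m') (at_vertices b' z)).
    by apply: bmeasM; apply: (bmeas_comp (measurable_at_vertices _) (bmeas_edge_prod _)).
  transitivity (Ex nu (fun z => \sum_m \sum_m'
    (edge_prod W (E m) (at_vertices b z) * edge_prod W (E' m') (at_vertices b' z)) *
    (c m (at_vertices b z) * c' m' (at_vertices b' z)))); last first.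
    apply: Ex_ext => z; rewrite big_distrlr/=; apply: eq_bigr => m _.
    by apply: eq_bigr => m' _; rewrite [RHS]mulrACA [RHS]mulrC.
  rewrite Ex_sum.
    by apply: eq_bigr => m _; rewrite Ex_sum// => m' _; exact: bmeasM.
  by move=> m _; apply: bmeas_sum => m' _; exact: bmeasM.
apply: eq_bigr => m _; apply: eq_bigr => m' _.
pose es := [seq (b ij.1, b ij.2) | ij <- edges (E m)] ++
           [seq (b' ij.1, b' ij.2) | ij <- edges (E' m')].
have ues : uniq [seq eix e.1 e.2 | e <- es].
  rewrite map_cat -!map_comp cat_uniq; apply/and3P; split.
  - exact: (uniq_pair_idx _ injb).
  - apply/hasPn => _ /mapP[[i' j'] + ->]; rewrite mem_edges => /andP[/= ij' E'ij'].
    apply/mapP => -[[i j] ]; rewrite mem_edges => /andP[/= ij Eij] /esym/eqP.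
    by rewrite (negbTE (disj _ _ _ _ _ _ ij Eij ij' E'ij')).
  - exact: (uniq_pair_idx _ injb').
transitivity (Ex nu (fun z => \prod_(e <- es) edge_ind W z e.1 e.2 *
    (c m (at_vertices b z) * c' m' (at_vertices b' z)))).
  by apply: Ex_ext => z; rewrite big_cat !big_map.
rewrite (Ex_edge_prod mW W01 nuP ues (bcc m m')); last first.
  by move=> z e u; rewrite !at_vertices_inr.
by apply: Ex_ext => z; rewrite big_cat !big_map !edge_prodE.
Qed.

(* [psi] is constant while the vertices outside [A] are averaged, and that average kills [D]. *)
Lemma Ex_orthogonal (A : pred 'I_p) b (D : ('I_p -> R) -> R) (psi : (idx -> R) -> R) :
  injective b -> bmeas (D : cspace R 'I_p -> R) -> bmeas (psi : cspace R idx -> R) ->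
  (forall y : 'I_p -> R,
     Ex nu (fun z => D (fun i => if A i then y i else z (inl (b i)))) = 0) ->
  (forall z z', (forall j, (forall i, ~~ A i -> j != inl (b i)) -> z j = z' j) ->
     psi z = psi z') ->
  Ex nu (fun z => D (at_vertices b z) * psi z) = 0.
Proof.
move=> injb bD bpsi D0 psiE.
(* [K] keeps every coordinate except the types of the vertices [b i] with [i] outside [A]; only
   those are resampled. *)
pose K : pred idx := fun j => ~~ [exists i, ~~ A i && (j == inl (b i))].
have Kb i : K (inl (b i)) = A i.
  rewrite /K; apply/idP/idP.
    by apply: contraR => nA; apply/existsP; exists i; rewrite nA eqxx.
  move=> Ai; apply/negP => /existsP[i' /andP[nA /eqP[/injb ii']]].
  by rewrite -ii' Ai in nA.
have bDb := bmeas_comp (measurable_at_vertices b) bD.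
rewrite (Ex_mix nuP K); last exact: bmeasM.
rewrite -[RHS](Ex_cst nu); apply: Ex_ext => z.
transitivity (Ex nu (fun z' => psi z *
    D (fun i => if A i then at_vertices b z i else z' (inl (b i))))); last first.
  rewrite ExZ ?D0 ?mulr0//.
  apply: (bmeas_comp (phi := fun z' : cspace R idx =>
    (fun i => if A i then at_vertices b z i else z' (inl (b i))) : cspace R 'I_p) _ bD).
  apply: measurable_to_cspace => i; case: (A i) => //; exact: measurable_coord.
apply: Ex_ext => z'; rewrite mulrC; congr (_ * _).
  apply: psiE => j jA; rewrite /mix; case: ifPn => // /negPn/existsP[i /andP[nA /eqP ji]].
  by have := jA i nA; rewrite ji eqxx.
by congr D; apply/funext => i; rewrite /at_vertices /mix Kb.
Qed.

Lemma mem_free (lam : seq 'I_p) q : (q \in Defs.free lam) = (q \notin lam).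
Proof. by rewrite mem_filter mem_enum andbT. Qed.

Lemma uniq_free (lam : seq 'I_p) : uniq (Defs.free lam).
Proof. by rewrite filter_uniq// enum_uniq. Qed.

Definition along b (s : seq 'I_p) : nat -> idx := nth (inl 0) [seq inl (b q) | q <- s].

Lemma along_index b (s : seq 'I_p) q : q \in s -> along b s (index q s) = inl (b q).
Proof. by move=> qs; rewrite /along (nth_map q) ?index_mem// nth_index. Qed.

Lemma along_inj b (s : seq 'I_p) : injective b -> uniq s ->
  {in gtn (size s) &, injective (along b s)}.
Proof.
move=> injb us i j; rewrite !inE => ilt jlt /eqP.
rewrite /along nth_uniq ?size_map//; first by move/eqP.
by rewrite map_inj_uniq// => q q' [/injb].
Qed.

Lemma measurable_assign (lam : seq 'I_p) (x : nat -> R) :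
  measurable_fun setT (fun w : cspace R nat => assign lam x w : cspace R 'I_p).
Proof.
apply: measurable_to_cspace => q; rewrite /assign; case: (q \in lam) => //.
exact: measurable_coord.
Qed.

(** The types of the unlabelled vertices are read in the order of [free lam], the order in which
    [assign] distributes the integration variables. *)
Lemma Ex_free (lam : seq 'I_p) b (x : nat -> R) (Psi : ('I_p -> R) -> R) :
  injective b -> bmeas (Psi : cspace R 'I_p -> R) ->
  Ex nu (fun z => Psi (fun i => if i \in lam then x (index i lam) else z (inl (b i)))) =
  cube_int (size (Defs.free lam)) (fun w => Psi (assign lam x w)).
Proof.
move=> injb bPsi.
rewrite (@cube_int_Ex _ _ nu _ (along b (Defs.free lam)))//.
- apply: Ex_ext => z; congr Psi; apply/funext => q; rewrite /assign; case: ifPn => // qlam.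
  have qf : q \in Defs.free lam by rewrite mem_free.
  by rewrite /trunc index_mem qf/= along_index.
- by apply: along_inj => //; exact: uniq_free.
- exact: (bmeas_comp (measurable_assign lam x) bPsi).
Qed.

Lemma Ex_labels (l : seq 'I_p) b (Psi : (nat -> R) -> R) :
  injective b -> uniq l -> bmeas (Psi : cspace R nat -> R) ->
  Ex nu (fun z => Psi (trunc (size l) (z \o along b l))) = cube_int (size l) Psi.
Proof.
by move=> injb ul bPsi; rewrite (@cube_int_Ex _ _ nu _ (along b l))//; exact: along_inj.
Qed.

End Kernels.
Lemma sum_option (V : nmodType) (M : finType) (f : option M -> V) :
  \sum_m f m = f None + \sum_m f (Some m).
Proof.
rewrite (bigD1 None)//=; congr (_ + _); rewrite (reindex_omap Some id) => [|[]//].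
by apply: eq_bigl => m /=; rewrite eqxx.
Qed.

(** * Hoeffding projection of the subgraph kernel *)

Section Projection.
Variables (R : realType) (W : R -> R -> R) (d p : nat) (F : 'I_d -> rel 'I_p).
Variable l : seq 'I_p.
Hypothesis mW : measurable_fun setT (fun z : R * R => W z.1 z.2).
Hypothesis W01 : forall x y, 0 <= W x y <= 1.
Variable nu : probability (cspace R idx) R.
Hypothesis nuP : iid_unif nu.
Hypotheses (ul : uniq l) (compF : compatible F l).
Variables (G : 'rV[R]_d -> R) (G' : 'I_d -> 'rV[R]_d -> R).
Let k := size l.
Notation theta := (tilde_t_x F W l).
Notation hat := (hat_t_x F W l).
Hypothesis bG : bmeas (fun x : cspace R nat => G (theta x)).
Hypothesis bG' : forall m, bmeas (fun x : cspace R nat => G' m (theta x)).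
Implicit Types (b : 'I_p -> nat) (x : nat -> R) (y : 'I_p -> R).

Definition unlab (m : 'I_d) : rel 'I_p := fun i j => F m i j && ~~ Elab F l i j.

Definition lab_coords y : nat -> R := nth 0 [seq y q | q <- l].

Lemma lab_coords_index y q : q \in l -> lab_coords y (index q l) = y q.
Proof. by move=> ql; rewrite /lab_coords (nth_map q) ?index_mem// nth_index. Qed.

(** Both sides vanish beyond [k], hence [trunc] on the right rather than [x] itself. *)
Lemma lab_coordsE y x : (forall q, q \in l -> y q = x (index q l)) ->
  lab_coords y = trunc k x.
Proof.
move=> yx; apply/funext => j; rewrite /trunc; case: ltnP => jk; last first.
  by rewrite /lab_coords nth_default// size_map.
have [q0 _] : exists q : 'I_p, q \in l.
  by move: jk; rewrite /k; case: (l) => // q s _; exists q; rewrite inE eqxx.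
rewrite -[j in LHS](index_uniq q0 jk ul) lab_coords_index ?mem_nth// yx ?mem_nth//.
by rewrite index_uniq.
Qed.

Lemma measurable_lab_coords :
  measurable_fun setT (fun y : cspace R 'I_p => lab_coords y : cspace R nat).
Proof.
apply: measurable_to_cspace => j; rewrite /lab_coords.
have [jk|jk] := ltnP j (size l); last first.
  rewrite [X in measurable_fun _ X](_ : _ = fun=> 0)//.
  by apply/funext => y; rewrite nth_default// size_map.
have [q0 _] : exists q : 'I_p, q \in l.
  by move: jk; case: (l) => // q s _; exists q; rewrite inE eqxx.
rewrite [X in measurable_fun _ X](_ : _ = fun y : cspace R 'I_p => y (nth q0 l j)).
  exact: measurable_coord.
by apply/funext => y; rewrite (nth_map q0).
Qed.

Lemma assign_trunc x w : assign l (trunc k x) w = assign l x w.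
Proof.
apply/funext => q; rewrite /assign; case: ifP => // ql.
by rewrite /trunc /k index_mem ql.
Qed.

Lemma theta_trunc x : theta (trunc k x) = theta x.
Proof.
apply/rowP => m; rewrite !mxE; congr cube_int; apply/funext => w.
by rewrite assign_trunc.
Qed.

Lemma edge_prod_lab (y y' : 'I_p -> R) : (forall q, q \in l -> y q = y' q) ->
  edge_prod W (Elab F l) y = edge_prod W (Elab F l) y'.
Proof. by move=> yy'; apply: eq_edge_prod => i j /and3P[il jl _]; rewrite !yy'. Qed.

Lemma hat_trunc x : hat (trunc k x) = hat x.
Proof. by apply: edge_prod_lab => q ql; rewrite /trunc /k index_mem ql. Qed.

Lemma hat_lab y : edge_prod W (Elab F l) y = hat (lab_coords y).
Proof. by apply: edge_prod_lab => q ql; rewrite lab_coords_index. Qed.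

(** The edges of [Elab] belong to every [F m], so they split off from [F m] with the same factor for
    all [m]. *)
Lemma edge_prod_split m y :
  edge_prod W (F m) y = edge_prod W (Elab F l) y * edge_prod W (unlab m) y.
Proof.
rewrite !edge_prodE !big_filter !big_enum_cond/= (bigID (fun ij => Elab F l ij.1 ij.2))/=.
congr (_ * _); apply: eq_bigl => ij; rewrite /unlab -andbA//.
congr (_ && _); apply/idP/idP => [/andP[]//|E1]; rewrite E1 andbT.
by move: E1 => /and3P[_ _ /forallP].
Qed.

Lemma edge_inds_split m b z :
  edge_inds W (F m) b z = edge_inds W (Elab F l) b z * edge_inds W (unlab m) b z.
Proof.
rewrite /edge_inds !big_filter !big_enum_cond/= (bigID (fun ij => Elab F l ij.1 ij.2))/=.
congr (_ * _); apply: eq_bigl => ij; rewrite /unlab -andbA//.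
congr (_ && _); apply/idP/idP => [/andP[]//|E1]; rewrite E1 andbT.
by move: E1 => /and3P[_ _ /forallP].
Qed.

(** Here the Compatibility Condition enters: an edge of one [F m] between two labels is an edge of
    all of them, hence lies in [Elab] and has been removed. *)
Lemma unlab_free m i j : unlab m i j -> (i \notin l) || (j \notin l).
Proof.
rewrite -negb_and /unlab => /andP[Fm]; apply: contra => /andP[il jl].
by rewrite /Elab il jl; apply/forallP => m'; rewrite (compF m' m).
Qed.

Lemma bmeas_theta m : bmeas (fun x : cspace R nat => theta x 0 m).
Proof.
apply: (@eq_bmeas _ (cspace R nat) R (fun x => cube_int (size (Defs.free l))
   (fun w => edge_prod W (unlab m) (assign l x w)))).
  by move=> x; rewrite !mxE.
apply: (@bmeas_cube_int _ _ (cspace R nat) _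
  (fun x w => edge_prod W (unlab m) (assign l x w))).
apply: (bmeas_comp (phi := fun z : cspace R nat * cspace R nat =>
  assign l z.1 z.2 : cspace R 'I_p) _ (bmeas_edge_prod mW W01 (unlab m))).
apply: measurable_to_cspace => q; rewrite /assign; case: (q \in l).
  exact: (measurableT_comp (measurable_coord _) measurable_fst).
exact: (measurableT_comp (measurable_coord _) measurable_snd).
Qed.

Lemma bmeas_hat : bmeas (hat : cspace R nat -> R).
Proof.
apply: (bmeas_comp (phi := fun x : cspace R nat => (fun q => x (index q l)) : cspace R 'I_p)
  _ (bmeas_edge_prod mW W01 (Elab F l))).
by apply: measurable_to_cspace => q; exact: measurable_coord.
Qed.

Definition Hedges (m : option 'I_d) : rel 'I_p := if m is Some m then F m else Elab F l.

(** With [I] the label-edge indicator and [tau] the average of the unlabelled products, the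
    first-order expansion of [G] at [theta] is [I * (G theta - G 0 + sum_m G' m theta * (tau m -
    theta m))]. [Hrest] collects what multiplies [I] alone, the index [None] of the kernel, while
    [G' m theta] multiplies [I * tau m], whose summands are the edge products of [F m], the index
    [Some m]. *)
Definition Hrest x : R := G (theta x) - G 0 - \sum_m G' m (theta x) * theta x 0 m.

Definition Hcoef (m : option 'I_d) y : R :=
  if m is Some m then G' m (theta (lab_coords y)) else Hrest (lab_coords y).

Definition Hmean x : R := hat x * (G (theta x) - G 0).

Lemma bmeas_Hrest : bmeas (Hrest : cspace R nat -> R).
Proof.
apply: bmeasB; first by apply: bmeasB => //; exact: bmeas_cst.
by apply: bmeas_sum => m _; apply: bmeasM => //; exact: bmeas_theta.
Qed.

Lemma bmeas_Hmean : bmeas (Hmean : cspace R nat -> R).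
Proof.
apply: bmeasM; first exact: bmeas_hat.
by apply: bmeasB => //; exact: bmeas_cst.
Qed.

Lemma bmeas_Hcoef m : bmeas (Hcoef m : cspace R 'I_p -> R).
Proof.
case: m => [m|].
  exact: (bmeas_comp (measurable_lab_coords) (bG' m)).
exact: (bmeas_comp (measurable_lab_coords) bmeas_Hrest).
Qed.

Lemma Hrest_trunc x : Hrest (trunc k x) = Hrest x.
Proof. by rewrite /Hrest theta_trunc. Qed.

Notation Hhat := (kernW W Hedges Hcoef).

Lemma HhatE y : Hhat y = hat (lab_coords y) * Hrest (lab_coords y) +
  \sum_m G' m (theta (lab_coords y)) * edge_prod W (F m) y.
Proof. by rewrite /kernW sum_option /= hat_lab mulrC. Qed.

Lemma measurable_patch (A : pred 'I_p) b y : measurable_fun setT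
  (fun z : cspace R idx => (fun i => if A i then y i else z (inl (b i))) : cspace R 'I_p).
Proof.
apply: measurable_to_cspace => i; case: (A i) => //; exact: measurable_coord.
Qed.

Lemma Ex_edge_prod_theta b x m : injective b ->
  Ex nu (fun z => edge_prod W (unlab m)
    (fun i => if i \in l then x (index i l) else z (inl (b i)))) = theta x 0 m.
Proof.
move=> injb; rewrite (Ex_free nuP l x injb (bmeas_edge_prod mW W01 (unlab m))).
by rewrite !mxE.
Qed.

(** Averaging the unlabelled vertices turns each product over [unlab m] into [theta m], so the
    first-order terms cancel against those subtracted in [Hrest]. *)
Lemma Ex_Hhat_free b x : injective b ->
  Ex nu (fun z => Hhat (fun i => if i \in l then x (index i l) else z (inl (b i)))) = Hmean x.
Proof.
move=> injb; pose Y (z : idx -> R) i := if i \in l then x (index i l) else z (inl (b i)) : R.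
have labY z : lab_coords (Y z) = trunc k x.
  by apply: lab_coordsE => q ql; rewrite /Y ql.
have bE m : bmeas (fun z : cspace R idx => edge_prod W (unlab m) (Y z)).
  apply: (bmeas_comp (phi := fun z : cspace R idx => Y z : cspace R 'I_p) _
    (bmeas_edge_prod mW W01 (unlab m))).
  exact: (measurable_patch (mem l) b (fun i => x (index i l))).
transitivity (Ex nu (fun z => hat x * Hrest x +
   \sum_m (G' m (theta x) * hat x) * edge_prod W (unlab m) (Y z))).
  apply: Ex_ext => z; rewrite HhatE labY hat_trunc Hrest_trunc; congr (_ + _).
  apply: eq_bigr => m _; rewrite theta_trunc edge_prod_split hat_lab labY hat_trunc.
  exact: mulrA.
rewrite ExD; [|exact: bmeas_cst|]; last first.
  by apply: bmeas_sum => m _; apply: bmeasM => //; exact: bmeas_cst.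
rewrite Ex_cst Ex_sum; last by move=> m _; apply: bmeasM => //; exact: bmeas_cst.
under eq_bigr do rewrite ExZ// Ex_edge_prod_theta//.
have -> : \sum_m G' m (theta x) * hat x * theta x 0 m =
    hat x * \sum_m G' m (theta x) * theta x 0 m.
  by rewrite mulr_sumr; apply: eq_bigr => m _; rewrite mulrAC mulrC.
by rewrite /Hmean /Hrest -mulrDr subrK.
Qed.

Lemma Ex_split_labels b (Psi : ('I_p -> R) -> R) : injective b ->
  bmeas (Psi : cspace R 'I_p -> R) ->
  Ex nu (fun z => Psi (at_vertices b z)) =
  Ex nu (fun z => Ex nu (fun z' => Psi (fun i =>
    if i \in l then trunc k (z \o along b l) (index i l) else z' (inl (b i))))).
Proof.
move=> injb bPsi; pose K : pred idx := fun j => [exists i, (i \in l) && (j == inl (b i))].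
rewrite (Ex_mix nuP K); last exact: (bmeas_comp (measurable_at_vertices b) bPsi).
apply: Ex_ext => z; apply: Ex_ext => z'; congr Psi; apply/funext => i.
rewrite /at_vertices /mix; case: ifPn => [Ki|nKi].
  have il : i \in l.
    by case/existsP: Ki => i' /andP[il /eqP[/injb ->]].
  by rewrite il /trunc /k index_mem il/= along_index.
case: ifPn => // il; case/existsP: nKi; exists i; by rewrite il eqxx.
Qed.

Lemma bmeas_Hhat : bmeas (Hhat : cspace R 'I_p -> R).
Proof. by apply: bmeas_kernW => // m; exact: bmeas_Hcoef. Qed.

Definition Hmu : R := cube_int k Hmean.

Lemma Ex_Hhat b : injective b -> Ex nu (fun z => Hhat (at_vertices b z)) = Hmu.
Proof.
move=> injb; rewrite Ex_split_labels//; last exact: bmeas_Hhat.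
rewrite /Hmu -(Ex_labels nuP injb ul bmeas_Hmean).
by apply: Ex_ext => z; exact: Ex_Hhat_free.
Qed.

(* The conditional mean of the Hoeffding kernel given that the vertex [q] has type [u]. *)
Definition vertex_proj (q : 'I_p) (u : R) : R :=
  if q \in l then cube_int k (fun x => Hmean (setc x (index q l) u))
  else cube_int k (fun x => hat x * Hrest x) +
    cube_int k (fun x => \sum_m t_lab F W (rcons l q) (setc x k u) m * G' m (theta x)).

Lemma measurable_upd_vertex (q : 'I_p) (u : R) :
  measurable_fun setT (fun y : cspace R 'I_p => upd y q u : cspace R 'I_p).
Proof.
apply: measurable_to_cspace => i; rewrite /upd; case: (i == q) => //.
exact: measurable_coord.
Qed.

Lemma bmeas_t_lab lam m : bmeas (fun x : cspace R nat => t_lab F W lam x m).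
Proof.
apply: (@bmeas_cube_int _ _ (cspace R nat) _
  (fun x w => edge_prod W (F m) (assign lam x w))).
apply: (bmeas_comp (phi := fun z : cspace R nat * cspace R nat =>
  assign lam z.1 z.2 : cspace R 'I_p) _ (bmeas_edge_prod mW W01 (F m))).
apply: measurable_to_cspace => q; rewrite /assign; case: (q \in lam).
  exact: (measurableT_comp (measurable_coord _) measurable_fst).
exact: (measurableT_comp (measurable_coord _) measurable_snd).
Qed.

(** If [q] is a label, averaging the free vertices gives [Hmean] with one coordinate replaced by
    [u]. If [q] is free, the label types are fixed first; averaging the vertices outside [rcons l q]
    then produces [t_lab]. *)
Lemma Ex_Hhat_vertex b q u : injective b ->
  Ex nu (fun z => Hhat (fun i => if i == q then u else z (inl (b i)))) = vertex_proj q u.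
Proof.
move=> injb; rewrite (@Ex_ext _ _ _ nu _ (fun z => Hhat (upd (at_vertices b z) q u)))//.
have bU := bmeas_comp (measurable_upd_vertex q u) bmeas_Hhat.
rewrite (Ex_split_labels injb bU) /vertex_proj; case: ifPn => ql.
  have bM : bmeas (fun x : cspace R nat => Hmean (setc x (index q l) u)).
    apply: (bmeas_comp (phi := fun x : cspace R nat => setc x (index q l) u : cspace R nat)
      _ bmeas_Hmean).
    by apply: measurable_setc => //; exact: measurable_id.
  rewrite -(Ex_labels nuP injb ul bM).
  apply: Ex_ext => z; rewrite -(Ex_Hhat_free _ injb); apply: Ex_ext => z'; congr Hhat.
  apply/funext => i; rewrite /upd; case: eqP => [->|iq]; first by rewrite ql /setc eqxx.
  case: ifPn => // il; rewrite /setc; case: eqP => // ii.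
  by case: iq; rewrite -(nth_index i il) ii nth_index.
have bR : bmeas (fun x : cspace R nat => hat x * Hrest x).
  by apply: bmeasM; [exact: bmeas_hat|exact: bmeas_Hrest].
have bS : bmeas (fun x : cspace R nat =>
    \sum_m t_lab F W (rcons l q) (setc x k u) m * G' m (theta x)).
  apply: bmeas_sum => m _; apply: bmeasM => //.
  apply: (bmeas_comp (phi := fun x : cspace R nat => setc x k u : cspace R nat)
      _ (bmeas_t_lab (rcons l q) m)).
  by apply: measurable_setc => //; exact: measurable_id.
rewrite -(Ex_labels nuP injb ul bR) -(Ex_labels nuP injb ul bS) -ExD; last 2 first.
- exact: (bmeas_comp (measurable_trunc k (along b l)) bR).
- exact: (bmeas_comp (measurable_trunc k (along b l)) bS).
apply: Ex_ext => z; set x := trunc k _.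
(* The new label [q] is at position [k = size l] of [rcons l q], where [setc x k u] reads [u]. *)
pose Y (z' : idx -> R) i := if i \in rcons l q then setc x k u (index i (rcons l q))
  else z' (inl (b i)) : R.
have YE z' : upd (fun i => if i \in l then x (index i l) else z' (inl (b i))) q u = Y z'.
  apply/funext => i; rewrite /Y /upd mem_rcons inE -cats1 index_cat.
  case: eqP => [->|iq]/=; first by rewrite (negbTE ql)/= eqxx addn0 /setc eqxx.
  case: ifPn => // il; rewrite /setc; case: eqP => // ii.
  by have := index_mem i l; rewrite il ii ltnn.
have labY z' : lab_coords (Y z') = trunc k x.
  apply: lab_coordsE => i il; rewrite -YE /upd; case: eqP => [iq|_]; last by rewrite il.
  by rewrite iq (negbTE ql) in il.
have bE m : bmeas (fun z : cspace R idx => edge_prod W (F m) (Y z)).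
  apply: (bmeas_comp (phi := fun z : cspace R idx => Y z : cspace R 'I_p) _
    (bmeas_edge_prod mW W01 (F m))).
  exact: (measurable_patch (mem (rcons l q)) b
    (fun i => setc x k u (index i (rcons l q)))).
transitivity (Ex nu (fun z' => hat x * Hrest x +
   \sum_m G' m (theta x) * edge_prod W (F m) (Y z'))).
  apply: Ex_ext => z'; rewrite YE HhatE labY hat_trunc Hrest_trunc; congr (_ + _).
  by apply: eq_bigr => m _; rewrite theta_trunc.
rewrite ExD; [|exact: bmeas_cst|]; last first.
  by apply: bmeas_sum => m _; apply: bmeasM => //; exact: bmeas_cst.
rewrite Ex_cst Ex_sum; last by move=> m _; apply: bmeasM => //; exact: bmeas_cst.
congr (_ + _); apply: eq_bigr => m _; rewrite ExZ// mulrC; congr (_ * _).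
exact: (Ex_free nuP (rcons l q) (setc x k u) injb (bmeas_edge_prod mW W01 (F m))).
Qed.

Lemma bmeas_vertex_proj q : bmeas (vertex_proj q).
Proof.
apply: (@eq_bmeas _ R R (fun u => Ex nu (fun z : cspace R idx =>
   Hhat (fun i => if i == q then u else z (inl (val i)))))).
  by move=> u; rewrite (Ex_Hhat_vertex q u val_inj).
apply: (@bmeas_Ex2 _ _ R (cspace R idx) R nu (fun uz =>
  Hhat (fun i => if i == q then uz.1 else uz.2 (inl (val i))))).
apply: (bmeas_comp (phi := fun uz : R * cspace R idx =>
  (fun i => if i == q then uz.1 else uz.2 (inl (val i))) : cspace R 'I_p) _ bmeas_Hhat).
apply: measurable_to_cspace => i; case: (i == q); first exact: measurable_fst.
exact: (measurableT_comp (measurable_coord _) measurable_snd).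
Qed.

Lemma mean_vertex_proj q : Rintegral lebesgue_measure `[0, 1]%classic (vertex_proj q) = Hmu.
Proof.
rewrite -(Ex_Hhat (@val_inj _ _ _)) (Ex_resample nuP (inl (val q))); last first.
  exact: (bmeas_comp (measurable_at_vertices _) bmeas_Hhat).
apply: eq_Rintegral => u _; rewrite -[LHS](Ex_Hhat_vertex q u (@val_inj _ _ _)).
by apply: Ex_ext => z; congr Hhat.
Qed.

Definition Hproj y : R := \sum_q (vertex_proj q (y q) - Hmu).

(** The extra index [None] is an edgeless term with coefficient minus the mean and the projection,
    so that the Hoeffding remainder is again a [kern] and [Ex_kern_mul] applies to it. *)
Definition Dedges (m : option (option 'I_d)) : rel 'I_p :=
  if m is Some m then Hedges m else fun _ _ => false.

Definition Dcoef (m : option (option 'I_d)) y : R :=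
  if m is Some m then Hcoef m y else - (Hmu + Hproj y).

Lemma bmeas_Hproj : bmeas (Hproj : cspace R 'I_p -> R).
Proof.
apply: bmeas_sum => q _; apply: bmeasB; last exact: bmeas_cst.
exact: (bmeas_comp (measurable_coord q) (bmeas_vertex_proj q)).
Qed.

Lemma bmeas_Dcoef m : bmeas (Dcoef m : cspace R 'I_p -> R).
Proof.
case: m => [m|]; first exact: bmeas_Hcoef.
by apply: bmeasN; apply: bmeasD; [exact: bmeas_cst|exact: bmeas_Hproj].
Qed.

Lemma edges_false : edges (fun _ _ : 'I_p => false) = [::].
Proof. by rewrite /edges (eq_filter (a2 := pred0)) ?filter_pred0// => ij; rewrite andbF. Qed.

Lemma kern_DE b z : kern W Dedges Dcoef b z =
  kern W Hedges Hcoef b z - Hmu - Hproj (at_vertices b z).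
Proof.
rewrite /kern sum_option/= {1}/edge_inds edges_false big_nil mulr1 addrC.
by rewrite opprD addrA.
Qed.

Lemma kernW_DE y : kernW W Dedges Dcoef y = Hhat y - Hmu - Hproj y.
Proof.
rewrite /kernW sum_option/= {1}edge_prodE edges_false big_nil mulr1 addrC.
by rewrite opprD addrA.
Qed.

(** Once the type at [q] is fixed, the mean of the kernel is [vertex_proj q], which the projection
    subtracts; the projections at the other vertices average to 0. The remainder is thus degenerate
    with respect to every single vertex. *)
Lemma Ex_D_vertex b q y : injective b ->
  Ex nu (fun z => kernW W Dedges Dcoef
    (fun i => if pred1 q i then y i else z (inl (b i)))) = 0.
Proof.
move=> injb.
have bV q' : bmeas (fun z : cspace R idx =>
    vertex_proj q' (if q' == q then y q' else z (inl (b q'))) - Hmu).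
  apply: bmeasB; last exact: bmeas_cst; case: (q' == q); first exact: bmeas_cst.
  exact: (bmeas_comp (measurable_coord _) (bmeas_vertex_proj q')).
have bHq : bmeas (fun z : cspace R idx =>
    Hhat (fun i => if i == q then y i else z (inl (b i)))).
  exact: (bmeas_comp (measurable_patch (pred1 q) b y) bmeas_Hhat).
transitivity (Ex nu (fun z => Hhat (fun i => if i == q then y i else z (inl (b i)))
   - Hmu - \sum_q' (vertex_proj q' (if q' == q then y q' else z (inl (b q'))) - Hmu))).
  by apply: Ex_ext => z; rewrite kernW_DE.
rewrite ExB; [|by apply: bmeasB => //; exact: bmeas_cst|exact: bmeas_sum].
rewrite ExB//; last exact: bmeas_cst.
rewrite Ex_cst Ex_sum// (bigD1 q)//= eqxx Ex_cst big1 => [|q' q'q].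
  rewrite (@Ex_ext _ _ _ nu _ (fun z => Hhat (fun i => if i == q then y q else z (inl (b i))))).
    by rewrite Ex_Hhat_vertex// addr0 subrr.
  by move=> z; congr Hhat; apply/funext => i; case: eqP => // ->.
rewrite (negbTE q'q) ExB; [|exact: (bmeas_comp (measurable_coord _) (bmeas_vertex_proj q'))|exact: bmeas_cst].
by rewrite Ex_cst (Ex_coord nuP _ (bmeas_vertex_proj q')) mean_vertex_proj subrr.
Qed.

Lemma eix_disjoint b b' (i j i' j' : 'I_p) : injective b -> injective b' ->
  i != j -> i' != j' -> (forall i0, b i != b' i0) \/ (forall i0, b j != b' i0) ->
  eix (b i) (b j) != eix (b' i') (b' j').
Proof.
move=> injb injb' ij ij' h; apply/eqP => /eix_inj.
rewrite !inj_eq// => /(_ ij ij') E; case: h => h.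
  by case: E => -[E _]; [have := h i'|have := h j']; rewrite E eqxx.
by case: E => -[_ E]; [have := h j'|have := h i']; rewrite E eqxx.
Qed.

(** Only [b q0] can be a common vertex, so no pair is common and the indicators become values of
    [W]. Averaging the types at the [b i] with [i != q0], which the second factor does not see,
    kills the first factor by [Ex_D_vertex]. *)
Lemma Ex_D_orthogonal b b' q0 : injective b -> injective b' ->
  (forall i i', i != q0 -> b i != b' i') ->
  Ex nu (fun z => kern W Dedges Dcoef b z * kern W Dedges Dcoef b' z) = 0.
Proof.
move=> injb injb' bb'; rewrite Ex_kern_mul//; last 3 first.
- exact: bmeas_Dcoef.
- exact: bmeas_Dcoef.
- move=> m m' i j i' j' ij _ ij' _; apply: eix_disjoint => //.
  + by rewrite neq_ltn ij.
  + by rewrite neq_ltn ij'.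
  + have [iq|iq] := eqVneq i q0; last by left => i0; exact: bb'.
    right => i0; apply: bb'; rewrite -iq neq_ltn ij orbT//.
have bD := bmeas_kernW mW W01 Dedges bmeas_Dcoef.
apply: (Ex_orthogonal nuP (A := pred1 q0) injb bD).
- exact: (bmeas_comp (measurable_at_vertices b') bD).
- by move=> y; exact: Ex_D_vertex.
- move=> z z' zz'; congr (kernW _ _ _ _); apply/funext => i'.
  by apply: zz' => i /= iq; apply/eqP => -[/esym/eqP]; apply/negP; exact: bb'.
Qed.

(** The centred edge product [J], written as a two-term kernel: [true] for the product over
    [unlab m], [false] for the subtracted mean [theta]. *)
Definition Jedges m (o : bool) : rel 'I_p := if o then unlab m else fun _ _ => false.

Definition Jcoef m (o : bool) y : R := if o then 1 else - theta (lab_coords y) 0 m.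

Lemma bmeas_Jcoef m o : bmeas (Jcoef m o : cspace R 'I_p -> R).
Proof.
case: o; first exact: bmeas_cst.
by apply: bmeasN; exact: (bmeas_comp measurable_lab_coords (bmeas_theta m)).
Qed.

Lemma kern_JE m b z : kern W (Jedges m) (Jcoef m) b z =
  edge_inds W (unlab m) b z - theta (lab_coords (at_vertices b z)) 0 m.
Proof.
by rewrite /kern big_bool/= /edge_inds edges_false big_nil mul1r mulr1.
Qed.

Lemma kernW_JE m y : kernW W (Jedges m) (Jcoef m) y =
  edge_prod W (unlab m) y - theta (lab_coords y) 0 m.
Proof.
rewrite /kernW big_bool/= mul1r; congr (_ + _).
by rewrite edge_prodE edges_false big_nil mulr1.
Qed.

(** Every edge of [unlab m] has an unlabelled endpoint, whose image the other injection avoids, so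
    no pair is shared even though the labels may be. Averaging the unlabelled types of [b] then
    cancels [theta]. *)
Lemma Ex_J_orthogonal m b b' : injective b -> injective b' ->
  (forall i i', i \notin l -> b i != b' i') ->
  Ex nu (fun z => kern W (Jedges m) (Jcoef m) b z * kern W (Jedges m) (Jcoef m) b' z) = 0.
Proof.
move=> injb injb' bb'; rewrite Ex_kern_mul//; last 3 first.
- exact: bmeas_Jcoef.
- exact: bmeas_Jcoef.
- move=> [] [] i j i' j' ij //= Eij ij' _; apply: eix_disjoint => //.
  + by rewrite neq_ltn ij.
  + by rewrite neq_ltn ij'.
  + by case/orP: (unlab_free Eij) => h; [left|right] => i0; exact: bb'.
have bD := bmeas_kernW mW W01 (Jedges m) (bmeas_Jcoef m).
apply: (Ex_orthogonal nuP (A := mem l) injb bD).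
- exact: (bmeas_comp (measurable_at_vertices b') bD).
- move=> y; pose x := lab_coords y.
  pose Y (z : idx -> R) i := if i \in l then x (index i l) else z (inl (b i)) : R.
  have bE : bmeas (fun z : cspace R idx => edge_prod W (unlab m) (Y z)).
    apply: (bmeas_comp (phi := fun z : cspace R idx => Y z : cspace R 'I_p) _
      (bmeas_edge_prod mW W01 (unlab m))).
    exact: (measurable_patch (mem l) b (fun i => x (index i l))).
  transitivity (Ex nu (fun z => edge_prod W (unlab m) (Y z) - theta x 0 m)).
    apply: Ex_ext => z; have -> : (fun i => if mem l i then y i else z (inl (b i))) = Y z.
      apply/funext => i; rewrite /Y; have [il|il] := boolP (i \in l).
        by rewrite /x lab_coords_index// ifT.
      by rewrite ifN.
    rewrite kernW_JE (@lab_coordsE (Y z) x) ?theta_trunc// => q ql.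
    by rewrite /Y ql.
  by rewrite ExB//; [rewrite Ex_cst Ex_edge_prod_theta// subrr|exact: bmeas_cst].
- move=> z z' zz'; congr (kernW _ _ _ _); apply/funext => i'.
  by apply: zz' => i /= il; apply/eqP => -[/esym/eqP]; apply/negP; exact: bb'.
Qed.

End Projection.
(** * Counting injections *)

Section InjectionCounting.
Variables (p n : nat).
Implicit Types (lam : seq 'I_p) (f : {ffun 'I_p -> 'I_n}).

Definition injs (r : nat) : {set {ffun 'I_r -> 'I_n}} := [set f : {ffun 'I_r -> 'I_n} | injectiveb f]%SET.

Definition fib lam (a : {ffun 'I_(size lam) -> 'I_n}) : {set {ffun 'I_p -> 'I_n}} :=
  [set f : {ffun 'I_p -> 'I_n} | injectiveb f &&
     [forall i : 'I_(size lam), f (tnth (in_tuple lam) i) == a i]]%SET.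

Lemma card_injs r : #|injs r| = (n ^_ r)%N.
Proof. by rewrite card_inj_ffuns !card_ord. Qed.

(** Each list is completed by its complement to an enumeration of [T], and [g] maps one enumeration
    to the other position by position. *)
Lemma extend_injection (T : finType) (s s' : seq T) : uniq s -> uniq s' -> size s = size s' ->
  exists g : T -> T, injective g /\ forall i x0, (i < size s)%N -> g (nth x0 s i) = nth x0 s' i.
Proof.
move=> us us' ss'; pose c (t : seq T) := t ++ [seq x <- enum T | x \notin t].
have uc t : uniq t -> uniq (c t).
  move=> ut; rewrite cat_uniq ut filter_uniq ?enum_uniq// andbT.
  by apply/hasPn => x; rewrite mem_filter => /andP[].
have memc t x : x \in c t by rewrite mem_cat mem_filter mem_enum andbT orbN.
have sizec t : uniq t -> size (c t) = #|T|.
  move=> ut; rewrite cardE; apply: perm_size; apply: uniq_perm; [exact: uc|exact: enum_uniq|].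
  by move=> x; rewrite memc mem_enum.
exists (fun x => nth x (c s') (index x (c s))); split.
  move=> x y; have xs : (index x (c s) < size (c s'))%N by rewrite sizec// -(sizec s)// index_mem memc.
  have ys : (index y (c s) < size (c s'))%N by rewrite sizec// -(sizec s)// index_mem memc.
  rewrite (set_nth_default y)// => /eqP; rewrite nth_uniq ?uc// => /eqP.
  by move/index_inj; apply; rewrite ?memc.
move=> i x0 si; rewrite (set_nth_default x0); last first.
  by rewrite sizec// -(sizec s)// index_mem memc.
by rewrite /c index_cat mem_nth// index_uniq// nth_cat -ss' si.
Qed.

Lemma fibP lam (a : {ffun 'I_(size lam) -> 'I_n}) f :
  reflect (injective f /\ forall i, f (tnth (in_tuple lam) i) = a i)
  (f \in fib a).
Proof.
rewrite inE; apply: (iffP andP) => -[/injectiveP injf h]; split => //.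
  by move=> i; apply/eqP; move/forallP: h.
by apply/forallP => i; apply/eqP.
Qed.

(** Composition with a permutation of the vertices carrying [a] to [a'] embeds one fibre into the
    other. With the roles exchanged, all fibres have the same cardinal. *)
Lemma leq_card_fib lam (a a' : {ffun 'I_(size lam) -> 'I_n}) :
  injective a -> injective a' -> (#|fib a| <= #|fib a'|)%N.
Proof.
move=> inja inja'.
have [g [injg ga]] := @extend_injection _ (codom a) (codom a')
  (introT (injectiveP a) inja) (introT (injectiveP a') inja') (etrans (size_codom a) (esym (size_codom a'))).
have gaE i : g (a i) = a' i.
  have := ga (enum_rank i) (a i); rewrite size_codom ltn_ord => /(_ isT).
  by rewrite !nth_codom enum_rankK.
rewrite -(card_imset (mem (fib a)) (f := fun f : {ffun 'I_p -> 'I_n} => [ffun i => g (f i)])).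
  apply/subset_leq_card/fintype.subsetP => _ /imsetP[f /fibP[injf fa] ->]; apply/fibP; split.
    by move=> i j; rewrite !ffunE => /injg/injf.
  by move=> i; rewrite ffunE fa gaE.
by move=> f f' /ffunP ff'; apply/ffunP => i; apply: injg; have := ff' i; rewrite !ffunE.
Qed.

Lemma restr_inj lam f : uniq lam -> injective f ->
  injective [ffun i : 'I_(size lam) => f (tnth (in_tuple lam) i)].
Proof.
by move=> ul injf i j; rewrite !ffunE => /injf; move/tuple_uniqP: (ul : uniq (in_tuple lam)); apply.
Qed.

Lemma big_injs_fib lam (V : Type) (v0 : V) (op : Monoid.com_law v0)
    (h : {ffun 'I_p -> 'I_n} -> V) : uniq lam ->
  \big[op/v0]_(f in injs p) h f =
  \big[op/v0]_(a in injs (size lam)) \big[op/v0]_(f in fib a) h f.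
Proof.
move=> ul; rewrite (partition_big (fun f => [ffun i => f (tnth (in_tuple lam) i)])
  (mem (injs (size lam)))); last first.
  by move=> f; rewrite !inE => /injectiveP injf; apply/injectiveP; exact: restr_inj.
apply: eq_bigr => a _; apply: eq_bigl => f; rewrite /fib !inE; congr (_ && _).
apply/eqP/forallP => [<- i|h']; first by rewrite ffunE.
by apply/ffunP => i; rewrite ffunE; apply/eqP.
Qed.

Lemma card_fib lam (a : {ffun 'I_(size lam) -> 'I_n}) : uniq lam -> injective a ->
  (n ^_ size lam * #|fib a|)%N = (n ^_ p)%N.
Proof.
move=> ul inja; transitivity (\sum_(f in injs p) 1)%N; last by rewrite sum1_card card_injs.
rewrite (big_injs_fib _ _ ul).
rewrite -card_injs -sum_nat_const; apply: eq_bigr => a'; rewrite inE => /injectiveP inja'.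
by rewrite sum1_card; apply/eqP; rewrite eqn_leq !leq_card_fib.
Qed.

Lemma card_fib_gt0 lam (a : {ffun 'I_(size lam) -> 'I_n}) : uniq lam -> injective a ->
  (p <= n)%N -> (0 < #|fib a|)%N.
Proof.
move=> ul inja pn; have := card_fib ul inja; case: #|fib a| => //.
by rewrite muln0 => /esym/eqP; rewrite -leqn0 leqNgt ffact_gt0 pn.
Qed.

(** Prescribing the value at one more vertex divides the fibre by [n - size lam]. It is an
    inequality because the left set is empty when [v] is already a value of [a]; otherwise one of
    its members provides the extension of [a] to [rcons lam q]. *)
Lemma card_fib_rcons lam q (a : {ffun 'I_(size lam) -> 'I_n}) (v : 'I_n) :
  uniq (rcons lam q) -> injective a -> (p <= n)%N ->
  ((n - size lam) * #|[set f in fib a | f q == v]%SET| <= #|fib a|)%N.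
Proof.
move=> ulq inja pn; have ul : uniq lam by move: ulq; rewrite rcons_uniq => /andP[].
have [->|[f0 /setIdP[/fibP[injf0 f0a] /eqP f0q]]] := set_0Vmem [set f in fib a | f q == v]%SET.
  by rewrite cards0 muln0.
pose a' : {ffun 'I_(size (rcons lam q)) -> 'I_n} :=
  [ffun i => f0 (tnth (in_tuple (rcons lam q)) i)].
have inja' : injective a' by exact: restr_inj.
have nl : (0 < n ^_ size lam)%N.
  rewrite ffact_gt0; apply: leq_trans pn.
  by have := max_card (mem lam); rewrite (card_uniqP ul) card_ord.
have sub : [set f in fib a | f q == v]%SET \subset fib a'.
  apply/fintype.subsetP => f /setIdP[/fibP[injf fa] /eqP fq]; apply/fibP; split => // i.
  rewrite ffunE !(tnth_nth q)/=; rewrite !nth_rcons.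
  have [il|_|_] := ltngtP i (size lam); [|by rewrite fq f0q..].
  by have := fa (Ordinal il); rewrite -f0a !(tnth_nth q)/=; exact.
rewrite -(leq_pmul2l nl) card_fib// mulnA -ffactnSr.
rewrite -(card_fib ulq inja') size_rcons leq_mul2l (subset_leq_card sub) orbT//.
Qed.

Lemma card_two_values i1 i2 (v1 v2 : 'I_n) : i1 != i2 -> (p <= n)%N ->
  (n * n.-1 * #|[set f in injs p | (f i1 == v1) && (f i2 == v2)]%SET| <= #|injs p|)%N.
Proof.
move=> i12 pn; pose a : {ffun 'I_(size [:: i1]) -> 'I_n} := [ffun=> v1].
have inja : injective a by move=> i j _; rewrite (ord1 i) (ord1 j).
have u12 : uniq (rcons [:: i1] i2) by rewrite /= inE i12.
have u1 : uniq [:: i1] by [].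
rewrite card_injs -(card_fib u1 inja) ffactn1 -mulnA leq_mul2l; apply/orP; right.
rewrite -subn1; apply: leq_trans (card_fib_rcons v2 u12 inja pn).
rewrite leq_mul2l subset_leq_card ?orbT//; apply/fintype.subsetP => f.
rewrite !inE => /and3P[/injectiveP injf /eqP f1 f2]; rewrite f2 andbT.
apply/andP; split; first exact/injectiveP.
by apply/forallP => i; rewrite (ord1 i) ffunE (tnth_nth i1)/= f1.
Qed.

Lemma leq_card_exists (T I : finType) (A : {set I}) (Q : T -> pred I) :
  (#|[set i in A | [exists t, Q t i]]%SET| <= \sum_t #|[set i in A | Q t i]%SET|)%N.
Proof.
rewrite -sum1_card (eq_bigl (fun i => (i \in A) && [exists t, Q t i])); last by move=> i; rewrite inE.
under [leqRHS]eq_bigr do rewrite -sum1dep_card.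
rewrite (exchange_big_dep (mem A)) /=; last by move=> t i _ /andP[].
rewrite big_mkcondr/=; apply: leq_sum => i iA; case: existsP => // -[t Qt].
by rewrite iA/= (bigD1 t)//=.
Qed.

Definition share2 (f f' : {ffun 'I_p -> 'I_n}) : bool :=
  [exists t : ('I_p * 'I_p) * ('I_p * 'I_p), [&& t.1.1 != t.1.2, t.2.1 != t.2.2,
     f t.1.1 == f' t.2.1 & f t.1.2 == f' t.2.2]].

(** There are [p ^ 4] choices of positions for the two coincidences, and each choice prescribes two
    values of [f'], which has frequency at most [1 / (n (n - 1))]. *)
Lemma card_share2 f : injective f -> (p <= n)%N ->
  (n * n.-1 * #|[set f' in injs p | share2 f f']%SET| <= p ^ 4 * #|injs p|)%N.
Proof.
move=> injf pn; apply: leq_trans (leq_mul (leqnn _) (leq_card_exists _ _)) _.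
rewrite big_distrr/=; apply: (@leq_trans (\sum_(t : ('I_p * 'I_p) * ('I_p * 'I_p)) #|injs p|)).
  apply: leq_sum => -[[i1 i2] [j1 j2]] _ /=.
  have [j12|j12] := eqVneq j1 j2.
    rewrite (_ : [set _ in _ | _]%SET = finset.set0) ?cards0 ?muln0//.
    by apply/setP => f'; rewrite !inE andbF/= andbF.
  apply: leq_trans (card_two_values (f i1) (f i2) j12 pn).
  rewrite leq_mul2l; apply/orP; right; apply/subset_leq_card/fintype.subsetP => f'.
  rewrite !inE => /and3P[-> _ /= /andP[/eqP -> /eqP ->]]; by rewrite !eqxx.
by rewrite sum_nat_const !card_prod card_ord leq_mul2r; apply/orP; right; rewrite !expnS; lia.
Qed.

Definition share_free lam (f f' : {ffun 'I_p -> 'I_n}) : bool :=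
  [exists t : 'I_p * 'I_p, [&& t.1 \notin lam, t.2 \notin lam & f t.1 == f' t.2]].

Lemma card_share_free lam (a : {ffun 'I_(size lam) -> 'I_n}) f : uniq lam -> injective a ->
  (p <= n)%N ->
  ((n - size lam) * #|[set f' in fib a | share_free lam f f']%SET| <= p ^ 2 * #|fib a|)%N.
Proof.
move=> ul inja pn; apply: leq_trans (leq_mul (leqnn _) (leq_card_exists _ _)) _.
rewrite big_distrr/=; apply: (@leq_trans (\sum_(t : 'I_p * 'I_p) #|fib a|)).
  apply: leq_sum => -[i j] _ /=; have [jl|jl] := boolP (j \in lam).
    rewrite (_ : [set _ in _ | _]%SET = finset.set0) ?cards0 ?muln0//.
    by apply/setP => f'; rewrite !inE /= !andbF.
  have ulj : uniq (rcons lam j) by rewrite rcons_uniq jl.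
  apply: leq_trans (card_fib_rcons (f i) ulj inja pn).
  rewrite leq_mul2l; apply/orP; right; apply/subset_leq_card/fintype.subsetP => f'.
  by rewrite !inE => /andP[-> /and3P[_ _ /eqP ->]]; rewrite eqxx.
by rewrite sum_nat_const !card_prod card_ord leq_mul2r; apply/orP; right; rewrite !expnS; lia.
Qed.

End InjectionCounting.

(** The square expands into a double sum in which only bad pairs contribute, each at most [C ^+ 2];
    in every row they make up a fraction of at most [M / N]. *)
Lemma Ex_sqr_avg d (T : measurableType d) (R : realType) (P : probability T R)
    (I : finType) (A : {set I}) (phi : I -> T -> R) (C : R) (bad : rel I) (M N : nat) :
  (forall i, i \in A -> bmeas (phi i)) ->
  (forall i x, i \in A -> `|phi i x| <= C) ->
  (forall i j, i \in A -> j \in A -> ~~ bad i j -> Ex P (fun x => phi i x * phi j x) = 0) ->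
  (0 < N)%N ->
  (forall i, i \in A -> (N * #|[set j in A | bad i j]%SET| <= M * #|A|)%N) ->
  Ex P (fun x => (#|A|%:R^-1 * \sum_(i in A) phi i x) ^+ 2) <= C ^+ 2 * (M%:R / N%:R).
Proof.
move=> bphi phiC orth N0 cbad.
have N0R : (0 : R) < N%:R by rewrite ltr0n.
have bpp i j : i \in A -> j \in A -> bmeas (fun x => phi i x * phi j x).
  by move=> iA jA; apply: bmeasM; exact: bphi.
have -> : Ex P (fun x => (#|A|%:R^-1 * \sum_(i in A) phi i x) ^+ 2) =
    #|A|%:R^-1 ^+ 2 * \sum_(i in A) \sum_(j in A) Ex P (fun x => phi i x * phi j x).
  transitivity (Ex P (fun x => #|A|%:R^-1 ^+ 2 *
      \sum_(i in A) \sum_(j in A) phi i x * phi j x)).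
    apply: Ex_ext => x; rewrite exprMn; congr (_ * _).
    by rewrite expr2 big_distrlr.
  rewrite ExZ; last by apply: bmeas_sum => i iA; apply: bmeas_sum => j jA; exact: bpp.
  congr (_ * _); rewrite Ex_sum; last by move=> i iA; apply: bmeas_sum => j jA; exact: bpp.
  by apply: eq_bigr => i iA; rewrite Ex_sum// => j jA; exact: bpp.
have [A0|A0] := posnP #|A|.
  rewrite A0 invr0 expr2 !mul0r; apply: mulr_ge0; first exact: sqr_ge0.
  by rewrite divr_ge0.
have A0R : (0 : R) < #|A|%:R by rewrite ltr0n.
have C2 : 0 <= C ^+ 2 by exact: sqr_ge0.
have row i : i \in A -> \sum_(j in A) Ex P (fun x => phi i x * phi j x) <=
    C ^+ 2 * (M%:R / N%:R) * #|A|%:R.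
  move=> iA; rewrite (bigID (bad i))/= [X in _ + X]big1 ?addr0; last first.
    by move=> j /andP[jA nb]; exact: orth.
  apply: (@le_trans _ _ (\sum_(j in A | bad i j) C ^+ 2)).
    apply: ler_sum => j /andP[jA _]; apply: le_trans (ler_norm _) _.
    apply: Ex_norm_le_cst => [|x]; first exact: bpp.
    by rewrite normrM expr2 ler_pM// phiC.
  rewrite sumr_const -[X in X <= _]mulr_natr -mulrA ler_wpM2l//.
  rewrite mulrAC ler_pdivlMr// -!natrM ler_nat mulnC.
  apply: leq_trans (cbad i iA); rewrite leq_mul2l; apply/orP; right.
  by apply/eq_leq/eq_card => j; rewrite !inE.
apply: (@le_trans _ _ (#|A|%:R^-1 ^+ 2 * \sum_(i in A) (C ^+ 2 * (M%:R / N%:R) * #|A|%:R))).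
  by rewrite ler_wpM2l ?sqr_ge0// ler_sum.
rewrite sumr_const -[X in _ * X]mulr_natr.
rewrite le_eqVlt; apply/orP; left; apply/eqP; rewrite expr2; field; by rewrite !gt_eqF.
Qed.

(** * Linearization of the statistic *)

Section Decomposition.
Variables (R : realType) (W : R -> R -> R) (d p : nat) (F : 'I_d -> rel 'I_p).
Variable l : seq 'I_p.
Hypothesis mW : measurable_fun setT (fun z : R * R => W z.1 z.2).
Hypothesis W01 : forall x y, 0 <= W x y <= 1.
Hypothesis Wsym : forall x y, W x y = W y x.
Variable nu : probability (cspace R idx) R.
Hypothesis nuP : iid_unif nu.
Hypotheses (ul : uniq l) (compF : compatible F l).
Hypothesis simpleF : forall m, simple_graph (F m).
Variables (G : 'rV[R]_d -> R) (G' : 'I_d -> 'rV[R]_d -> R) (K : R).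
Notation theta := (tilde_t_x F W l).
Hypothesis bG : bmeas (fun x : cspace R nat => G (theta x)).
Hypothesis bG' : forall m, bmeas (fun x : cspace R nat => G' m (theta x)).
Hypothesis K0 : 0 <= K.
Hypothesis taylorG : forall v w : 'rV[R]_d,
  (forall m, 0 <= v 0 m <= 1) -> (forall m, 0 <= w 0 m <= 1) ->
  `|G v - G w - \sum_m G' m w * (v 0 m - w 0 m)| <= K * \sum_m (v 0 m - w 0 m) ^+ 2.

Let k := size l.

Definition graph_of (n : nat) (z : idx -> R) : rel 'I_n :=
  fun i j => (i != j) && (z (eix i j) < W (z (inl (i : nat))) (z (inl (j : nat)))).

Definition vtx n (f : {ffun 'I_p -> 'I_n}) : 'I_p -> nat := fun i => f i.

Lemma vtx_inj n (f : {ffun 'I_p -> 'I_n}) : injective f -> injective (vtx f).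
Proof. by move=> injf i j /ord_inj /injf. Qed.

Lemma eixC i j : eix i j = eix j i.
Proof. by rewrite /eix minnC maxnC. Qed.

Lemma prod_nat_of_bool (T : Type) (s : seq T) (q : T -> bool) :
  \prod_(t <- s) (q t)%:R = (all q s)%:R :> R.
Proof.
elim: s => [|t s IH]; first by rewrite big_nil.
by rewrite big_cons IH /=; case: (q t); rewrite ?mul1r ?mul0r.
Qed.

(** The left side tests ordered pairs in both directions, the right side only those with [i < j];
    symmetry of [F m], of [W] and of [eix] closes the gap. *)
Lemma graph_of_edges n m (f : {ffun 'I_p -> 'I_n}) z : injective f ->
  [forall i : 'I_p, forall j : 'I_p, F m i j ==> graph_of z (f i) (f j)]%:R =
  edge_inds W (F m) (vtx f) z.
Proof.
move=> injf; rewrite /edge_inds prod_nat_of_bool; congr (_%:R); congr nat_of_bool.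
have [symF irrF] := simpleF m.
apply/forallP/allP => [h [i j]|h i].
  rewrite mem_edges => /andP[/= ij Fij].
  by have /forallP/(_ j) := h i; rewrite Fij/= => /andP[].
apply/forallP => j; apply/implyP => Fij.
have ij : i != j by apply/eqP => ij; rewrite ij irrF in Fij.
rewrite /graph_of inj_eq// ij/=.
have [ltij|ltji|eij] := ltngtP i j; last by rewrite (ord_inj eij) eqxx in ij.
  by have := h (i, j); rewrite mem_edges/= ltij Fij => /(_ isT).
by have := h (j, i); rewrite mem_edges/= ltji symF Fij eixC Wsym => /(_ isT).
Qed.

Lemma t_injE n (z : idx -> R) (a : {ffun 'I_(size l) -> 'I_n}) m :
  t_inj R F (graph_of z) a m =
  #|fib a|%:R^-1 * \sum_(f in fib a) edge_inds W (F m) (vtx f) z.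
Proof.
transitivity (#|fib a|%:R^-1 * #|[set f in fib a | [forall i : 'I_p, forall j : 'I_p,
    F m i j ==> graph_of z (f i) (f j)]]%SET|%:R : R); first (rewrite /t_inj; cbv zeta; rewrite [LHS]mulrC).
  (* The sets inside [t_inj] are classical sets whereas [fib] is a finite set; [memS] reconciles the
     two memberships. *)
  have memS (Q : pred {ffun 'I_p -> 'I_n}) f : (f \in [set` Q]%classic) = Q f.
    by apply/idP/idP => [/set_mem//|Qf]; exact/mem_set.
  congr (_^-1 * _); congr (_%:R); apply: eq_card => f.
    rewrite [RHS]inE; exact: (memS (fun f => injectiveb f && [forall i, _ ])).
  rewrite !inE; congr andb; exact: (memS (fun f => injectiveb f && [forall i, _ ])).
congr (_ * _); rewrite -sum1_card natr_sum big_mkcond [RHS]big_mkcond/=.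
apply: eq_bigr => f _; rewrite inE; have [ff|//] := boolP (f \in fib a).
have /fibP[injf _] := ff; rewrite -graph_of_edges//=.
by case: [forall i, _].
Qed.

Lemma edge_inds_lab (b b' : 'I_p -> nat) z : (forall q, q \in l -> b q = b' q) ->
  edge_inds W (Elab F l) b z = edge_inds W (Elab F l) b' z.
Proof.
move=> bb'; rewrite /edge_inds big_seq [RHS]big_seq; apply: eq_bigr => ij.
by rewrite mem_edges => /andP[_ /and3P[il jl _]]; rewrite !bb'.
Qed.

Lemma theta01 x m : 0 <= theta x 0 m <= 1.
Proof.
rewrite -(Ex_edge_prod_theta F l mW W01 nuP x m (@val_inj _ _ _)).
have bE : bmeas (fun z : cspace R idx => edge_prod W (unlab F l m)
    (fun i => if i \in l then x (index i l) else z (inl (val i)))).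
  apply: (bmeas_comp (phi := fun z : cspace R idx => (fun i =>
    if mem l i then x (index i l) else z (inl (val i))) : cspace R 'I_p) _
    (bmeas_edge_prod mW W01 (unlab F l m))).
  exact: (measurable_patch (mem l) val (fun i => x (index i l))).
rewrite Ex_ge0/= => [|z]; last by have /andP[] := edge_prod_ge0_le1 W01 (unlab F l m)
  (fun i => if i \in l then x (index i l) else z (inl (val i))).
apply: le_trans (ler_norm _) _; apply: Ex_norm_le_cst => // z.
have /andP[h0 h1] := edge_prod_ge0_le1 W01 (unlab F l m)
  (fun i => if i \in l then x (index i l) else z (inl (val i))).
by rewrite ger0_norm.
Qed.

Definition Javg n (a : {ffun 'I_(size l) -> 'I_n}) m z : R :=
  #|fib a|%:R^-1 * \sum_(f in fib a) kern W (Jedges F l m) (Jcoef W F l m) (vtx f) z.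

Notation Hkern := (kern W (Hedges F l) (Hcoef W F l G G')).

(** All injections of the fibre agree on the labels, so the indicator [I] and the label types [x]
    depend on [a] only, and [t_inj] factors as [I * tau m]. The deviation of [tau] from [theta x] is
    exactly [Javg], so the Taylor remainder is quadratic in it. *)
Lemma label_decomposition n (a : {ffun 'I_(size l) -> 'I_n}) z : (p <= n)%N -> injective a ->
  `|G (\row_m t_inj R F (graph_of z) a m) - G 0 -
    #|fib a|%:R^-1 * \sum_(f in fib a) Hkern (vtx f) z| <=
  K * \sum_m Javg a m z ^+ 2.
Proof.
move=> pn inja; have Npos := card_fib_gt0 ul inja pn.
have /card_gt0P[f0 f0a] := Npos; have /fibP[injf0 f0E] := f0a.
pose y (f : {ffun 'I_p -> 'I_n}) := at_vertices (vtx f) z : 'I_p -> R.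
have same f q : f \in fib a -> q \in l -> vtx f q = vtx f0 q.
  move=> /fibP[_ fE] ql; have qi : (index q l < size l)%N by rewrite index_mem.
  have := fE (Ordinal qi); rewrite -f0E !(tnth_nth q)/= nth_index//.
  by rewrite /vtx => ->.
pose I := edge_inds W (Elab F l) (vtx f0) z; pose x := lab_coords l (y f0).
have sameI f : f \in fib a -> edge_inds W (Elab F l) (vtx f) z = I.
  by move=> ff; apply: edge_inds_lab => q; exact: same.
have samex f : f \in fib a -> lab_coords l (y f) = x.
  move=> ff; rewrite /x /lab_coords; congr nth; apply/eq_in_map => q ql.
  by rewrite /y /at_vertices (same f q).
pose tau m := #|fib a|%:R^-1 * \sum_(f in fib a) edge_inds W (unlab F l m) (vtx f) z.
have NR : (#|fib a|%:R : R) != 0 by rewrite pnatr_eq0 -lt0n.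
have avgc (c : R) : #|fib a|%:R^-1 * \sum_(f in fib a) c = c.
  by rewrite sumr_const -[X in _ * X]mulr_natr mulrCA mulVf ?mulr1.
have tE m : t_inj R F (graph_of z) a m = I * tau m.
  rewrite t_injE mulrCA; congr (_ * _); rewrite mulr_sumr; apply: eq_bigr => f ff.
  by rewrite (edge_inds_split W F l) sameI.
have JE m : Javg a m z = tau m - theta x 0 m.
  rewrite -[theta x 0 m]avgc -mulrBr -sumrB; congr (_ * _); apply: eq_bigr => f ff.
  by rewrite kern_JE [lab_coords _ _]samex.
have HE : #|fib a|%:R^-1 * \sum_(f in fib a) Hkern (vtx f) z =
    I * (Hrest W F l G G' x + \sum_m G' m (theta x) * tau m).
  transitivity (#|fib a|%:R^-1 * \sum_(f in fib a) (I * Hrest W F l G G' x +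
      \sum_m G' m (theta x) * (I * edge_inds W (unlab F l m) (vtx f) z))).
    congr (_ * _); apply: eq_bigr => f ff; rewrite /kern sum_option/=.
    rewrite [lab_coords _ _]samex// sameI// mulrC; congr (_ + _).
    by apply: eq_bigr => m _; rewrite (edge_inds_split W F l) sameI.
  rewrite big_split/= [LHS]mulrDr avgc [RHS]mulrDr; congr (_ + _).
  rewrite exchange_big mulr_sumr [RHS]mulr_sumr; apply: eq_bigr => m _.
  rewrite -mulr_sumr -mulr_sumr mulrCA [RHS]mulrCA; congr (_ * _).
  by rewrite mulrCA.
have tau01 m : 0 <= tau m <= 1.
  rewrite mulr_ge0 ?invr_ge0 ?ler0n//=; last first.
    by apply: sumr_ge0 => f _; have /andP[] := edge_inds_ge0_le1 W (unlab F l m) (vtx f) z.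
  rewrite -[leRHS]avgc ler_wpM2l ?invr_ge0 ?ler0n// ler_sum// => f _.
  by have /andP[] := edge_inds_ge0_le1 W (unlab F l m) (vtx f) z.
rewrite HE (_ : (\row_m _) = \row_m (I * tau m)); last by apply/rowP => m; rewrite !mxE tE.
(* The two values of [I] are treated apart: at 0 the left side vanishes, and at 1 it is the Taylor
   remainder between [tau] and [theta x]. *)
have [I0|I1] := edge_inds_eq01 W (Elab F l) (vtx f0) z.
  rewrite /I I0 mul0r subr0 (_ : (\row_m _) = 0); last by apply/rowP => m; rewrite !mxE mul0r.
  rewrite subrr normr0; apply: mulr_ge0 => //; apply: sumr_ge0 => m _; exact: sqr_ge0.
rewrite /I I1 mul1r (_ : (\row_m _) = \row_m tau m); last by apply/rowP => m; rewrite !mxE mul1r.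
have := @taylorG (\row_m tau m) (theta x).
under eq_bigr do rewrite mxE.
under [X in _ -> _ -> _ <= _ * X]eq_bigr do rewrite mxE -JE.
move=> T; apply: le_trans (T _ _); last 2 first.
- by move=> m; rewrite mxE.
- by move=> m; exact: theta01.
rewrite le_eqVlt; apply/orP; left; apply/eqP; congr `|_|.
rewrite /Hrest; under [X in _ = _ - X]eq_bigr do rewrite mulrBr.
rewrite sumrB; ring.
Qed.

Lemma card_injs_fib n (a : {ffun 'I_(size l) -> 'I_n}) : injective a ->
  (#|injs n p| = #|injs n (size l)| * #|fib a|)%N.
Proof. by move=> inja; rewrite !card_injs card_fib. Qed.

Lemma Gamma_n_decomposition n z : (p <= n)%N ->
  `|Gamma_n F l G (graph_of (n := n) z) - G 0 -
    #|injs n p|%:R^-1 * \sum_(f in injs n p) Hkern (vtx f) z| <=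
  K * (#|injs n k|%:R^-1 * \sum_(a in injs n k) \sum_m Javg a m z ^+ 2).
Proof.
move=> pn.
have kp : (size l <= p)%N by have := max_card (mem l); rewrite (card_uniqP ul) card_ord.
have Npos : (0 < #|injs n k|)%N by rewrite card_injs ffact_gt0 (leq_trans kp).
have NR : (#|injs n k|%:R : R) != 0 by rewrite pnatr_eq0 -lt0n.
have -> : Gamma_n F l G (graph_of (n := n) z) = #|injs n k|%:R^-1 *
    \sum_(a in injs n k) G (\row_m t_inj R F (graph_of z) a m).
  rewrite /Gamma_n; cbv zeta.
  have memS (Q : pred {ffun 'I_(size l) -> 'I_n}) f : (f \in [set` Q]%classic) = Q f.
    by apply/idP/idP => [/set_mem//|Qf]; exact/mem_set.
  congr (_^-1 * _).
    congr (_%:R); apply: eq_card => f; rewrite [RHS]inE.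
    exact: (memS (fun f => injectiveb f)).
  apply: eq_bigl => f; rewrite [RHS]inE.
  exact: (memS (fun f => injectiveb f)).
rewrite (big_injs_fib _ _ ul)/=.
(* Since all fibres have the same cardinal, the average over all injections is the average over [a]
   of the averages over the fibres. *)
have -> : #|injs n p|%:R^-1 * \sum_(a in injs n k) \sum_(f in fib a) Hkern (vtx f) z =
    #|injs n k|%:R^-1 * \sum_(a in injs n k) #|fib a|%:R^-1 *
      \sum_(f in fib a) Hkern (vtx f) z.
  rewrite !mulr_sumr; apply: eq_bigr => a; rewrite inE => /injectiveP inja.
  by rewrite mulrA (card_injs_fib inja) natrM invfM.
have -> : G 0 = #|injs n k|%:R^-1 * \sum_(a in injs n k) G 0.
  by rewrite sumr_const -[X in _ * X]mulr_natr mulrCA mulVf ?mulr1.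
rewrite -!mulrBr -!sumrB normrM ger0_norm ?invr_ge0 ?ler0n// mulrCA.
rewrite ler_wpM2l ?invr_ge0 ?ler0n//.
apply: le_trans (ler_norm_sum _ _ _) _; rewrite mulr_sumr; apply: ler_sum => a.
by rewrite inE => /injectiveP inja; exact: label_decomposition.
Qed.

Notation vproj := (vertex_proj W F l G G').
Notation mu := (Hmu W F l G).

Definition vertex_sum (u : R) : R := \sum_q (vproj q u - mu).

(** Under a uniform injection the image of each [q] is a uniform vertex: the fibres over its [n]
    values have the same size. *)
Lemma avg_vertex_sum n z : (p <= n)%N -> (0 < n)%N ->
  #|injs n p|%:R^-1 * \sum_(f in injs n p) Hproj W F l G G' (at_vertices (vtx f) z) =
  n%:R^-1 * \sum_(i < n) vertex_sum (z (inl (i : nat))).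
Proof.
move=> pn n0; rewrite exchange_big/= [in RHS]exchange_big/= !mulr_sumr; apply: eq_bigr => q _.
rewrite (partition_big (fun f : {ffun 'I_p -> 'I_n} => f q) predT)//= !mulr_sumr.
apply: eq_bigr => v _.
rewrite (eq_bigr (fun=> vproj q (z (inl (v : nat))) - mu)); last first.
  by move=> f /andP[_ /eqP fq]; rewrite /at_vertices /vtx fq.
rewrite sumr_const -[X in _ * X]mulr_natl mulrA; congr (_ * _).
pose a : {ffun 'I_(size [:: q]) -> 'I_n} := [ffun=> v].
have inja : injective a by move=> i j _; rewrite (ord1 i) (ord1 j).
have cE : #|[pred f | (f \in injs n p) && (f q == v)]| = #|fib a|.
  apply: eq_card => f; rewrite !inE; congr (_ && _).
  apply/eqP/forallP => [fq i|/(_ ord0)].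
    by rewrite (ord1 i) ffunE (tnth_nth q)/= fq.
  by rewrite ffunE (tnth_nth q) => /eqP.
have := card_fib (isT : uniq [:: q]) inja; rewrite ffactn1 -card_injs => cn.
transitivity (#|injs n p|%:R^-1 * #|fib a|%:R : R); first by congr (_ * _%:R); exact: cE.
have f0 := card_fib_gt0 (isT : uniq [:: q]) inja pn.
by rewrite -cn natrM invfM -mulrA mulVf ?mulr1// pnatr_eq0 -lt0n.
Qed.

Lemma Ex_Javg n (a : {ffun 'I_(size l) -> 'I_n}) m : (p < n)%N -> injective a ->
  Ex nu (fun z => Javg a m z ^+ 2) <= (p ^ 2)%:R / (n - p)%:R.
Proof.
move=> pn inja.
have kp : (size l <= p)%N by have := max_card (mem l); rewrite (card_uniqP ul) card_ord.
have np0 : (0 < n - p)%N by rewrite subn_gt0.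
have := @Ex_sqr_avg _ _ R nu _ (fib a)
  (fun f z => kern W (Jedges F l m) (Jcoef W F l m) (vtx f) z) 1 (share_free l) (p ^ 2) (n - size l).
rewrite expr1n mul1r => h; apply: le_trans (h _ _ _ _ _) _.
- by move=> f _; apply: bmeas_kern => // o; exact: bmeas_Jcoef.
- move=> f z _; rewrite kern_JE.
  have /andP[e0 e1] := edge_inds_ge0_le1 W (unlab F l m) (vtx f) z.
  have /andP[t0 t1] := theta01 (lab_coords l (at_vertices (vtx f) z)) m.
  by rewrite ler_norml; apply/andP; split; lra.
- move=> f f' /fibP[injf fE] /fibP[injf' fE'] nsh.
  apply: (Ex_J_orthogonal mW W01 nuP ul compF); [exact: vtx_inj..|].
  (* A common vertex [f i = f' i'] with both positions free is excluded by [nsh]. If [i'] is a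
     label, both injections take the value prescribed by [a] there, so [f i = f i'] and injectivity
     makes the free position [i] a label. *)
  move=> i i' il; apply/negP => /eqP/ord_inj ff'.
  move/negP: nsh; apply; apply/existsP; exists (i, i'); rewrite /= il ff' eqxx andbT/=.
  apply/negP => i'l; have i'i : (index i' l < size l)%N by rewrite index_mem.
  have E := fE (Ordinal i'i); have E' := fE' (Ordinal i'i).
  rewrite -E !(tnth_nth i)/= nth_index// in E'; rewrite E' in ff'.
  by move/injf : ff' => ii'; rewrite ii' i'l in il.
- by rewrite subn_gt0 (leq_ltn_trans kp).
- by move=> f /fibP[injf _]; apply: card_share_free => //; exact: ltnW.
rewrite ler_wpM2l ?ler0n// lef_pV2 ?posrE ?ltr0n// ?ler_nat ?leq_sub2l//.
by rewrite subn_gt0 (leq_ltn_trans kp).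
Qed.

Notation Dkern := (kern W (Dedges F l) (Dcoef W F l G G')).

Lemma Dkern_bounded : exists2 C, 0 <= C & forall (b : 'I_p -> nat) z, `|Dkern b z| <= C.
Proof.
have [C hC] := choice (fun m => (bmeas_Dcoef mW W01 nuP ul bG bG' m).2).
exists (\sum_m C m).
  by apply: sumr_ge0 => m _; apply: le_trans (hC m (fun=> 0)).
move=> b z; apply: le_trans (ler_norm_sum _ _ _) _; apply: ler_sum => m _.
rewrite normrM; have /andP[e0 e1] := edge_inds_ge0_le1 W (Dedges F l m) b z.
by rewrite (ger0_norm e0) -[leRHS]mulr1 ler_pM// hC.
Qed.

(** The second moment is at most [C^2 p^4 / (n (n - 1))], hence at most [(C p^2 / (n - p))^2]
    because [p >= 1]; the first absolute moment follows by Cauchy-Schwarz. *)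
Lemma Ex_Davg C n : (0 < p)%N -> 0 <= C -> (forall (b : 'I_p -> nat) z, `|Dkern b z| <= C) ->
  (p < n)%N ->
  Ex nu (fun z => `|#|injs n p|%:R^-1 * \sum_(f in injs n p) Dkern (vtx f) z|) <=
  C * (p ^ 2)%:R / (n - p)%:R.
Proof.
move=> p0 C0 DC pn; have n1 : (0 < n.-1)%N by case: (n) pn => [|[|]]//; case: (p) p0.
have bD f : bmeas (fun z : cspace R idx => Dkern (vtx (f : {ffun 'I_p -> 'I_n})) z).
  by apply: bmeas_kern => // m; exact: (bmeas_Dcoef mW W01 nuP ul bG bG').
have bA : bmeas (fun z : cspace R idx => #|injs n p|%:R^-1 * \sum_(f in injs n p) Dkern (vtx f) z).
  by apply: bmeasM; [exact: bmeas_cst|apply: bmeas_sum].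
have np0 : (0 < n - p)%N by rewrite subn_gt0.
have rhs0 : 0 <= C * (p ^ 2)%:R / (n - p)%:R by rewrite divr_ge0// mulr_ge0.
rewrite -(@ler_pXn2r _ 2)// ?nnegrE//; last by apply: Ex_ge0.
apply: le_trans (Ex_norm_sqr _ bA) _.
have h := @Ex_sqr_avg _ _ R nu _ (injs n p)
  (fun f z => Dkern (vtx f) z) C (@share2 p n) (p ^ 4) (n * n.-1).
apply: le_trans (h _ _ _ _ _) _.
- by move=> f _.
- by move=> f z _.
- move=> f f'; rewrite !inE => /injectiveP injf /injectiveP injf' nsh.
  pose i0 : 'I_p := Ordinal p0.
  (* Without two common vertices, all coincidences occur at a single position [q0] of [f]: a second
     one would, by injectivity of [f], be at a different position of [f'] too. If there is none, any
     position serves, and [p0] supplies one. *)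
  have [q0 hq0] : exists q0, forall i i', i != q0 -> f i != f' i'.
    have [/existsP[i1 /existsP[j1 /eqP e1]]|] := boolP [exists i, exists i', f i == f' i'].
      exists i1 => i i' ii1; apply/negP => /eqP e2; move/negP: nsh; apply.
      apply/existsP; exists ((i, i1), (i', j1)); rewrite /= ii1 e1 e2 !eqxx !andbT/=.
      by apply/eqP => ij; rewrite ij -e1 in e2; move/injf : e2 => e2; rewrite e2 eqxx in ii1.
    move=> nex; exists i0 => i i' _; apply: contra nex => e.
    by apply/existsP; exists i; apply/existsP; exists i'.
  apply: (Ex_D_orthogonal mW W01 nuP ul bG bG' (vtx_inj injf) (vtx_inj injf') (q0 := q0)).
  by move=> i i' /hq0 h'; apply: contra (h' i') => /eqP/ord_inj ->.
- by rewrite muln_gt0 n1 andbT; case: (n) pn.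
- by move=> f; rewrite inE => /injectiveP injf; apply: card_share2 => //; exact: ltnW.
rewrite exprMn exprMn -mulrA ler_wpM2l ?sqr_ge0//.
rewrite exprVn -!natrX -expnM ler_wpM2l ?ler0n// lef_pV2 ?posrE ?ltr0n//.
- by rewrite ler_nat expnS expn1 leq_mul// ?leq_subr// -subn1 leq_sub2l.
- by rewrite muln_gt0 n1 andbT; case: (n) pn.
- by rewrite expn_gt0 np0.
Qed.

(** The graph takes finitely many values, so any function of it is a finite sum over adjacency
    matrices; no regularity of [phi] enters. *)
Lemma bmeas_graph_of n (phi : rel 'I_n -> R) :
  bmeas (fun z : cspace R idx => phi (graph_of (n := n) z)).
Proof.
pose psi (E : {ffun 'I_n * 'I_n -> bool}) := phi (fun i j => E (i, j)).
apply: (@eq_bmeas _ (cspace R idx) R (fun z => \sum_E psi E *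
   \prod_ij (graph_of z ij.1 ij.2 == E ij)%:R)).
  move=> z; pose Ez : {ffun 'I_n * 'I_n -> bool} := [ffun ij => graph_of z ij.1 ij.2].
  rewrite (bigD1 Ez)//= [X in _ + X]big1 ?addr0.
    rewrite big1 ?mulr1 => [|ij _]; last by rewrite ffunE eqxx.
    by congr phi; apply/funext => i; apply/funext => j; rewrite ffunE.
  move=> E EEz; have [ij Eij|e] := pickP (fun ij => E ij != Ez ij).
    rewrite (bigD1 ij)//= (_ : (_ == E ij) = false) ?mul0r ?mulr0//.
    by apply/negbTE; rewrite eq_sym; move: Eij; rewrite ffunE.
  case/eqP: EEz; apply/ffunP => ij; apply/eqP; by move/(_ ij) : e => /= /negbT/negPn.
apply: bmeas_sum => E _; apply: bmeasM; first exact: bmeas_cst.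
apply: bmeas_prod => -[i j] _ /=.
have bg : bmeas (fun z : cspace R idx => (i != j)%:R * edge_ind W z i j).
  by apply: bmeasM; [exact: bmeas_cst|exact: bmeas_edge_ind].
have gE z : (i != j)%:R * edge_ind W z i j = (graph_of z i j)%:R.
  by rewrite /edge_ind /graph_of -natrM mulnb.
case: (E (i, j)).
  by apply: (eq_bmeas _ bg) => z; rewrite gE; case: (graph_of z i j).
apply: (@eq_bmeas _ (cspace R idx) R (fun z => 1 - (i != j)%:R * edge_ind W z i j)).
  by move=> z; rewrite gE; case: (graph_of z i j); rewrite ?subrr ?subr0.
by apply: bmeasB => //; exact: bmeas_cst.
Qed.

Lemma bmeas_vertex_sum : bmeas vertex_sum.
Proof.
by apply: bmeas_sum => q _; apply: bmeasB;
  [exact: (bmeas_vertex_proj mW W01 nuP ul bG bG')|exact: bmeas_cst].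
Qed.

Lemma Gamma_limE : Gamma_lim F W l G = G 0 + mu.
Proof.
have bH := bmeas_hat F l mW W01.
rewrite /Gamma_lim /hat_t /Hmu -!(Ex_labels nuP (@val_inj _ _ 'I_p) ul)//; last 2 first.
- exact: bmeas_Hmean.
- exact: bmeasM.
pose x (z : cspace R idx) := trunc k (z \o along val l) : cspace R nat.
have bHx := bmeas_comp (measurable_trunc k (along val l)) bH.
have bGx := bmeas_comp (measurable_trunc k (along val l)) bG.
have -> : Ex nu (fun z => Hmean W F l G (trunc (size l) (z \o along val l))) =
    Ex nu (fun z => hat_t_x F W l (x z) * G (theta (x z))) -
    G 0 * Ex nu (fun z => hat_t_x F W l (x z)).
  rewrite -ExZ// -ExB; [|exact: bmeasM|by apply: bmeasM => //; exact: bmeas_cst].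
  by apply: Ex_ext => z; rewrite /Hmean /x mulrBr [G 0 * _]mulrC.
rewrite /x; ring.
Qed.

Lemma Gamma_n_linearization : (0 < p)%N -> exists C, forall n, (p < n)%N ->
  Ex nu (fun z => `|Gamma_n F l G (graph_of (n := n) z) - Gamma_lim F W l G -
    n%:R^-1 * \sum_(i < n) vertex_sum (z (inl (i : nat)))|) <= C / (n - p)%:R.
Proof.
move=> p0; have [C C0 DC] := Dkern_bounded.
(* The first term bounds the degenerate remainder [Dkern], the second the Taylor remainder, a sum of
   [d] squares [Javg a m ^+ 2]. *)
exists (C * (p ^ 2)%:R + K * (d%:R * (p ^ 2)%:R)) => n pn.
have bD f : bmeas (fun z : cspace R idx => Dkern (vtx (f : {ffun 'I_p -> 'I_n})) z).
  by apply: bmeas_kern => // m; exact: (bmeas_Dcoef mW W01 nuP ul bG bG').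
have bA : bmeas (fun z : cspace R idx => #|injs n p|%:R^-1 * \sum_(f in injs n p) Dkern (vtx f) z).
  by apply: bmeasM; [exact: bmeas_cst|apply: bmeas_sum].
have bJ (a : {ffun 'I_(size l) -> 'I_n}) m : bmeas (fun z : cspace R idx => Javg a m z ^+ 2).
  apply: bmeasX; apply: bmeasM; first exact: bmeas_cst.
  by apply: bmeas_sum => f _; apply: bmeas_kern => // o; exact: bmeas_Jcoef.
have bJs : bmeas (fun z : cspace R idx => #|injs n k|%:R^-1 *
    \sum_(a in injs n k) \sum_m Javg a m z ^+ 2).
  apply: bmeasM; first exact: bmeas_cst.
  by apply: bmeas_sum => a _; apply: bmeas_sum => m _; exact: bJ.
have bS : bmeas (fun z : cspace R idx => n%:R^-1 * \sum_(i < n) vertex_sum (z (inl (i : nat)))).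
  apply: bmeasM; first exact: bmeas_cst.
  by apply: bmeas_sum => i _; exact: (bmeas_comp (measurable_coord _) bmeas_vertex_sum).
apply: (@le_trans _ _ (Ex nu (fun z =>
   `|#|injs n p|%:R^-1 * \sum_(f in injs n p) Dkern (vtx f) z| +
   K * (#|injs n k|%:R^-1 * \sum_(a in injs n k) \sum_m Javg a m z ^+ 2)))).
  apply: Ex_le.
  - apply: bmeas_norm; apply: bmeasB => //; apply: bmeasB; last exact: bmeas_cst.
    exact: (bmeas_graph_of (fun E => Gamma_n F l G E)).
  - by apply: bmeasD; [exact: bmeas_norm|apply: bmeasM => //; exact: bmeas_cst].
  - move=> z; have := Gamma_n_decomposition z (ltnW pn).
    set A := #|injs n p|%:R^-1 * _; set B := K * _; set g := Gamma_n _ _ _ _ => AB.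
    have n0 : (0 < n)%N by exact: leq_ltn_trans pn.
    have -> : #|injs n p|%:R^-1 * \sum_(f in injs n p) Dkern (vtx f) z =
        A - mu - n%:R^-1 * \sum_(i < n) vertex_sum (z (inl (i : nat))).
      rewrite -(avg_vertex_sum z (ltnW pn) n0) /A.
      under eq_bigr do rewrite kern_DE.
      rewrite !sumrB mulrBr mulrBr; congr (_ - _ - _).
      rewrite sumr_const -[X in _ * X]mulr_natr mulrCA mulVf ?mulr1// pnatr_eq0 -lt0n.
      by rewrite card_injs ffact_gt0 ltnW.
    rewrite Gamma_limE.
    set S := n%:R^-1 * _; have -> : g - (G 0 + mu) - S = (A - mu - S) + (g - G 0 - A) by ring.
    by apply: le_trans (ler_normD _ _) _; rewrite lerD2l.
rewrite ExD; [|exact: bmeas_norm|by apply: bmeasM => //; exact: bmeas_cst].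
rewrite mulrDl lerD//; first exact: Ex_Davg.
rewrite ExZ// -mulrA ler_wpM2l//.
rewrite ExZ; last by apply: bmeas_sum => a _; apply: bmeas_sum => m _; exact: bJ.
rewrite Ex_sum; last by move=> a _; apply: bmeas_sum => m _; exact: bJ.
apply: (@le_trans _ _ (#|injs n k|%:R^-1 * \sum_(a in injs n k) (d%:R * (p ^ 2)%:R / (n - p)%:R))).
  rewrite ler_wpM2l ?invr_ge0 ?ler0n// ler_sum// => a; rewrite inE => /injectiveP inja.
  rewrite Ex_sum//; apply: (@le_trans _ _ (\sum_(m < d) ((p ^ 2)%:R / (n - p)%:R))).
    by apply: ler_sum => m _; exact: Ex_Javg.
  by rewrite sumr_const card_ord -[X in X <= _]mulr_natl mulrA.
rewrite sumr_const -[X in _ * X]mulr_natr mulrCA mulVf ?mulr1// pnatr_eq0 -lt0n card_injs ffact_gt0.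
by rewrite (leq_trans _ (ltnW pn))//; have := max_card (mem l); rewrite (card_uniqP ul) card_ord.
Qed.

End Decomposition.

(** * Identification of the limiting variance *)

Section Variance.
Variables (R : realType) (W : R -> R -> R) (d p : nat) (F : 'I_d -> rel 'I_p).
Variable l : seq 'I_p.
Hypothesis mW : measurable_fun setT (fun z : R * R => W z.1 z.2).
Hypothesis W01 : forall x y, 0 <= W x y <= 1.
Variable nu : probability (cspace R idx) R.
Hypothesis nuP : iid_unif nu.
Hypothesis ul : uniq l.
Variable g : 'rV[R]_d -> R.
Hypothesis bg : bmeas (fun x : cspace R nat => g (tilde_t_x F W l x)).
Hypothesis bg' : forall m, bmeas (fun x : cspace R nat => pderiv g m (tilde_t_x F W l x)).
Local Notation vsum := (vertex_sum W F l g (pderiv g)).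

Lemma perm_label_free : perm_eq (l ++ Defs.free l) (enum 'I_p).
Proof.
have pe : perm_eq ([seq x <- enum 'I_p | x \in l] ++ Defs.free l) (enum 'I_p).
  by rewrite /Defs.free (perm_filterC (mem l)).
apply: perm_trans pe; rewrite perm_cat2r; apply: uniq_perm => //; first by rewrite filter_uniq ?enum_uniq.
by move=> x; rewrite mem_filter mem_enum andbT.
Qed.

(** Term by term, the label part of [curlyU] is [vertex_proj] at the labels; at a free vertex
    [vertex_proj] has in addition the integral of [hat * Hrest], which does not depend on [u]. The
    constant also restores the means subtracted in [vertex_sum], and it drops out of the
    variance. *)
Lemma vertex_sum_curlyU : exists c, forall u, curlyU F W l g u = vsum u + c.
Proof.
exists (\sum_(q : 'I_p) Hmu W F l g - \sum_(q <- Defs.free l) cube_int (size l)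
  (fun x => hat_t_x F W l x * Hrest W F l g (pderiv g) x)) => u.
rewrite /vertex_sum sumrB addrA subrK /curlyU.
rewrite -[X in _ = X - _]big_enum /= -(perm_big _ perm_label_free) /= big_cat /= -addrA; congr (_ + _).
  rewrite [RHS]big_tnth; apply: eq_bigr => i _; rewrite /vertex_proj mem_tnth.
  by rewrite (tnth_nth (tnth (in_tuple l) i)) index_uniq.
rewrite -sumrB !big_seq; apply: eq_bigr => q qf; rewrite /vertex_proj.
have /negbTE -> : q \notin l by rewrite -mem_free.
by rewrite addrC addKr.
Qed.

Lemma mean_vertex_sum : Rintegral lebesgue_measure `[0, 1]%classic vsum = 0.
Proof.
have bv q : bmeas (vertex_proj W F l g (pderiv g) q) := bmeas_vertex_proj mW W01 nuP ul bg bg' q.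
rewrite -Ex_uniform01; last exact: (bmeas_vertex_sum mW W01 nuP ul bg bg').
rewrite /vertex_sum Ex_sum; last first.
  by move=> q _; apply: bmeasB; [exact: bv|exact: bmeas_cst].
rewrite big1// => q _; rewrite ExB//; last exact: bmeas_cst.
by rewrite Ex_cst Ex_uniform01// (mean_vertex_proj mW W01 nuP ul bg bg') subrr.
Qed.

Lemma sigma2_vertex_sum :
  sigma2 F W l g = Rintegral lebesgue_measure `[0, 1]%classic (fun u => vsum u ^+ 2).
Proof.
have bv : bmeas vsum := bmeas_vertex_sum mW W01 nuP ul bg bg'.
have [c cE] := vertex_sum_curlyU.
have bc (a : R) : bmeas (fun _ : R => a) := bmeas_cst _ a.
have bU : bmeas (curlyU F W l g).
  by apply: (@eq_bmeas _ _ _ (fun u => vsum u + c)); [move=> u; rewrite cE|exact: bmeasD].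
have v0 : Ex (U01 R) vsum = 0 by rewrite Ex_uniform01// mean_vertex_sum.
rewrite /sigma2 -!Ex_uniform01//; try exact: bmeasX.
rewrite (Ex_ext _ cE) ExD// v0 Ex_cst add0r.
rewrite (Ex_ext _ (g := fun u => vsum u ^+ 2 + (2 * c) * vsum u + c ^+ 2)); last first.
  by move=> u; rewrite cE; ring.
have b2 : bmeas (fun u => vsum u ^+ 2) by exact: bmeasX.
have b3 : bmeas (fun u => (2 * c) * vsum u) by exact: bmeasM.
by rewrite ExD//; [rewrite ExD// ExZ// v0 Ex_cst mulr0 addr0 addrK|exact: bmeasD].
Qed.

End Variance.
(** * Convergence of characteristic functions *)

Section Elementary.
Variable R : realType.
Implicit Types x y : R.

(** The bounds on sine and cosine below form a chain: each difference has the previous one as its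
    derivative. *)
Lemma ge0_of_derive (f f' : R -> R) y : 0 <= f 0 -> (forall x, is_derive x 1 f (f' x)) ->
  (forall x, 0 <= x -> 0 <= f' x) -> 0 <= y -> 0 <= f y.
Proof.
move=> f0 df f'0 y0; apply: (le_trans f0).
have cf : continuous f by move=> x; apply/differentiable_continuous/derivable1_diffP; by case: (df x).
apply: (@ger0_derive1_le R f 0 y _ _ true false).
- by move=> x _; case: (df x).
- move=> x; rewrite in_itv/= => /andP[/ltW x0 _]; rewrite derive1E (@derive_val _ _ _ _ _ _ _ (df x)).
  exact: f'0.
- exact: continuous_subspaceT.
- by rewrite bound_itvE.
- by rewrite bound_itvE.
- by [].
Qed.

Lemma sin_le_id y : 0 <= y -> sin y <= y.
Proof.
move=> y0; rewrite -subr_ge0.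
apply: (@ge0_of_derive (fun x => x - sin x) (fun x => 1 - cos x)).
- by rewrite sin0 subrr.
- by move=> x _; rewrite subr_ge0 cos_le1.
- by [].
Qed.

Lemma cos_ge_quadratic y : 0 <= y -> 1 - y ^+ 2 / 2 <= cos y.
Proof.
move=> y0; rewrite -subr_ge0.
apply: (@ge0_of_derive (fun x => cos x - (1 - x ^+ 2 / 2)) (fun x => x - sin x)) => //.
- by rewrite cos0 expr0n/= mul0r; lra.
- move=> x; apply: is_derive_eq; rewrite /= /GRing.scale/=; lra.
- by move=> x x0; rewrite subr_ge0 sin_le_id.
Qed.

Lemma sin_ge_cubic y : 0 <= y -> y - y ^+ 3 / 6 <= sin y.
Proof.
move=> y0; rewrite -subr_ge0.
apply: (@ge0_of_derive (fun x => sin x - (x - x ^+ 3 / 6)) (fun x => cos x - (1 - x ^+ 2 / 2))) => //.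
- by rewrite sin0 expr0n/= mul0r; lra.
- move=> x; apply: is_derive_eq; rewrite /= /GRing.scale/=; lra.
- by move=> x x0; rewrite subr_ge0 cos_ge_quadratic.
Qed.

Lemma cos_le_quartic y : 0 <= y -> cos y <= 1 - y ^+ 2 / 2 + y ^+ 4 / 24.
Proof.
move=> y0; rewrite -subr_ge0.
apply: (@ge0_of_derive (fun x => 1 - x ^+ 2 / 2 + x ^+ 4 / 24 - cos x)
  (fun x => sin x - (x - x ^+ 3 / 6))) => //.
- by rewrite cos0 !expr0n/= !mul0r; lra.
- move=> x; apply: is_derive_eq; rewrite /= /GRing.scale/=; lra.
- by move=> x x0; rewrite subr_ge0 sin_ge_cubic.
Qed.

Lemma expRN_le_quadratic y : 0 <= y -> expR (- y) <= 1 - y + y ^+ 2 / 2.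
Proof.
move=> y0; rewrite -subr_ge0.
apply: (@ge0_of_derive (fun x => 1 - x + x ^+ 2 / 2 - expR (- x)) (fun x => expR (- x) - (1 - x))) .
- by rewrite oppr0 expR0 expr0n/= mul0r; lra.
- move=> x; apply: is_derive_eq; rewrite /= /GRing.scale/=; lra.
- by move=> x x0; rewrite subr_ge0; exact: expR_ge1Dx.
- by [].
Qed.

Lemma sin_approx y : `|sin y - y| <= `|y| ^+ 3.
Proof.
wlog y0 : y / 0 <= y.
  move=> H; case: (leP 0 y) => [/H //|/ltW]; rewrite -oppr_ge0 => /H.
  by rewrite sinN -opprD !normrN.
have := sin_ge_cubic y0; have := sin_le_id y0; have : 0 <= y ^+ 3 by exact: exprn_ge0.
by rewrite (ger0_norm y0) ler_norml => ???; apply/andP; split; lra.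
Qed.

Lemma cos_approx y : `|cos y - 1 + y ^+ 2 / 2| <= `|y| ^+ 4 / 2.
Proof.
wlog y0 : y / 0 <= y.
  move=> H; case: (leP 0 y) => [/H //|/ltW]; rewrite -oppr_ge0 => /H.
  by rewrite cosN sqrrN normrN.
have := cos_le_quartic y0; have := cos_ge_quadratic y0; have : 0 <= y ^+ 4 by exact: exprn_ge0.
by rewrite (ger0_norm y0) ler_norml => ???; apply/andP; split; lra.
Qed.

Lemma expRN_approx y : 0 <= y -> `|expR (- y) - 1 + y| <= y ^+ 2 / 2.
Proof.
move=> y0; have := expRN_le_quadratic y0; have := expR_ge1Dx (- y); have : 0 <= y ^+ 2 by exact: exprn_ge0.
by rewrite ler_norml => ???; apply/andP; split; lra.
Qed.

End Elementary.

Section CentralLimit.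
Variable R : realType.
Variable nu : probability (cspace R idx) R.
Hypothesis nuP : iid_unif nu.
Variables (h : R -> R) (M s2 : R).
Hypothesis bh : bmeas h.
Hypothesis hM : forall u, `|h u| <= M.
Hypothesis h0 : Rintegral lebesgue_measure `[0, 1]%classic h = 0.
Hypothesis s2E : Rintegral lebesgue_measure `[0, 1]%classic (fun u => h u ^+ 2) = s2.

(** The cubic term comes from the sine; the quartic terms, with coefficients 1/2 from the cosine and
    1/8 from the exponential, are covered generously by 2. *)
Definition charfun_err (s : R) : R := `|s| ^+ 3 * M ^+ 3 + 2 * (s ^+ 4 * M ^+ 4).

Lemma measurable_cos : measurable_fun setT (cos : R -> R).
Proof. by apply: continuous_measurable_fun; exact: continuous_cos. Qed.

Lemma bmeas_cos d (T : measurableType d) (f : T -> R) : measurable_fun setT f ->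
  bmeas (fun x => cos (f x)).
Proof.
move=> mf; split; first exact: (measurableT_comp measurable_cos mf).
by exists 1 => x; exact: cos_max.
Qed.

(** The addition formula and second-order expansions replace the integrand by [q], whose linear term
    integrates to 0 because [h] is centred. The phase [b] is arbitrary so that it can hold the rest
    of a sum. *)
Lemma Ex_cos_step b s : `|Rintegral lebesgue_measure `[0, 1]%classic (fun u => cos (b + s * h u))
   - cos b * expR (- (s ^+ 2 * s2 / 2))| <= charfun_err s.
Proof.
have M0 : 0 <= M by apply: le_trans (hM 0).
have b2 : bmeas (fun u => h u ^+ 2) by exact: bmeasX.
have bc (c : R) : bmeas (fun _ : R => c) by exact: bmeas_cst.
have s20 : 0 <= s2 by rewrite -s2E -Ex_uniform01//; apply: Ex_ge0 => u; exact: sqr_ge0.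
have s2M : s2 <= M ^+ 2.
  rewrite -s2E -Ex_uniform01// -(Ex_cst (U01 R) (M ^+ 2)); apply: Ex_le => // u.
  by rewrite -real_normK ?num_real// lerXn2r// nnegrE.
have bcos : bmeas (fun u => cos (b + s * h u)).
  by apply: bmeas_cos; case: (bmeasD (bc b) (bmeasM (bc s) bh)).
set q := fun u => cos b * (1 - s ^+ 2 * h u ^+ 2 / 2) - sin b * (s * h u).
rewrite -(Ex_uniform01 bcos).
have qE u : q u = cos b + (- (cos b * s ^+ 2 / 2)) * h u ^+ 2 + (- (sin b * s)) * h u.
  by rewrite /q; field.
have b3 c : bmeas (fun u => c * h u) by exact: bmeasM.
have b4 c : bmeas (fun u => c * h u ^+ 2) by exact: bmeasM.
have bq : bmeas q.
  apply: (@eq_bmeas _ _ _ (fun u => cos b + (- (cos b * s ^+ 2 / 2)) * h u ^+ 2 + (- (sin b * s)) * h u)).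
    by move=> u; rewrite qE.
  by apply: bmeasD => //; exact: bmeasD.
have Eq : Ex (U01 R) q = cos b * (1 - s ^+ 2 * s2 / 2).
  rewrite (Ex_ext _ qE) ExD//; last exact: bmeasD.
  by rewrite ExD// Ex_cst !ExZ// !Ex_uniform01// h0 s2E; field.
have -> : Ex (U01 R) (fun u => cos (b + s * h u)) - cos b * expR (- (s ^+ 2 * s2 / 2)) =
   Ex (U01 R) (fun u => cos (b + s * h u) - q u) -
   cos b * (expR (- (s ^+ 2 * s2 / 2)) - 1 + s ^+ 2 * s2 / 2).
  by rewrite ExB// Eq; ring.
apply: (le_trans (ler_normB _ _)).
have e1 : `|Ex (U01 R) (fun u => cos (b + s * h u) - q u)| <= s ^+ 4 * M ^+ 4 / 2 + `|s| ^+ 3 * M ^+ 3.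
  apply: Ex_norm_le_cst; first exact: bmeasB.
  move=> u; have -> : cos (b + s * h u) - q u =
     cos b * (cos (s * h u) - 1 + (s * h u) ^+ 2 / 2) - sin b * (sin (s * h u) - s * h u).
    by rewrite cosD /q; field.
  have shM : `|s * h u| <= `|s| * M by rewrite normrM ler_wpM2l.
  apply: (le_trans (ler_normB _ _)); apply: lerD; rewrite normrM.
    apply: le_trans (ler_piMl _ (cos_max b)) _ => //; apply: le_trans (cos_approx _) _.
    rewrite ler_pM2r ?invr_gt0//; apply: (le_trans (lerXn2r 4 _ _ shM)); rewrite ?nnegrE ?mulr_ge0//.
    by rewrite exprMn -normrX ger0_norm// (exprM s 2 2) sqr_ge0.
  apply: le_trans (ler_piMl _ (sin_max b)) _ => //; apply: le_trans (sin_approx _) _.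
  by apply: (le_trans (lerXn2r 3 _ _ shM)); rewrite ?nnegrE ?mulr_ge0// exprMn.
have e2 : `|cos b * (expR (- (s ^+ 2 * s2 / 2)) - 1 + s ^+ 2 * s2 / 2)| <= s ^+ 4 * M ^+ 4 / 8.
  rewrite normrM; apply: le_trans (ler_piMl _ (cos_max b)) _ => //.
  have y0 : 0 <= s ^+ 2 * s2 / 2 by rewrite divr_ge0// mulr_ge0// sqr_ge0.
  apply: le_trans (expRN_approx y0) _.
  have : (s ^+ 2 * s2) ^+ 2 <= s ^+ 4 * M ^+ 4.
    have -> : s ^+ 4 * M ^+ 4 = (s ^+ 2 * M ^+ 2) ^+ 2 by ring.
    have sM : s ^+ 2 * s2 <= s ^+ 2 * M ^+ 2 by rewrite ler_wpM2l ?sqr_ge0.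
    by apply: lerXn2r sM; rewrite nnegrE mulr_ge0 ?sqr_ge0.
  by rewrite expr_div_n; lra.
have s4 : 0 <= s ^+ 4 * M ^+ 4 by rewrite mulr_ge0// ?(exprM _ 2 2) ?sqr_ge0.
apply: le_trans (lerD e1 e2) _; rewrite /charfun_err; lra.
Qed.

Lemma bmeas_coord_sum n : bmeas (fun z : cspace R idx => \sum_(i < n) h (z (inl (i : nat)))).
Proof. by apply: bmeas_sum => i _; apply: bmeas_comp bh; exact: measurable_coord. Qed.

Lemma coord_sum_upd n (z : idx -> R) u : \sum_(i < n.+1) h (upd z (inl n : idx) u (inl (i : nat))) =
  \sum_(i < n) h (z (inl (i : nat))) + h u.
Proof.
rewrite big_ord_recr/= /upd eqxx; congr (_ + _); apply: eq_bigr => i _.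
by rewrite ifN//; apply/eqP => -[] ii; have := ltn_ord i; rewrite ii ltnn.
Qed.

(** Given the first [n] coordinates, the last one is integrated by [Ex_cos_step] with the partial
    sum in the phase. Each step multiplies the previous error by [e <= 1] and adds one
    [charfun_err]. *)
Lemma Ex_cos_sum a s n :
  `|Ex nu (fun z => cos (a + s * \sum_(i < n) h (z (inl (i : nat))))) -
    cos a * expR (- (s ^+ 2 * s2 / 2)) ^+ n| <= n%:R * charfun_err s.
Proof.
have bS m : bmeas (fun z : cspace R idx => cos (a + s * \sum_(i < m) h (z (inl (i : nat))))).
  apply: bmeas_cos; apply: measurable_funD => //; apply: measurable_funM => //.
  exact: (bmeas_coord_sum m).1.
set e := expR _; have e0 : 0 <= e by exact: expR_ge0.
have e1 : e <= 1.
  rewrite /e expR_le1 oppr_le0 divr_ge0// mulr_ge0 ?sqr_ge0// -s2E -Ex_uniform01; last exact: bmeasX.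
  by apply: Ex_ge0 => u; exact: sqr_ge0.
elim: n => [|n IH].
  rewrite mul0r expr0 mulr1 (Ex_ext _ (g := fun=> cos a)) ?Ex_cst ?subrr ?normr0//.
  by move=> z; rewrite big_ord0 mulr0 addr0.
rewrite (Ex_resample_inner nuP (inl n))//.
set f := fun z : cspace R idx => _.
have fE z : f z = Rintegral lebesgue_measure `[0, 1]%classic
    (fun u => cos ((a + s * \sum_(i < n) h (z (inl (i : nat)))) + s * h u)).
  by apply: eq_Rintegral => u _; rewrite coord_sum_upd mulrDr addrA.
have bf : bmeas f.
  have bF := bmeas_comp (measurable_upd (R := R) (inl n : idx)) (bS n.+1).
  have bE := bmeas_Ex1 (U01 R) bF.
  apply: (eq_bmeas _ bE) => z; rewrite Ex_uniform01//.
  exact: (bmeas_slice2 z bF).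
have -> : Ex nu f - cos a * e ^+ n.+1 =
   Ex nu (fun z => f z - cos (a + s * \sum_(i < n) h (z (inl (i : nat)))) * e) +
   e * (Ex nu (fun z => cos (a + s * \sum_(i < n) h (z (inl (i : nat))))) - cos a * e ^+ n).
  have bce : bmeas (fun z : cspace R idx => cos (a + s * \sum_(i < n) h (z (inl (i : nat)))) * e).
    by apply: bmeasM => //; exact: bmeas_cst.
  rewrite ExB// (Ex_ext _ (f := fun z : cspace R idx => cos (a + s * \sum_(i < n) h (z (inl (i : nat)))) * e)
    (g := fun z => e * cos (a + s * \sum_(i < n) h (z (inl (i : nat)))))).
    by rewrite ExZ// exprS; ring.
  by move=> z; rewrite mulrC.
apply: le_trans (ler_normD _ _) _.
rewrite -natr1 mulrDl mul1r addrC; apply: lerD.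
  by rewrite normrM (ger0_norm e0); apply: le_trans (ler_piMl _ e1) _.
apply: Ex_norm_le_cst.
  by apply: bmeasB => //; apply: bmeasM => //; exact: bmeas_cst.
by move=> z; rewrite fE; exact: Ex_cos_step.
Qed.

End CentralLimit.

(** * Gaussian integrals of cosines *)

Section Gaussian.
Variable R : realType.
Local Notation mu := (@lebesgue_measure R).
Implicit Types (f : R -> R) (t z a : R).

Definition gauss z : R := expR (- (z ^+ 2) / 2) / Num.sqrt (2 * pi).

Lemma gauss_ge0 z : 0 <= gauss z.
Proof. by rewrite divr_ge0 ?expR_ge0// sqrtr_ge0. Qed.

Lemma gaussE : gauss = normal_pdf 0 1.
Proof.
rewrite normal_pdfE ?oner_neq0//; apply/funext => z.
rewrite /gauss /normal_peak /normal_fun subr0 expr1n mul1r mulrC.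
by rewrite -(mulr_natl pi).
Qed.

Lemma integrable_gauss : mu.-integrable setT (EFin \o gauss).
Proof. by rewrite gaussE; exact: integrable_normal_pdf. Qed.

Lemma integral_gauss : Rintegral mu setT gauss = 1.
Proof. by rewrite gaussE /Rintegral integral_normal_pdf. Qed.

Lemma is_derive_gauss z : is_derive z 1 gauss (- z * gauss z).
Proof.
rewrite /gauss; apply: is_derive_eq; rewrite /GRing.scale/=; lra.
Qed.

Lemma continuous_of_derive f f' : (forall z, is_derive z 1 f (f' z)) -> continuous f.
Proof. by move=> df z; apply/differentiable_continuous/derivable1_diffP; case: (df z). Qed.

Lemma continuous_gauss : continuous gauss.
Proof. exact: continuous_of_derive is_derive_gauss. Qed.

(** From [|z| <= 1 + z^2/4 <= exp (z^2/4)], half of the Gaussian exponent absorbs [|z|]. What is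
    left is, up to a constant, the normal density of variance 2, known to be integrable. *)
Lemma norm_gauss_le z : `|z| * gauss z <=
  (Num.sqrt (2 * pi))^-1 * (normal_peak (Num.sqrt 2))^-1 * normal_pdf 0 (Num.sqrt 2) z.
Proof.
have s2 : Num.sqrt 2 != 0 :> R by rewrite sqrtr_eq0 -ltNge.
rewrite normal_pdfE// -mulrA mulKf ?gt_eqF ?normal_peak_gt0//.
rewrite /gauss mulrA mulrC ler_wpM2l ?invr_ge0 ?sqrtr_ge0//.
rewrite /normal_fun subr0 sqr_sqrtr//.
have -> : - z ^+ 2 / 2 = - z ^+ 2 / (2 *+ 2) + - (z ^+ 2 / 4) by rewrite mulr2n; field.
rewrite expRD mulrCA ler_piMr ?expR_ge0//.
rewrite expRN ler_pdivrMr ?expR_gt0// mul1r.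
apply: le_trans (expR_ge1Dx _).
rewrite -[z ^+ 2]real_normK ?num_real//.
have := sqr_ge0 (`|z| / 2 - 1); rewrite sqrrB expr1n; lra.
Qed.

Lemma integrable_mul_gauss (h : R -> R) : measurable_fun setT h ->
  (exists C : R, forall z, `|h z| <= C * (1 + `|z|)) ->
  mu.-integrable setT (EFin \o (fun z => h z * gauss z)).
Proof.
move=> mh [C hC].
pose c : R := (Num.sqrt (2 * pi))^-1 * (normal_peak (Num.sqrt 2))^-1.
apply: (@le_integrable _ _ _ mu setT _ _
  (EFin \o (fun z => C * (gauss z + c * normal_pdf 0 (Num.sqrt 2) z)))) => //.
- apply/measurable_EFinP; apply: measurable_funM => //.
  by apply: continuous_measurable_fun; exact: continuous_gauss.
- move=> z _ /=; rewrite lee_fin normrM (ger0_norm (gauss_ge0 z)).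
  apply: le_trans (ler_wpM2r (gauss_ge0 z) (hC z)) _; apply: le_trans (ler_norm _).
  have C0 : 0 <= C by apply: le_trans (normr_ge0 (h 0)) _; have := hC 0; rewrite normr0 addr0 mulr1.
  rewrite -mulrA ler_wpM2l// mulrDl mul1r lerD2l; exact: norm_gauss_le.
- rewrite [X in _.-integrable _ X](_ : _ = (fun z =>
    C%:E * ((gauss z)%:E + (c%:E * (normal_pdf 0 (Num.sqrt 2) z)%:E)))%E)//.
  apply: integrableZl => //; apply: integrableD => //; first exact: integrable_gauss.
  by apply: integrableZl => //; exact: integrable_normal_pdf.
Qed.

Lemma gauss_decay : exists C, forall z, gauss z * (1 + `|z|) <= C.
Proof.
pose c : R := (Num.sqrt (2 * pi))^-1 * (normal_peak (Num.sqrt 2))^-1.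
exists (normal_peak 1 + c * normal_peak (Num.sqrt 2)) => z.
have s2 : Num.sqrt 2 != 0 :> R by rewrite sqrtr_eq0 -ltNge.
rewrite mulrDr mulr1 [gauss z * `|z|]mulrC; apply: lerD.
  by rewrite gaussE; apply: normal_pdf_ub; exact: oner_neq0.
apply: le_trans (norm_gauss_le z) _; rewrite ler_wpM2l//; last exact: normal_pdf_ub.
by rewrite mulr_ge0// invr_ge0 ?sqrtr_ge0// normal_peak_ge0.
Qed.

(** By dominated convergence the integral is the limit of those over [[-(n+1), n+1]], which are
    boundary differences of [f]; these are of order [1/n] by the decay assumption. *)
Lemma Rintegral_derive_eq0 f f' : (forall z, is_derive z 1 f (f' z)) -> continuous f' ->
  mu.-integrable setT (EFin \o f') -> (exists C, forall z, `|f z| * (1 + `|z|) <= C) ->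
  Rintegral mu setT f' = 0.
Proof.
move=> df cf' if' [C fC].
have cf := continuous_of_derive df.
pose D (n : nat) : set R := `[- n.+1%:R, n.+1%:R]%classic.
have mf' : measurable_fun setT f' by exact: continuous_measurable_fun.
have mD n : measurable (D n) by exact: measurable_itv.
have h1 n : measurable_fun (setT : set R) ((EFin \o f') \_ (D n)).
  by apply/(measurable_restrictT _ (mD n)); apply: measurable_funTS; exact/measurable_EFinP.
have h2 : measurable_fun (setT : set R) (EFin \o f') by exact/measurable_EFinP.
have h3 : \forall x \ae mu, (setT : set R) x -> ((EFin \o f') \_ (D n)) x @[n --> \oo] --> (EFin \o f') x.
  apply: aeW => x _; apply: cvg_near_cst.
  have [N _ HN] := nbhs_infty_gtr `|x|.
  exists N => // n /= Nn; rewrite patchE ifT// inE /D/= in_itv/= -ler_norml.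
  by apply: ltW; apply: lt_le_trans (HN n Nn) _; rewrite ler_nat.
have h4 : \forall x \ae mu, forall n, (setT : set R) x -> (`|((EFin \o f') \_ (D n)) x| <= `|(f' x)%:E|)%E.
  apply: aeW => x n _; rewrite patchE; case: ifP => // _; by rewrite abse0.
have [_ _ cvg] := @dominated_convergence _ (measurableTypeR R) R mu setT measurableT _ _ _
  h1 h2 h3 (integrable_abse if') h4.
have cvg0 : [sequence (\int[mu]_(x in setT) ((EFin \o f') \_ (D n)) x)%E]_n @ \oo --> 0%E.
  rewrite (_ : [sequence _]_n = (fun n => (f n.+1%:R - f (- n.+1%:R))%:E)); last first.
    apply/funext => n /=; rewrite -integral_mkcond EFinB; apply: continuous_FTC2.
    - by rewrite -subr_gt0 opprK -natrD ltr0n.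
    - by apply: continuous_subspaceT.
    - split => //.
      + exact/cvg_at_right_filter/cf.
      + exact/cvg_at_left_filter/cf.
    - by move=> x _; rewrite derive1E; case: (df x).
  apply/cvg_EFin; first by near=> n.
  apply: (@squeeze_cvgr _ _ _ _ (fun n => - (2 * C) * harmonic n) (fun n => (2 * C) * harmonic n)).
  - near=> n; rewrite mulNr -ler_norml.
    have b y : `|y| = n.+1%:R -> `|f y| <= C * harmonic n.
      move=> yn; rewrite /= ler_pdivlMr ?ltr0n//.
      by apply: le_trans (fC y); rewrite yn ler_wpM2l// ler_wpDl.
    apply: le_trans (ler_normB _ _) _; rewrite -mulrA mulr_natl mulr2n.
    by apply: lerD; apply: b; rewrite ?normrN normr_nat.
  - by rewrite -[0 in X in _ --> X](mulr0 (- (2 * C))); apply: cvgMr; exact: cvg_harmonic.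
  - by rewrite -[0 in X in _ --> X](mulr0 (2 * C)); apply: cvgMr; exact: cvg_harmonic.
have : (\int[mu]_x (f' x)%:E)%E = 0%E by apply: cvg_unique cvg cvg0.
by rewrite /Rintegral => ->.
Unshelve. all: by end_near.
Qed.

Definition gauss_cos a t : R := Rintegral mu setT (fun z => cos (a + t * z) * gauss z).

(** Differentiation under the integral, dominated by [|z| * gauss z], brings down [- z * sin].
    Integration by parts, in the form that the derivative of [sin (a + t z) * gauss z] has integral
    0, turns it into [- t * cos]. *)
Lemma is_derive_gauss_cos a t : is_derive t 1 (gauss_cos a) (- t * gauss_cos a t).
Proof.
have mg : measurable_fun setT gauss by apply: continuous_measurable_fun; exact: continuous_gauss.
have msin : measurable_fun setT (fun z => sin (a + t * z)).
  apply: continuous_measurable_fun => z; apply: continuous_comp; last exact: continuous_sin.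
  by apply: cvgD; [exact: cvg_cst|apply: cvgM; [exact: cvg_cst|exact: cvg_id]].
have icos x : mu.-integrable setT (EFin \o (fun z => cos (a + x * z) * gauss z)).
  apply: integrable_mul_gauss.
    apply: continuous_measurable_fun => z; apply: continuous_comp; last exact: continuous_cos.
    by apply: cvgD; [exact: cvg_cst|apply: cvgM; [exact: cvg_cst|exact: cvg_id]].
  by exists 1 => z; rewrite mul1r; apply: le_trans (cos_max _) _; rewrite ler_wpDr.
have iz : mu.-integrable setT (EFin \o (fun z => `|z| * gauss z)).
  apply: integrable_mul_gauss; first by apply: continuous_measurable_fun; exact: norm_continuous.
  by exists 1 => z; rewrite normr_id mul1r ler_wpDl.
have isin : mu.-integrable setT (EFin \o (fun z => (z * sin (a + t * z)) * gauss z)).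
  apply: integrable_mul_gauss; first exact: measurable_funM.
  exists 1 => z; rewrite mul1r normrM; apply: le_trans (ler_piMr _ (sin_max _)) _ => //.
  by rewrite ler_wpDl.
have D (x z : R) : is_derive x 1 (fun x => cos (a + x * z) * gauss z) (- (z * sin (a + x * z)) * gauss z).
  by apply: is_derive_eq; rewrite /GRing.scale/=; ring.
have tI : `]t - 1, t + 1[%classic t by rewrite /= in_itv/=; apply/andP; split; lra.
have G0 z : 0 <= `|z| * gauss z by rewrite mulr_ge0// gauss_ge0.
have dx x z : `]t - 1, t + 1[%classic x -> setT z ->
  derivable ((fun x z => cos (a + x * z) * gauss z)^~ z) x 1 by move=> _ _; case: (D x z).
have Gb x z : `]t - 1, t + 1[%classic x -> setT z ->
    `|partial1of2 (fun x z => cos (a + x * z) * gauss z) x z| <= `|z| * gauss z.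
  move=> _ _; rewrite /partial1of2 derive1E; case: (D x z) => _ ->.
  rewrite normrM (ger0_norm (gauss_ge0 z)) ler_wpM2r ?gauss_ge0//.
  by rewrite normrN normrM; exact: ler_piMr (sin_max _).
have ic x : `]t - 1, t + 1[%classic x -> mu.-integrable setT (EFin \o (fun z => cos (a + x * z) * gauss z)).
  by move=> _; exact: icos.
have der := @derivable_under_integral R _ _ mu _ setT measurableT t _ _ tI ic dx _ G0 iz Gb.
have val := @differentiation_under_integral R _ _ mu _ setT measurableT t _ _ tI ic dx _ G0 iz Gb.
apply: DeriveDef => //; rewrite -derive1E [LHS]val.
pose f' z := t * (cos (a + t * z) * gauss z) - (z * sin (a + t * z)) * gauss z.
have df z : is_derive z 1 (fun z => sin (a + t * z) * gauss z) (f' z).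
  have dg := is_derive_gauss z.
  by apply: is_derive_eq; rewrite /f' /GRing.scale/=; ring.
have itcos : mu.-integrable setT (EFin \o (fun z => t * (cos (a + t * z) * gauss z))).
  rewrite [X in _.-integrable _ X](_ : _ = (fun z => t%:E * (cos (a + t * z) * gauss z)%:E))%E//.
  by apply: integrableZl => //; exact: icos.
have itcosN : mu.-integrable setT (EFin \o (fun z => - t * (cos (a + t * z) * gauss z))).
  rewrite [X in _.-integrable _ X](_ : _ = (fun z => (- t)%:E * (cos (a + t * z) * gauss z)%:E))%E//.
  by apply: integrableZl => //; exact: icos.
have if' : mu.-integrable setT (EFin \o f').
  rewrite [X in _.-integrable _ X](_ : _ = (fun z =>
    (t * (cos (a + t * z) * gauss z))%:E - ((z * sin (a + t * z)) * gauss z)%:E))%E//.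
  by apply: integrableB.
have cu z : {for z, continuous (fun z => a + t * z)}.
  by apply: cvgD; [exact: cvg_cst|apply: cvgM; [exact: cvg_cst|exact: cvg_id]].
have ccos : continuous (fun z => cos (a + t * z)).
  by move=> z; apply: continuous_comp (cu z) _; exact: continuous_cos.
have csin : continuous (fun z => sin (a + t * z)).
  by move=> z; apply: continuous_comp (cu z) _; exact: continuous_sin.
have cf' : continuous f'.
  move=> z; apply: cvgB.
    by apply: cvgM; [exact: cvg_cst|apply: cvgM; [exact: ccos|exact: continuous_gauss]].
  by apply: cvgM; [apply: cvgM; [exact: cvg_id|exact: csin]|exact: continuous_gauss].
have f'0 : Rintegral mu setT f' = 0.
  apply: (Rintegral_derive_eq0 df cf' if'); have [C gC] := gauss_decay; exists C => z.
  rewrite normrM (ger0_norm (gauss_ge0 z)) -mulrA; apply: le_trans (gC z).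
  by apply: ler_piMl (sin_max _); rewrite mulr_ge0 ?gauss_ge0// addr_ge0.
transitivity (Rintegral mu setT (fun z => f' z + - t * (cos (a + t * z) * gauss z))); last first.
  by rewrite RintegralD// f'0 add0r RintegralZl.
apply: eq_Rintegral => z _; rewrite /partial1of2 derive1E; case: (D t z) => _ ->.
by rewrite /f'; ring.
Qed.

(** The differential equation makes the product with [expR (x ^+ 2 / 2)] constant; its value is read
    at 0. *)
Lemma gauss_cosE a t : gauss_cos a t = cos a * expR (- (t ^+ 2 / 2)).
Proof.
have d (x : R) : is_derive x 1 (fun x : R => gauss_cos a x * expR (x ^+ 2 / 2)) 0.
  have dg := is_derive_gauss_cos a x.
  by apply: is_derive_eq; rewrite /GRing.scale/=; lra.
have /= := is_derive_0_is_cst t 0 d.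
rewrite expr0n/= mul0r expR0 mulr1 {2}/gauss_cos.
have -> : Rintegral mu setT (fun z => cos (a + 0 * z) * gauss z) = cos a.
  transitivity (Rintegral mu setT (fun z => cos a * gauss z)).
    by apply: eq_Rintegral => z _; rewrite mul0r addr0.
  by rewrite RintegralZl ?integral_gauss ?mulr1//; exact: integrable_gauss.
by move=> <-; rewrite -mulrA -expRD subrr expR0 mulr1.
Qed.

End Gaussian.
(** * From cosines to bounded continuous functions *)

Section TrigApproximation.
Variable R : realType.
Implicit Types (q h : R -> R) (x y : R).

(** Triples of amplitude, phase and frequency. With free phases, sines are included and the class is
    closed under products by the product-to-sum formula. *)
Definition trig_poly q : Prop := exists s : seq (R * R * R),
  forall x, q x = \sum_(c <- s) c.1.1 * cos (c.1.2 + c.2 * x).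

Lemma eq_trig q q' : q =1 q' -> trig_poly q -> trig_poly q'.
Proof. by move=> qq [s sE]; exists s => x; rewrite -qq. Qed.

Lemma trig_cos c a t : trig_poly (fun x => c * cos (a + t * x)).
Proof. by exists [:: (c, a, t)] => x; rewrite big_seq1. Qed.

Lemma trig_cst c : trig_poly (fun=> c).
Proof.
apply: eq_trig (trig_cos c 0 0) => x.
by rewrite mul0r addr0 cos0 mulr1.
Qed.

Lemma trigD q q' : trig_poly q -> trig_poly q' -> trig_poly (fun x => q x + q' x).
Proof. by move=> [s sE] [s' s'E]; exists (s ++ s') => x; rewrite big_cat/= sE s'E. Qed.

Lemma trig_ind (Q : (R -> R) -> Prop) :
  (forall c a t, Q (fun x => c * cos (a + t * x))) ->
  (forall q q', trig_poly q -> trig_poly q' -> Q q -> Q q' -> Q (fun x => q x + q' x)) ->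
  forall q, trig_poly q -> Q q.
Proof.
move=> Qcos QD q [s sE].
rewrite (_ : q = fun x => \sum_(c <- s) c.1.1 * cos (c.1.2 + c.2 * x)); last exact/funext.
elim: s {q sE} => [|c s IH].
  rewrite (_ : (fun _ => _) = fun x => 0 * cos (0 + 0 * x)) //.
  by apply/funext => x; rewrite big_nil mul0r.
rewrite (_ : (fun _ => _) = fun x => c.1.1 * cos (c.1.2 + c.2 * x) +
  \sum_(c <- s) c.1.1 * cos (c.1.2 + c.2 * x)); last by apply/funext => x; rewrite big_cons.
by apply: QD => //; [exact: trig_cos|exists s].
Qed.

Lemma continuous_cos_affine (c a t : R) : continuous (fun x => c * cos (a + t * x)).
Proof.
move=> x; apply: cvgM; first exact: cvg_cst.
apply: (@continuous_comp _ _ _ (fun x => a + t * x) cos); last exact: continuous_cos.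
by apply: cvgD; [exact: cvg_cst|apply: cvgM; [exact: cvg_cst|exact: cvg_id]].
Qed.

Lemma continuous_trig q : trig_poly q -> continuous q.
Proof.
move: q; apply: trig_ind => [c a t|q q' _ _ cq cq' x]; first exact: continuous_cos_affine.
by apply: cvgD; [exact: cq|exact: cq'].
Qed.

Lemma trig_bounded q : trig_poly q -> exists M, forall x, `|q x| <= M.
Proof.
move: q; apply: trig_ind => [c a t|q q' _ _ [M qM] [M' qM']].
  by exists `|c| => x; rewrite normrM ler_piMr// cos_max.
by exists (M + M') => x; apply: le_trans (ler_normD _ _) _; exact: lerD.
Qed.

Lemma trig_sum (I : Type) (s : seq I) (f : I -> R -> R) : (forall i, trig_poly (f i)) ->
  trig_poly (fun x => \sum_(i <- s) f i x).
Proof.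
move=> tf; elim: s => [|i s IH].
  by apply: eq_trig (trig_cst 0) => x; rewrite big_nil.
by apply: eq_trig (trigD (tf i) IH) => x; rewrite big_cons.
Qed.

Lemma trigM q q' : trig_poly q -> trig_poly q' -> trig_poly (fun x => q x * q' x).
Proof.
move=> [s sE] [s' s'E].
apply: (@eq_trig (fun x => \sum_(c <- s) \sum_(c' <- s')
    (c.1.1 * cos (c.1.2 + c.2 * x)) * (c'.1.1 * cos (c'.1.2 + c'.2 * x)))).
  move=> x; rewrite sE s'E mulr_suml; apply: eq_bigr => c _.
  by rewrite mulr_sumr.
apply: trig_sum => -[[c a] t]; apply: trig_sum => -[[c' a'] t'] /=.
apply: eq_trig (trigD (trig_cos (c * c' / 2) (a + a') (t + t'))
                      (trig_cos (c * c' / 2) (a - a') (t - t'))) => x.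
have -> : a + a' + (t + t') * x = (a + t * x) + (a' + t' * x) by ring.
have -> : a - a' + (t - t') * x = (a + t * x) - (a' + t' * x) by ring.
by rewrite cosB cosD; field.
Qed.

Lemma trig_sin t : trig_poly (fun x => sin (t * x)).
Proof.
apply: eq_trig (trig_cos 1 (- (pi / 2)) t) => x.
by rewrite mul1r addrC cosBpihalf.
Qed.

(* [bern n g y] is the mean of [g] under the binomial law of parameters [n] and [y], that is the
   Bernstein polynomial of [g], given by conditioning on the first trial. *)
Fixpoint bern (n : nat) (g : nat -> R) (y : R) : R :=
  if n is n'.+1 then (1 - y) * bern n' g y + y * bern n' (g \o succn) y else g 0.

Lemma bernD n g g' y : bern n (fun k => g k + g' k) y = bern n g y + bern n g' y.
Proof. by elim: n g g' => //= n IH g g'; rewrite IH (IH (g \o succn) (g' \o succn)); ring. Qed.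

Lemma bernZ n c g y : bern n (fun k => c * g k) y = c * bern n g y.
Proof. by elim: n g => //= n IH g; rewrite IH (IH (g \o succn)); ring. Qed.

Lemma bern_cst n c y : bern n (fun=> c) y = c.
Proof. by elim: n => //= n IH; rewrite /comp IH; ring. Qed.

Lemma bern_le n g g' y : 0 <= y <= 1 -> (forall k, (k <= n)%N -> g k <= g' k) -> bern n g y <= bern n g' y.
Proof.
move=> /andP[y0 y1]; elim: n g g' => /= [|n IH] g g' gg; first exact: gg.
by apply: lerD; rewrite ler_wpM2l ?subr_ge0//; apply: IH => k kn; apply: gg => //; exact: leqW.
Qed.

(** The shift [c] is there for the induction, since conditioning on the first trial moves the centre
    by [- y] or [1 - y]. At [c = 0] this is the binomial variance. *)
Lemma bern_variance n c y :
  bern n (fun k => (k%:R - n%:R * y + c) ^+ 2) y = n%:R * y * (1 - y) + c ^+ 2.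
Proof.
elim: n c => /= [|n IH] c; first by rewrite !mul0r subr0 !add0r.
have -> : (fun k : nat => (k%:R - n.+1%:R * y + c) ^+ 2) = (fun k : nat => (k%:R - n%:R * y + (c - y)) ^+ 2).
  by apply/funext => k; rewrite -natr1; ring.
have -> : (fun k : nat => (k%:R - n%:R * y + (c - y)) ^+ 2) \o succn =
   (fun k : nat => (k%:R - n%:R * y + (c + 1 - y)) ^+ 2).
  by apply/funext => k /=; rewrite -natr1; ring.
by rewrite !IH -natr1; ring.
Qed.

Lemma bern_trig n g q : trig_poly q -> trig_poly (fun x => bern n g (q x)).
Proof.
move=> tq; elim: n g => /= [|n IH] g; first exact: trig_cst.
apply: trigD; apply: trigM => //.
apply: (@eq_trig (fun x => 1 + (-1) * q x)); first by move=> x; rewrite mulN1r.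
by apply: trigD; [exact: trig_cst|apply: trigM => //; exact: trig_cst].
Qed.

(** Only [x] is confined to [K]; [y] is free. This is needed because the nodes at which Bernstein
    polynomials sample a function may leave the compact set where continuity is known. *)
Lemma compact_modulus (K : set R) (f : R -> R) (e : R) : compact K ->
  (forall x, K x -> {for x, continuous f}) -> 0 < e ->
  exists2 r, 0 < r & forall x y, K x -> `|x - y| < r -> `|f x - f y| < e.
Proof.
move=> cK cf e0.
have : \forall r \near (0 : R)^'+, K `<=` (fun x => forall y, `|x - y| < r -> `|f x - f y| < e).
  have /compact_near_coveringP nc := cK.
  apply: nc => x Kx.
  have e2 : 0 < e / 2 by rewrite divr_gt0.
  have /cvgrPdist_lt/(_ _ e2) := cf x Kx; rewrite -nbhs_nearE => /nbhs_ballP[r /= r0 rP].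
  exists (ball x (r / 2), [set s | 0 < s < r / 2]) => /=.
    split; first by apply: nbhsx_ballx; rewrite divr_gt0.
    near=> s; apply/andP; split; near: s; first exact: nbhs_right_gt.
    by apply: nbhs_right_lt; rewrite divr_gt0.
  move=> [x' s] [/= bx /andP[s0 sr]] y x'y; rewrite /ball/= in bx.
  have h1 : `|f x - f x'| < e / 2.
    by apply: rP; rewrite /ball/=; apply: lt_trans bx _; rewrite ltr_pdivrMr// mulr2n; lra.
  have h2 : `|f x - f y| < e / 2.
    apply: rP; rewrite /ball/=.
    by have := ler_distD x' x y; lra.
  have := ler_distD (f x) (f x') (f y); rewrite (distrC (f x') (f x)); lra.
move=> H; have [r [r0 rP]] : exists r, 0 < r /\ K `<=` (fun x => forall y, `|x - y| < r -> `|f x - f y| < e).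
  have : \forall r \near (0 : R)^'+, 0 < r /\ K `<=` (fun x => forall y, `|x - y| < r -> `|f x - f y| < e).
    by near=> r; split; near: r => //; exact: nbhs_right_gt.
  by move=> /filter_ex.
by exists r => // x y Kx; exact: rP.
Unshelve. all: by end_near.
Qed.

(** On [[-A, A]] one has [h x = f (sin (x / A))] with [f v = h (A * asin v)]. A Bernstein polynomial
    of [f] in the variable [(1 + sin (x / A)) / 2] is a trigonometric polynomial, and as an average
    of values of [h] it keeps the bound [M] on the whole line. *)
Lemma trig_approx h M A e : continuous h -> (forall x, `|h x| <= M) -> 0 < A -> 0 < e ->
  exists q, [/\ trig_poly q, forall x, `|q x| <= M & forall x, `|x| <= A -> `|h x - q x| <= e].
Proof.
move=> ch hM A0 e0.
have M0 : 0 <= M by apply: le_trans (hM 0).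
pose f v := h (A * asin v).
have pi2 : 1 <= pi / 2 :> R by have := pi_ge2 R; lra.
have in1 x : `|x| <= 1 -> x \in `[- (pi / 2), pi / 2] by rewrite ler_norml in_itv/= => ?; lra.
(* For [|x| <= A] the value [sin (x / A)] stays within [sin 1] of 0, hence inside the open interval
   where [asin] is continuous. *)
have s1 : sin 1 < 1 :> R.
  have cp : 0 < cos 1 :> R by apply: cos1_gt0.
  have := cos2Dsin2 (1 : R); have := sin_le1 (1 : R).
  rewrite le_eqVlt => /orP[/eqP -> |//]; nra.
have K1 x : `|x| <= 1 -> `|sin x| <= sin 1.
  move=> x1; have i1 : (1 : R) \in `[- (pi / 2), pi / 2] by apply: in1; rewrite normr1.
  have iN1 : (-1 : R) \in `[- (pi / 2), pi / 2] by apply: in1; rewrite normrN1.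
  move: (x1); rewrite ler_norml => /andP[l u].
  have ler_sin a b : a \in `[- (pi / 2), pi / 2] -> b \in `[- (pi / 2), pi / 2] ->
      a <= b -> sin a <= sin b :> R.
    move=> ia ib; rewrite le_eqVlt => /orP[/eqP -> //|ab]; apply: ltW; by rewrite ltr_sin.
  by rewrite ler_norml -sinN !ler_sin// ?in1.
have cf x : `[- sin 1, sin 1]%classic x -> {for x, continuous f}.
  rewrite /= in_itv/= => /andP[l u].
  have ca : {for x, continuous asin} by apply: continuous_asin; apply/andP; split; lra.
  apply: (@continuous_comp _ _ _ (fun v => A * asin v) h); last exact: ch.
  by apply: cvgM; [exact: cvg_cst|exact: ca].
have e2 : 0 < e / 2 by rewrite divr_gt0.
have [r r0 rP] := compact_modulus (@segment_compact _ _ _) cf e2.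
(* Chebyshev constant: where [|v - w| >= r], the trivial bound [2 * M] is at most
   [K * (v - w) ^+ 2], whose binomial mean is of order [1 / N]. *)
pose K := 2 * M / r ^+ 2.
have K0 : 0 <= K by apply: divr_ge0; [exact: mulr_ge0|exact: sqr_ge0].
have [N NK] : exists N : nat, K / N.+1%:R <= e / 2.
  exists (Num.truncn (K / (e / 2))); rewrite ler_pdivrMr ?ltr0n// mulrC -ler_pdivrMr//.
  by apply: ltW; apply: truncnS_gt.
pose w (k : nat) : R := 2 * k%:R / N.+1%:R - 1.
pose q x := bern N.+1 (fun k => f (w k)) ((1 + sin (A^-1 * x)) / 2).
have y01 x : 0 <= (1 + sin (A^-1 * x)) / 2 <= 1.
  by have := sin_le1 (A^-1 * x); have := sin_geN1 (A^-1 * x); lra.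
exists q; split.
- apply: bern_trig.
  apply: (@eq_trig (fun x => 2^-1 + 2^-1 * sin (A^-1 * x))); first by move=> x; field.
  by apply: trigD; [exact: trig_cst|apply: trigM; [exact: trig_cst|exact: trig_sin]].
- move=> x; rewrite ler_norml; set y := (1 + sin (A^-1 * x)) / 2.
  have fM k : - M <= f (w k) <= M by rewrite -ler_norml; exact: hM.
  apply/andP; split.
    by rewrite -(bern_cst N.+1 (- M) y); apply: bern_le (y01 x) _ => k _; case/andP: (fM k).
  by rewrite -[leRHS](bern_cst N.+1 M y); apply: bern_le (y01 x) _ => k _; case/andP: (fM k).
- move=> x xA; set v := sin (A^-1 * x).
  have x1 : `|A^-1 * x| <= 1 by rewrite normrM gtr0_norm ?invr_gt0// mulrC ler_pdivrMr// mul1r.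
  have hv : h x = f v by rewrite /f /v sinK ?in1// mulVKf// gt_eqF.
  have Kv : `[- sin 1, sin 1]%classic v by rewrite /= in_itv/= -ler_norml K1.
  have fw k : `|f v - f (w k)| <= e / 2 + K * (v - w k) ^+ 2.
    have [d|d] := ltP `|v - w k| r.
      by apply: le_trans (ltW (rP _ _ Kv d)) _; rewrite lerDl mulr_ge0// sqr_ge0.
    apply: (@le_trans _ _ (2 * M)).
      apply: le_trans (ler_normB _ _) _; rewrite mulr_natl mulr2n; apply: lerD; exact: hM.
    apply: ler_wpDl; first exact: ltW.
    rewrite /K mulrAC ler_pdivlMr ?exprn_gt0// ler_wpM2l ?mulr_ge0//.
    by rewrite -[X in _ <= X]real_normK ?num_real//; apply: lerXn2r; rewrite ?nnegrE// ltW.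
  have vE k : (v - w k) ^+ 2 = (4 / N.+1%:R ^+ 2) * (k%:R - N.+1%:R * ((1 + v) / 2) + 0) ^+ 2.
    by rewrite /w; field; rewrite gt_eqF// ltr0n.
  have bE : bern N.+1 (fun k => (e / 2 + K * (v - w k) ^+ 2)) ((1 + v) / 2) <= e.
    rewrite bernD bern_cst bernZ.
    have -> : (fun k => (v - w k) ^+ 2) =
      (fun k : nat => (4 / N.+1%:R ^+ 2) * (k%:R - N.+1%:R * ((1 + v) / 2) + 0) ^+ 2) by apply/funext.
    rewrite bernZ bern_variance.
    have -> : 4 / N.+1%:R ^+ 2 * (N.+1%:R * ((1 + v) / 2) * (1 - (1 + v) / 2) + 0 ^+ 2) =
        (1 - v ^+ 2) / N.+1%:R.
      by field; rewrite gt_eqF// ltr0n.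
    have : K * ((1 - v ^+ 2) / N.+1%:R) <= K / N.+1%:R.
      by rewrite ler_wpM2l// ler_pdivrMr ?ltr0n// mulVf ?gt_eqF ?ltr0n// gerBl sqr_ge0.
    by move=> hK; apply: le_trans (lerD (lexx _) (le_trans hK NK)) _; rewrite -splitr.
  have qv : q x = bern N.+1 (fun k => f (w k)) ((1 + v) / 2) by [].
  have lo : f v <= q x + e.
    rewrite -(bern_cst N.+1 (f v) ((1 + v) / 2)) qv; apply: le_trans (lerD (lexx _) bE).
    rewrite -bernD; apply: bern_le (y01 x) _ => k _.
    by have := fw k; rewrite ler_norml => /andP[_]; rewrite lerBlDl.
  have up : q x <= f v + e.
    rewrite -{1}(bern_cst N.+1 (f v) ((1 + v) / 2)) qv; apply: le_trans (lerD (lexx _) bE).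
    rewrite -bernD; apply: bern_le (y01 x) _ => k _.
    by have := fw k; rewrite ler_norml => /andP[]; lra.
  rewrite hv ler_norml; lra.
Qed.

End TrigApproximation.

Section Portmanteau.
Variable R : realType.

Lemma integrable_gauss_bounded (h : R -> R) : continuous h -> (exists M, forall x, `|h x| <= M) ->
  lebesgue_measure.-integrable setT (EFin \o (fun z => h z * gauss z)).
Proof.
move=> ch [M hM]; apply: integrable_mul_gauss; first exact: continuous_measurable_fun.
exists M => z; apply: le_trans (hM z) _; rewrite ler_peMr//; last by rewrite lerDl.
by apply: le_trans (hM z).
Qed.

Variables (d : measure_display) (T : measurableType d) (P : probability T R).
Variables (S : nat -> T -> R) (C tau : R).
Hypothesis bS : forall n, bmeas (S n).
Hypothesis SC : \forall n \near \oo, Ex P (fun w => `|S n w|) <= C.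
Hypothesis S_cos : forall a t, Ex P (fun w => cos (a + t * S n w)) @[n --> \oo] -->
  cos a * expR (- ((t * tau) ^+ 2 / 2)).

Lemma integrable_gauss_trig q : trig_poly q ->
  lebesgue_measure.-integrable setT (EFin \o (fun z => q (tau * z) * gauss z)).
Proof.
move=> tq; apply: (@integrable_gauss_bounded (fun z => q (tau * z))).
  move=> z; apply: (@continuous_comp _ _ _ (fun z => tau * z) q); last exact: continuous_trig.
  by apply: cvgM; [exact: cvg_cst|exact: cvg_id].
by have [M qM] := trig_bounded tq; exists M.
Qed.

Lemma bmeas_bounded_comp (h : R -> R) n : continuous h -> (exists M, forall x, `|h x| <= M) ->
  bmeas (fun w => h (S n w)).
Proof.
move=> ch [M hM]; split; last by exists M.
apply: (@measurableT_comp _ _ _ _ _ _ h); first exact: continuous_measurable_fun.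
by case: (bS n).
Qed.

Lemma cvg_trig q : trig_poly q -> Ex P (fun w => q (S n w)) @[n --> \oo] -->
  Rintegral lebesgue_measure setT (fun z => q (tau * z) * gauss z).
Proof.
move: q; apply: trig_ind => [c a t|q q' tq tq' cq cq'].
  have -> : Rintegral lebesgue_measure setT (fun z => c * cos (a + t * (tau * z)) * gauss z) =
      c * (cos a * expR (- ((t * tau) ^+ 2 / 2))).
    rewrite -gauss_cosE /gauss_cos -RintegralZl//.
      by apply: eq_Rintegral => z _; rewrite !mulrA.
    apply: (@integrable_gauss_bounded (fun z => cos (a + t * tau * z))).
      by move=> z; have := @continuous_cos_affine _ 1 a (t * tau) z; under eq_fun do rewrite mul1r.
    by exists 1 => z; exact: cos_max.
  rewrite (_ : (fun n => _) = (fun n => c * Ex P (fun w => cos (a + t * S n w)))).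
    by apply: cvgM; [exact: cvg_cst|exact: S_cos].
  apply/funext => n; rewrite ExZ//; apply: bmeas_cos.
  by apply: measurable_funD => //; apply: measurable_funM => //; case: (bS n).
have b q0 n : trig_poly q0 -> bmeas (fun w => q0 (S n w)).
  by move=> t0; apply: bmeas_bounded_comp; [exact: continuous_trig|exact: trig_bounded].
rewrite (_ : (fun n => _) = (fun n => Ex P (fun w => q (S n w)) + Ex P (fun w => q' (S n w)))); last first.
  by apply/funext => n; rewrite ExD//; exact: b.
rewrite (_ : Rintegral _ _ _ = Rintegral lebesgue_measure setT (fun z => q (tau * z) * gauss z) +
  Rintegral lebesgue_measure setT (fun z => q' (tau * z) * gauss z)).
  exact: cvgD.
rewrite -RintegralD//; try exact: integrable_gauss_trig.
by apply: eq_Rintegral => z _; rewrite mulrDl.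
Qed.

(** Tightness is used through first moments: with [q] close to [h] on [[-A, A]] and both bounded by
    [M], the linear bound [|h x - q x| <= e / 8 + (2 * M / A) * |x|] holds everywhere and is
    integrated on both sides. *)
Lemma cvg_bounded_continuous (h : R -> R) : continuous h -> (exists M, forall x : R, `|h x| <= M) ->
  Ex P (fun w => h (S n w)) @[n --> \oo] -->
  Rintegral lebesgue_measure setT (fun z => h (tau * z) * gauss z).
Proof.
move=> ch [M hM]; apply/cvgrPdist_le => e e0.
have M0 : 0 <= M by apply: le_trans (hM 0).
have imz : lebesgue_measure.-integrable setT (EFin \o (fun z : R => `|z| * gauss z)).
  apply: integrable_mul_gauss; first by apply: continuous_measurable_fun; exact: norm_continuous.
  by exists 1 => z; rewrite normr_id mul1r lerDr.
pose m1 := Rintegral lebesgue_measure setT (fun z : R => `|z| * gauss z).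
have m10 : 0 <= m1.
  by apply: Rintegral_ge0 => z _; rewrite mulr_ge0 ?gauss_ge0.
pose c := 2 * M * (`|C| + `|tau| * m1).
have c0 : 0 <= c by rewrite !mulr_ge0// addr_ge0// mulr_ge0.
(* [A] is such that the two linear terms, for [S n] and for the Gaussian, sum to at most [e / 4];
   with two errors [e / 8] and the [e / 4] of [cvg_trig] the total stays below [e]. *)
pose A := c / (e / 4) + 1.
have A0 : 0 < A by rewrite ltr_wpDl// divr_ge0// ltW// divr_gt0.
have cA : c / A <= e / 4.
  by rewrite ler_pdivrMr// mulrC -ler_pdivrMr ?divr_gt0// /A lerDl.
have e8 : 0 < e / 8 by rewrite divr_gt0.
have [q [tq qM hq]] := trig_approx ch hM A0 e8.
have hqx x : `|h x - q x| <= e / 8 + (2 * M / A) * `|x|.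
  have [xA|Ax] := leP `|x| A.
    by apply: le_trans (hq x xA) _; rewrite lerDl mulr_ge0// divr_ge0 ?mulr_ge0// ltW.
  apply: ler_wpDl; first exact: ltW.
  apply: (@le_trans _ _ (2 * M)).
    by apply: le_trans (ler_normB _ _) _; rewrite mulr_natl mulr2n; exact: lerD.
  by rewrite mulrAC ler_pdivlMr// ler_wpM2l ?mulr_ge0// ltW.
have e4 : 0 < e / 4 by rewrite divr_gt0.
have /cvgrPdist_le/(_ _ e4) cq := cvg_trig tq.
have bh n : bmeas (fun w => h (S n w)) by apply: bmeas_bounded_comp => //; exists M.
have bq n : bmeas (fun w => q (S n w)) by apply: bmeas_bounded_comp; [exact: continuous_trig|exists M].
have tailG : `|Rintegral lebesgue_measure setT (fun z => h (tau * z) * gauss z) -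
   Rintegral lebesgue_measure setT (fun z => q (tau * z) * gauss z)| <= e / 8 + (2 * M / A) * (`|tau| * m1).
  have ih : lebesgue_measure.-integrable setT (EFin \o (fun z => h (tau * z) * gauss z)).
    apply: (@integrable_gauss_bounded (fun z => h (tau * z))); last by exists M.
    move=> z; apply: (@continuous_comp _ _ _ (fun z => tau * z) h); last exact: ch.
    by apply: cvgM; [exact: cvg_cst|exact: cvg_id].
  have iq := integrable_gauss_trig tq.
  rewrite -RintegralB//.
  have iB : lebesgue_measure.-integrable setT
      (EFin \o (fun z : R => h (tau * z) * gauss z - q (tau * z) * gauss z)).
    rewrite [X in _.-integrable _ X](_ : _ = (fun z =>
      (h (tau * z) * gauss z)%:E - (q (tau * z) * gauss z)%:E)%E)//.
    by apply: integrableB.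
  apply: le_trans (le_normr_Rintegral _ iB) _ => //.
  have i1 : lebesgue_measure.-integrable setT (EFin \o (fun z : R => e / 8 * gauss z)).
    rewrite [X in _.-integrable _ X](_ : _ = (fun z : R => (e / 8)%:E * (gauss z)%:E)%E)//.
    by apply: integrableZl => //; exact: integrable_gauss.
  have i2 : lebesgue_measure.-integrable setT
      (EFin \o (fun z : R => (2 * M / A * `|tau|) * (`|z| * gauss z))).
    rewrite [X in _.-integrable _ X](_ : _ = (fun z : R =>
      (2 * M / A * `|tau|)%:E * (`|z| * gauss z)%:E)%E)//.
    by apply: integrableZl.
  have -> : e / 8 + (2 * M / A) * (`|tau| * m1) = Rintegral lebesgue_measure setT
      (fun z : R => e / 8 * gauss z + (2 * M / A * `|tau|) * (`|z| * gauss z)).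
    rewrite RintegralD// RintegralZl//; last exact: integrable_gauss.
    by rewrite RintegralZl// integral_gauss mulr1 mulrA.
  apply: le_Rintegral => //.
  - exact: (integrable_abse iB).
  - rewrite [X in _.-integrable _ X](_ : _ = (fun z : R => (e / 8 * gauss z)%:E +
      ((2 * M / A * `|tau|) * (`|z| * gauss z))%:E)%E)//.
    by apply: integrableD.
  - move=> z _; rewrite -mulrBl normrM (ger0_norm (gauss_ge0 z)).
    apply: le_trans (ler_wpM2r (gauss_ge0 z) (hqx _)) _.
    by rewrite normrM mulrDl !mulrA.
near=> n.
have tailS : `|Ex P (fun w => h (S n w)) - Ex P (fun w => q (S n w))| <= e / 8 + (2 * M / A) * `|C|.
  rewrite -ExB//; apply: le_trans (Ex_norm_le _ (bmeasB (bh n) (bq n))) _.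
  have bS' := bmeas_norm (bS n).
  have bc (x : R) : bmeas (fun _ : T => x) := bmeas_cst _ x.
  apply: (@le_trans _ _ (Ex P (fun w => e / 8 + (2 * M / A) * `|S n w|))).
    apply: Ex_le => //; first by apply: bmeas_norm; exact: bmeasB.
    by apply: bmeasD => //; exact: bmeasM.
  rewrite ExD//; last exact: bmeasM.
  rewrite Ex_cst ExZ// lerD2l ler_wpM2l ?divr_ge0 ?mulr_ge0 ?(ltW A0)//.
  by apply: le_trans (ler_norm C); near: n.
have mid : `|Rintegral lebesgue_measure setT (fun z => q (tau * z) * gauss z) -
    Ex P (fun w => q (S n w))| <= e / 4.
  by near: n.
have cA' : 2 * M / A * `|C| + 2 * M / A * (`|tau| * m1) <= e / 4.
  by apply: le_trans cA; rewrite -mulrDr /c mulrAC.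
move: tailG tailS mid cA'; set a1 := Rintegral _ _ _; set a2 := Rintegral _ _ _.
set b1 := Ex _ _; set b2 := Ex _ _ => h1 h2 h3 h4.
have := ler_distD a2 a1 b1; have := ler_distD b2 a2 b1; rewrite (distrC b2 b1); lra.
Unshelve. all: by end_near.
Qed.

End Portmanteau.
(** * Taylor expansion on the cube *)

Section CubeCalculus.
Variables (R : realType) (d : nat).
Local Notation V := 'rV[R]_d.
Implicit Types (f : V -> R) (u v w : V).

Definition cube : set V := [set v : V | forall m, 0 <= v 0 m <= 1].

Lemma cube_compact : compact cube.
Proof.
have := @rV_compact R d (fun=> `[0, 1]%classic) (fun=> @segment_compact _ _ _).
congr compact; apply/seteqP; split => v /= vc m; by have := vc m; rewrite /= in_itv.
Qed.

Lemma compact_norm_bounded (X : topologicalType) (K : set X) (f : X -> R) : compact K ->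
  (forall x, K x -> {for x, continuous f}) -> exists2 M, 0 <= M & forall x, K x -> `|f x| <= M.
Proof.
move=> cK cf.
have : \forall M \near +oo, K `<=` (fun x => `|f x| <= M).
  have /compact_near_coveringP nc := cK; apply: nc => x Kx.
  have /cvgrPdist_lt/(_ _ ltr01) := cf x Kx => fx.
  near=> y M; rewrite /=.
  have h1 : `|f x - f y| < 1 by near: y.
  have h2 : `|f x| + 1 <= M by near: M; exact: nbhs_pinfty_ge.
  have := lerB_dist (f y) (f x); rewrite distrC; lra.
move=> H; have [M [M0 MP]] : exists M, 0 <= M /\ K `<=` (fun x => `|f x| <= M).
  have : \forall M \near +oo, 0 <= M /\ K `<=` (fun x => `|f x| <= M).
    by near=> M; split; near: M => //; exact: nbhs_pinfty_ge.
  by move=> /filter_ex.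
by exists M.
Unshelve. all: by end_near.
Qed.

(** The parameter runs over [[0, 1]] and is multiplied by [s], so the increment may have either sign
    or vanish. *)
Lemma mvt_line f u (e : V) s :
  (forall t, 0 <= t <= 1 -> derivable f ((t * s) *: e + u) e) ->
  exists2 t, 0 <= t <= 1 & f (s *: e + u) - f u = 'D_e f ((t * s) *: e + u) * s.
Proof.
move=> df.
have shift (c : R) : (fun h : R => h^-1 *: ((fun t : R => f (t *: e + u)) (h *: 1 + c) - f (c *: e + u))) =
    (fun h : R => h^-1 *: (f (h *: e + (c *: e + u)) - f (c *: e + u))).
  apply/funext => h; congr (_ *: (f _ - _)).
  by rewrite addrA -scalerDl; congr (_ *: _ + _); rewrite /GRing.scale/= mulr1.
have dl (c : R) : derivable f (c *: e + u) e ->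
    is_derive c 1 (fun t : R => f (t *: e + u)) ('D_e f (c *: e + u)).
  move=> dc; apply: DeriveDef; first by rewrite /derivable shift.
  by rewrite /derive shift.
have dp (t : R) : 0 <= t <= 1 ->
    is_derive t 1 (fun t : R => f ((t * s) *: e + u)) ('D_e f ((t * s) *: e + u) * s).
  move=> t01; have di := dl _ (df t t01).
  have dm : is_derive t 1 (fun t => t * s) s.
    by apply: is_derive_eq; rewrite /GRing.scale/= mulr0 add0r mulr1.
  exact: (@is_derive1_comp R (fun c : R => f (c *: e + u)) (fun t => t * s) t _ _ di dm).
have d1 (t : R) : t \in `]0, 1[ ->
    is_derive t 1 (fun t : R => f ((t * s) *: e + u)) ('D_e f ((t * s) *: e + u) * s).
  by rewrite in_itv/= => /andP[/ltW t0 /ltW t1]; apply: dp; rewrite t0.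
have c1 : {within `[0, 1]%classic, continuous (fun t : R => f ((t * s) *: e + u))}.
  apply: derivable_within_continuous => t; rewrite in_itv/= => t01.
  by case: (dp t t01).
have [t] := MVT_segment ler01 d1 c1.
rewrite in_itv/= => t01; rewrite mul1r mul0r scale0r add0r subr0 mulr1 => tE.
by exists t.
Qed.

(** Coordinates are changed from [w] to [v] one at a time, with the mean value theorem along each
    axis. Thus partial derivatives suffice, and the intermediate points stay in the cube because it
    is a product of intervals. *)
Lemma partial_telescope f v w : (forall i v', cube v' -> derivable f v' (delta_mx 0 i)) ->
  cube v -> cube w -> exists xi : 'I_d -> V,
  [/\ forall j, cube (xi j), forall j i, `|xi j 0 i - w 0 i| <= `|v 0 i - w 0 i| &
      f v - f w = \sum_j pderiv f j (xi j) * (v 0 j - w 0 j)].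
Proof.
move=> df cv cw.
pose mixv (j : nat) : V := \row_i (if (i < j)%N then v 0 i else w 0 i).
have mixS (j : 'I_d) : mixv j.+1 = (v 0 j - w 0 j) *: delta_mx 0 j + mixv j.
  apply/rowP => i; rewrite !mxE eqxx/= ltnS leq_eqVlt.
  by case: (eqVneq i j) => [->|ij] /=; rewrite ?eqxx ?ltnn ?mulr1 ?subrK// val_eqE (negbTE ij)/= mulr0 add0r.
pose pt (j : 'I_d) (t : R) : V := (t * (v 0 j - w 0 j)) *: delta_mx 0 j + mixv j.
have ptE (j : 'I_d) t i : pt j t 0 i = if i == j then w 0 j + t * (v 0 j - w 0 j) else mixv j 0 i.
  rewrite !mxE eqxx/=; case: (eqVneq i j) => [->|ij] /=; rewrite ?ltnn ?mulr1 1?addrC//.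
  by rewrite mulr0 addr0.
have cpt j t : 0 <= t <= 1 -> cube (pt j t).
  move=> t01 i; rewrite ptE; case: eqP => _; last by rewrite mxE; case: ifP => _; [exact: cv|exact: cw].
  by have := cv j; have := cw j; nra.
have dpt j t i : 0 <= t <= 1 -> `|pt j t 0 i - w 0 i| <= `|v 0 i - w 0 i|.
  move=> /andP[t0 t1]; rewrite ptE; case: eqP => [->|_].
    by rewrite addrC addKr normrM ger0_norm// ler_piMl.
  by rewrite mxE; case: ifP => // _; rewrite subrr normr0.
have ex (j : 'I_d) : exists x : V, [/\ cube x, forall i, `|x 0 i - w 0 i| <= `|v 0 i - w 0 i| &
    f (mixv j.+1) - f (mixv j) = pderiv f j x * (v 0 j - w 0 j)].
  have [t t01 tE] := mvt_line (fun t t01 => df j _ (cpt j t t01)).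
  exists (pt j t); split; [exact: cpt|by move=> i; exact: dpt|].
  by rewrite mixS tE.
have [xi xiP] := fin_all_exists ex.
exists xi; split => [j|j i|]; [by case: (xiP j)|by case: (xiP j)|].
have -> : v = mixv d by apply/rowP => i; rewrite mxE ltn_ord.
have -> : f w = f (mixv 0) by congr f; apply/rowP => i; rewrite mxE.
rewrite -(telescope_sumr (fun j => f (mixv j)))// big_mkord.
by apply: eq_bigr => j _; case: (xiP j) => _ _ ->; rewrite /mixv !mxE ltn_ord.
Qed.

Lemma cube_lipschitz f B v w : (forall i v', cube v' -> derivable f v' (delta_mx 0 i)) ->
  (forall i v', cube v' -> `|pderiv f i v'| <= B) -> cube v -> cube w ->
  `|f v - f w| <= B * \sum_i `|v 0 i - w 0 i|.
Proof.
move=> df fB cv cw; have [xi [cxi _ ->]] := partial_telescope df cv cw.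
apply: le_trans (ler_norm_sum _ _ _) _; rewrite mulr_sumr; apply: ler_sum => j _.
by rewrite normrM ler_wpM2r// fB.
Qed.

(** Lagrange's identity: the difference of the two sides is half the sum of the squares
    [(a i - a j) ^+ 2]. *)
Lemma cauchy_schwarz_sum (n : nat) (a : 'I_n -> R) : (\sum_i a i) ^+ 2 <= n%:R * \sum_i a i ^+ 2.
Proof.
have : 0 <= \sum_i \sum_j (a i - a j) ^+ 2 by do 2 (apply: sumr_ge0 => ? _); exact: sqr_ge0.
have -> : \sum_i \sum_j (a i - a j) ^+ 2 = 2 * (n%:R * \sum_i a i ^+ 2 - (\sum_i a i) ^+ 2).
  transitivity (\sum_(i < n) (n%:R * a i ^+ 2 + \sum_j a j ^+ 2 - 2 * (a i * \sum_j a j))).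
    apply: eq_bigr => i _.
    transitivity (\sum_(j < n) (a i ^+ 2 + a j ^+ 2 - 2 * (a i * a j))).
      by apply: eq_bigr => j _; ring.
    rewrite sumrB big_split/= sumr_const card_ord -mulr_natl -!mulr_sumr; ring.
  rewrite sumrB big_split/= -mulr_sumr sumr_const card_ord -mulr_natl -mulr_sumr -mulr_suml; ring.
by rewrite pmulr_rge0// subr_ge0.
Qed.

(** The telescoping formula gives first derivatives at points [xi j] no farther from [w] than [v]
    is, coordinatewise; the Lipschitz bound on these derivatives then compares them with their
    values at [w]. The factor [d] comes from Cauchy-Schwarz. *)
Lemma C2_taylor (g : V -> R) : C2_cube g -> exists2 K, 0 <= K & forall v w : V,
  (forall m, 0 <= v 0 m <= 1) -> (forall m, 0 <= w 0 m <= 1) ->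
  `|g v - g w - \sum_m pderiv g m w * (v 0 m - w 0 m)| <= K * \sum_m (v 0 m - w 0 m) ^+ 2.
Proof.
move=> [U [_ [cubeU [_ [dg [_ [ddg cddg]]]]]]].
have bound ij : exists2 M, 0 <= M & forall v, cube v -> `|pderiv (pderiv g ij.1) ij.2 v| <= M.
  by apply: compact_norm_bounded cube_compact _ => v /cubeU Uv; exact: cddg.
have [M M0 MP] := fin_all_exists2 bound.
pose B : R := \sum_ij M ij.
have B0 : 0 <= B by apply: sumr_ge0.
have gB i j v : cube v -> `|pderiv (pderiv g i) j v| <= B.
  move=> cv; apply: (le_trans (MP (i, j) v cv)).
  by rewrite /B (bigD1 (i, j))//= lerDl sumr_ge0.
exists (B * d%:R); first exact: mulr_ge0.
move=> v w cv cw.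
have [xi [cxi xiw ->]] := partial_telescope (fun i v' cv' => dg i v' (cubeU _ cv')) cv cw.
rewrite -sumrB; apply: le_trans (ler_norm_sum _ _ _) _.
set s := \sum_i `|v 0 i - w 0 i|.
apply: (@le_trans _ _ (\sum_j (B * s) * `|v 0 j - w 0 j|)).
  apply: ler_sum => j _; rewrite -mulrBl normrM ler_wpM2r//.
  apply: le_trans (cube_lipschitz (fun i v' cv' => ddg j i v' (cubeU _ cv'))
    (fun i v' => @gB j i v') (cxi j) cw) _.
  by rewrite ler_wpM2l//; apply: ler_sum.
rewrite -mulr_sumr -/s -mulrA -expr2 -mulrA ler_wpM2l//.
apply: le_trans (cauchy_schwarz_sum _) _.
by rewrite ler_wpM2l//; apply: ler_sum => i _; rewrite real_normK// num_real.
Qed.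

Lemma bmeas_continuous_cube dS (S : measurableType dS) (f : S -> V) (G : V -> R) :
  (forall m, measurable_fun setT (fun x => f x 0 m)) -> (forall x, cube (f x)) ->
  (forall v, cube v -> {for v, continuous G}) -> bmeas (fun x => G (f x)).
Proof.
move=> mf cf cG; split; last first.
  by have [M _ MP] := compact_norm_bounded cube_compact cG; exists M => x; exact: MP.
(* [f] is rounded down to the grid of step [1 / N.+1], so that only finitely many values remain. *)
pose cell (N : nat) (x : S) (m : 'I_d) : 'I_N.+2 := inord (Num.truncn (N.+1%:R * f x 0 m)).
pose grid (N : nat) (c : {ffun 'I_d -> 'I_N.+2}) : V := \row_m ((c m)%:R / N.+1%:R).
pose rd (N : nat) (x : S) : V := grid N [ffun m => cell N x m].
(* The truncation reaches [N.+1] when the coordinate equals 1, hence [N.+2] cells. *)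
have tr N x m : (Num.truncn (N.+1%:R * f x 0%R m) < N.+2)%N.
  have /andP[f0 f1] := cf x m.
  rewrite ltnS -ltnS truncn_lt_nat ?mulr_ge0//.
  by apply: le_lt_trans (ler_piMr _ f1) _; rewrite ?ltr_nat.
have cellE N x m (c : 'I_N.+2) : (cell N x m == c) =
      (c%:R <= N.+1%:R * f x 0 m) && (N.+1%:R * f x 0 m < c.+1%:R).
  have /andP[f0 _] := cf x m.
  by rewrite -val_eqE /cell/= inordK// truncn_eq// mulr_ge0.
apply: (@measurable_fun_cvg _ _ _ _ (fun N x => G (rd N x))).
  move=> N.
  suff : bmeas (fun x => G (rd N x)) by case.
  apply: (@eq_bmeas _ _ _ (fun x => \sum_c G (grid N c) * \prod_m (cell N x m == c m)%:R)).
    move=> x; rewrite (bigD1 [ffun m => cell N x m])//= [X in _ + X]big1 ?addr0.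
      by rewrite big1 ?mulr1// => m _; rewrite ffunE eqxx.
    move=> c cx; have [m cm|e] := pickP (fun m => cell N x m != c m).
      by rewrite (bigD1 m)//= (negbTE cm) mul0r mulr0.
    case/eqP: cx; apply/ffunP => m; rewrite ffunE; apply/eqP.
    by move/(_ m): e => /negbT/negPn; rewrite eq_sym.
  apply: bmeas_sum => c _; apply: bmeasM; first exact: bmeas_cst.
  apply: bmeas_prod => m _; split; last first.
    by exists 1 => x; case: (_ == _); rewrite ?normr1 ?normr0.
  rewrite (_ : (fun x => _) = (fun x =>
      if ((c m)%:R <= N.+1%:R * f x 0 m) && (N.+1%:R * f x 0 m < (c m).+1%:R) then 1 else 0)); last first.
    by apply/funext => x; rewrite cellE; case: ifP.
  apply: measurable_fun_ifT => //.
  have mNf : measurable_fun setT (fun x => N.+1%:R * f x 0 m) by apply: measurable_funM.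
  by apply: measurable_and; [exact: measurable_fun_ler|exact: measurable_fun_ltr].
move=> x _; apply: (@cvg_comp _ _ _ (fun N => rd N x) G _ (nbhs (f x)) _ _ (cG _ (cf x))).
apply/cvg_ballP => e e0; near=> N.
rewrite /ball/=; split => // i m; rewrite ord1 /ball/= !mxE ffunE.
have /andP[f0 _] := cf x m.
have := @truncn_itv _ (N.+1%:R * f x 0 m); rewrite mulr_ge0// => /(_ isT) /andP[lo hi].
rewrite /cell inordK//.
have n0 : 0 < N.+1%:R :> R by rewrite ltr0n.
have Ne : N.+1%:R^-1 < e by near: N; exact: near_infty_natSinv_lt (PosNum e0).
rewrite ger0_norm; last by rewrite subr_ge0 ler_pdivrMr// (mulrC (f x 0 m)).
rewrite ltrBlDr; apply: (@lt_le_trans _ _ (N.+1%:R^-1 + (Num.truncn (N.+1%:R * f x 0 m))%:R / N.+1%:R)).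
  rewrite -[X in X + _]mul1r -mulrDl ltr_pdivlMr// addrC natr1 (mulrC (f x 0 m)); exact: hi.
by rewrite lerD2r ltW.
Unshelve. all: by end_near.
Qed.

End CubeCalculus.

(** * Integrals of functions known only off a null set *)

Section NullSets.
Context d (T : measurableType d) (R : realType) (mu : {measure set T -> \bar R}).
Implicit Types f g : T -> \bar R.
Local Open Scope ereal_scope.

Lemma ge0_le_integral_sup f g : (forall x, 0 <= f x) -> (forall x, f x <= g x) ->
  \int[mu]_x f x <= \int[mu]_x g x.
Proof.
move=> f0 fg; have g0 x : 0 <= g x by apply: le_trans (fg x).
rewrite !ge0_integralTE//; apply: le_ereal_sup => _ [h /= hf <-]; exists h => // x.
exact: le_trans (hf x) (fg x).
Qed.

Let measurable_mem (N : set T) : measurable N -> measurable_fun setT (fun x => x \in N).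
Proof.
move=> mN; apply: (measurable_fun_bool true); rewrite setTI.
by rewrite (_ : _ @^-1` _ = N)//; apply/seteqP; split => x /=; [move/set_mem|move/mem_set].
Qed.

(** [f] lies between two measurable functions, equal to [g] off [N] and to 0, respectively [+oo], on
    [N]; both have the integral of [g], and the integral is monotone even at a non-measurable
    [f]. *)
Lemma ge0_integral_eq_off_null (N : set T) f g : measurable N -> mu N = 0 -> measurable_fun setT g ->
  (forall x, 0 <= f x) -> (forall x, 0 <= g x) -> (forall x, ~ N x -> f x = g x) ->
  \int[mu]_x f x = \int[mu]_x g x.
Proof.
move=> mN N0 mg f0 g0 fg.
have mNC : measurable (~` N) by exact: measurableC.
have ae h : (forall x, ~ N x -> h x = g x) -> ae_eq mu setT h g.
  move=> hg; exists N; split => // x /= xN; apply: contrapT => nN; apply: xN => _; exact: hg.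
apply/eqP; rewrite eq_le; apply/andP; split.
  pose h x := if x \in N then +oo else g x.
  have mh : measurable_fun setT h.
    by apply: measurable_fun_ifT => //; exact: measurable_mem.
  have h0 x : 0 <= h x by rewrite /h; case: ifP.
  have hg x : ~ N x -> h x = g x by move=> nN; rewrite /h memNset.
  rewrite -(@ge0_ae_eq_integral _ _ _ mu setT h g)//; last exact: ae.
  apply: ge0_le_integral_sup => // x; rewrite /h; case: ifPn => [_|]; first exact: leey.
  by rewrite notin_setE => /fg ->.
pose h x := if x \in N then 0 else g x.
have mh : measurable_fun setT h.
  by apply: measurable_fun_ifT => //; exact: measurable_mem.
have h0 x : 0 <= h x by rewrite /h; case: ifP.
have hg x : ~ N x -> h x = g x by move=> nN; rewrite /h memNset.
rewrite -(@ge0_ae_eq_integral _ _ _ mu setT h g)//; last exact: ae.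
apply: ge0_le_integral_sup => // x; rewrite /h; case: ifPn => // /negP nN.
by rewrite fg// => ?; apply: nN; exact: mem_set.
Qed.

(* [f] may be non-measurable: the integral is a supremum over simple functions, hence monotone. *)
Lemma integral_eq_off_null (N : set T) f g : measurable N -> mu N = 0 -> measurable_fun setT g ->
  (forall x, ~ N x -> f x = g x) -> \int[mu]_x f x = \int[mu]_x g x.
Proof.
move=> mN N0 mg fg; rewrite integralE [RHS]integralE; congr (_ - _).
  apply: (ge0_integral_eq_off_null mN N0) => // [|x /fg e]; first exact: measurable_funepos.
  by rewrite !funeposE e.
apply: (ge0_integral_eq_off_null mN N0) => // [|x /fg e]; first exact: measurable_funeneg.
by rewrite !funenegE e.
Qed.

End NullSets.

Lemma cvg_inv_sqrt (R : realType) : (fun n : nat => (Num.sqrt n%:R)^-1 : R) @ \oo --> 0.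
Proof.
apply/cvgrPdist_lt => e e0; near=> n.
have ei : 0 < e^-1 by rewrite invr_gt0.
have h : e^-1 < Num.sqrt n%:R.
  rewrite -[ltLHS](gtr0_norm ei) -sqrtr_sqr ltr_sqrt.
    by near: n; exact: nbhs_infty_gtr.
  by apply: lt_trans (_ : e^-1 ^+ 2 < _); [exact: exprn_gt0|near: n; exact: nbhs_infty_gtr].
rewrite sub0r normrN ger0_norm ?invr_ge0 ?sqrtr_ge0//.
by rewrite invf_plt ?posrE//; apply: lt_trans h.
Unshelve. all: by end_near.
Qed.

Section CoordinateSums.
Variable R : realType.
Variable nu : probability (cspace R idx) R.
Hypothesis nuP : iid_unif nu.
Variables (h : R -> R) (s2 : R).
Hypothesis bh : bmeas h.
Hypothesis h0 : Rintegral lebesgue_measure `[0, 1]%classic h = 0.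
Hypothesis s2E : Rintegral lebesgue_measure `[0, 1]%classic (fun u => h u ^+ 2) = s2.
Local Notation csum n := (fun z : cspace R idx => \sum_(i < n) h (z (inl (i : nat)))).

Lemma Ex_sqr_csum n : Ex nu (fun z => csum n z ^+ 2) = n%:R * s2.
Proof.
have bS m := bmeas_coord_sum bh m.
have bc c : bmeas (fun _ : cspace R idx => c) := bmeas_cst _ c.
have bR c : bmeas (fun _ : R => c) := bmeas_cst _ c.
have b2 : bmeas (fun u => h u ^+ 2) by exact: bmeasX.
elim: n => [|n IH].
  rewrite mul0r (Ex_ext _ (g := fun=> 0)) ?Ex_cst// => z.
  by rewrite big_ord0 expr0n.
rewrite (Ex_resample_inner nuP (inl n)); last exact: bmeasX.
rewrite (Ex_ext _ (g := fun z => csum n z ^+ 2 + s2)).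
  by rewrite ExD// ?Ex_cst ?IH -?natr1 ?mulrDl ?mul1r//; exact: bmeasX.
move=> z; rewrite -s2E -!Ex_uniform01//; last first.
  apply: (@eq_bmeas _ _ _ (fun u => (csum n z + h u) ^+ 2)); last first.
    by apply: bmeasX; apply: bmeasD.
  by move=> u; rewrite coord_sum_upd.
rewrite (Ex_ext _ (g := fun u => csum n z ^+ 2 + (2 * csum n z) * h u + h u ^+ 2)).
  rewrite ExD//; last by apply: bmeasD => //; exact: bmeasM.
  rewrite ExD//; last exact: bmeasM.
  by rewrite Ex_cst ExZ// [X in _ * X]Ex_uniform01// h0 mulr0 addr0.
by move=> u; rewrite coord_sum_upd; ring.
Qed.

Lemma Ex_norm_csum n : Ex nu (fun z => `|csum n z|) <= Num.sqrt (n%:R * s2).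
Proof.
rewrite -[leLHS]ger0_norm; last by apply: Ex_ge0.
by rewrite -sqrtr_sqr ler_wsqrtr// -Ex_sqr_csum Ex_norm_sqr//; exact: bmeas_coord_sum.
Qed.

(** With [s = t / sqrt n] one has [n * s ^+ 2 = t ^+ 2], so the [n]-th power of the exponential is
    exactly the limit, while [n * charfun_err s] is of order [1 / sqrt n]. *)
Lemma cvg_cos_csum a t :
  Ex nu (fun z => cos (a + t * (Num.sqrt n%:R * (n%:R^-1 * csum n z)))) @[n --> \oo] -->
  cos a * expR (- ((t * Num.sqrt s2) ^+ 2 / 2)).
Proof.
have s20 : 0 <= s2 by rewrite -s2E -Ex_uniform01; [apply: Ex_ge0 => u; exact: sqr_ge0|exact: bmeasX].
have [_ [M hM]] := bh.
pose s (n : nat) : R := t / Num.sqrt n%:R.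
have rE (n : nat) : (Num.sqrt n%:R * n%:R^-1 : R) = (Num.sqrt n%:R)^-1.
  case: n => [|n]; first by rewrite invr0 mulr0 sqrtr0 invr0.
  have r0 : Num.sqrt n.+1%:R != 0 :> R by rewrite sqrtr_eq0 -ltNge ltr0n.
  by rewrite -{2}[n.+1%:R](@sqr_sqrtr R) ?ler0n// expr2 invfM mulrA divff// mul1r.
have s2n n : (0 < n)%N -> n%:R * s n ^+ 2 = t ^+ 2.
  move=> n0; rewrite /s expr_div_n sqr_sqrtr// mulrC divfK//.
  by rewrite pnatr_eq0 -lt0n.
pose b n : R := `|t| ^+ 3 * M ^+ 3 * (Num.sqrt n%:R)^-1 +
  2 * t ^+ 4 * M ^+ 4 * ((Num.sqrt n%:R)^-1 * (Num.sqrt n%:R)^-1).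
have cb : b @ \oo --> 0.
  have r0 := @cvg_inv_sqrt R.
  rewrite -[0 in X in _ --> X](addr0 0); apply: cvgD.
    by rewrite -[0 in X in _ --> X](mulr0 (`|t| ^+ 3 * M ^+ 3)); apply: cvgMr.
  rewrite -[0 in X in _ --> X](mulr0 (2 * t ^+ 4 * M ^+ 4)); apply: cvgMr.
  by rewrite -[0 in X in _ --> X](mulr0 0); exact: cvgM.
apply/cvgrPdist_le => e e0; near=> n.
have n0 : (0 < n)%N by near: n; exact: nbhs_infty_gt.
have n0R : n%:R != 0 :> R by rewrite pnatr_eq0 -lt0n.
have ber : b n <= e.
  apply: le_trans (ler_norm _) _; rewrite -normrN -sub0r.
  by near: n; move/cvgrPdist_le : cb; apply.
apply: le_trans ber.
rewrite distrC (Ex_ext _ (g := fun z => cos (a + s n * csum n z))); last first.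
  by move=> z; rewrite (mulrA (Num.sqrt _)) rE mulrA.
have eE : expR (- ((t * Num.sqrt s2) ^+ 2 / 2)) = expR (- (s n ^+ 2 * s2 / 2)) ^+ n.
  by rewrite -expRM_natl; congr expR; rewrite exprMn sqr_sqrtr// -(s2n n n0); field.
rewrite eE; apply: le_trans (Ex_cos_sum nuP bh hM h0 s2E a (s n) n) _.
rewrite /charfun_err /b.
have q4 : n%:R * s n ^+ 4 = t ^+ 4 * ((Num.sqrt n%:R)^-1 * (Num.sqrt n%:R)^-1).
  rewrite (exprD _ 2 2) mulrA s2n// /s expr_div_n -invfM -expr2 sqr_sqrtr// mulrA; congr (_ / _); ring.
have q3 : n%:R * `|s n| ^+ 3 = `|t| ^+ 3 * (Num.sqrt n%:R)^-1.
  rewrite (exprD _ 2 1) expr1 real_normK ?num_real// mulrA s2n// -[t ^+ 2]real_normK ?num_real//.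
  by rewrite /s normrM normfV (ger0_norm (sqrtr_ge0 _)) mulrA -exprSr.
rewrite (_ : _ * (_ + _) = (n%:R * `|s n| ^+ 3) * M ^+ 3 + 2 * (n%:R * s n ^+ 4) * M ^+ 4); last by ring.
by rewrite q3 q4 le_eqVlt; apply/orP; left; apply/eqP; ring.
Unshelve. all: by end_near.
Qed.

End CoordinateSums.

Lemma cos_lipschitz (R : realType) (x y : R) : `|cos x - cos y| <= `|x - y|.
Proof.
wlog xy : x y / x <= y.
  by move=> H; case: (leP x y) => [/H //|/ltW /H]; rewrite distrC (distrC y).
have cc : {within `[x, y]%classic, continuous (cos : R -> R)}.
  by apply: continuous_subspaceT; exact: continuous_cos.
have [c _ cE] := MVT_segment xy (fun z _ => is_derive_cos z) cc.
by rewrite distrC cE normrM (distrC x) ler_piMl// normrN sin_max.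
Qed.

(** * The central limit theorem *)

Section GammaCLT.
Variables (R : realType) (W : R -> R -> R) (d p : nat) (F : 'I_d -> rel 'I_p).
Variable l : seq 'I_p.
Hypothesis mW : measurable_fun setT (fun z : R * R => W z.1 z.2).
Hypothesis W01 : forall x y, 0 <= W x y <= 1.
Hypothesis Wsym : forall x y, W x y = W y x.
Variable nu : probability (cspace R idx) R.
Hypothesis nuP : iid_unif nu.
Hypotheses (p_gt0 : (0 < p)%N) (ul : uniq l) (compF : compatible F l).
Hypothesis simpleF : forall m, simple_graph (F m).
Variable g : 'rV[R]_d -> R.
Hypothesis C2g : C2_cube g.

Lemma bmeas_C2_theta : bmeas (fun x : cspace R nat => g (tilde_t_x F W l x)) /\
  forall m, bmeas (fun x : cspace R nat => pderiv g m (tilde_t_x F W l x)).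
Proof.
have [U [_ [cubeU [cg [_ [cdg _]]]]]] := C2g.
have mth m := (bmeas_theta F l mW W01 m).1.
have th01 x : cube (tilde_t_x F W l x) by move=> m; exact: (theta01 F l mW W01 nuP).
split=> [|m]; apply: (bmeas_continuous_cube mth th01) => v /cubeU Uv; [exact: cg|exact: cdg].
Qed.

(** The rescaled statistic [T] and its linear part [L] are close in [L^1]. Cosine being 1-Lipschitz,
    the limit for [L] passes to [T], and the bounded first moments of [T] give the tightness
    required by [cvg_bounded_continuous]. *)
Lemma Gamma_n_clt (h : R -> R) : continuous h -> (exists M, forall x : R, `|h x| <= M) ->
  Ex nu (fun z => h (Num.sqrt n%:R * (Gamma_n F l g (graph_of W (n := n) z) - Gamma_lim F W l g)))
    @[n --> \oo] -->
  Rintegral lebesgue_measure setT (fun z => h (Num.sqrt (sigma2 F W l g) * z) * gauss z).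
Proof.
have [bg bg'] := bmeas_C2_theta.
have [K K0 tay] := C2_taylor C2g.
have [C CP] := Gamma_n_linearization mW W01 Wsym nuP ul compF simpleF bg bg' K0 tay p_gt0.
have bv := bmeas_vertex_sum mW W01 nuP ul bg bg'.
have v0 := mean_vertex_sum mW W01 nuP ul bg bg'.
have s2E := esym (sigma2_vertex_sum mW W01 nuP ul bg bg').
set v := vertex_sum W F l g (pderiv g) in CP bv v0 s2E.
set s2 := sigma2 F W l g in s2E *.
pose T (n : nat) (z : cspace R idx) : R :=
  Num.sqrt n%:R * (Gamma_n F l g (graph_of W (n := n) z) - Gamma_lim F W l g).
pose L (n : nat) (z : cspace R idx) : R := Num.sqrt n%:R * (n%:R^-1 * \sum_(i < n) v (z (inl (i : nat)))).
have bc (c : R) : bmeas (fun _ : cspace R idx => c) := bmeas_cst _ c.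
have bT n : bmeas (T n).
  exact: (@bmeas_graph_of R W mW W01 n
    (fun G : rel 'I_n => Num.sqrt n%:R * (Gamma_n F l g G - Gamma_lim F W l g))).
have bL n : bmeas (L n).
  by apply: bmeasM => //; apply: bmeasM => //; exact: bmeas_coord_sum.
have bTL n : bmeas (fun z : cspace R idx => `|T n z - L n z|).
  by apply: bmeas_norm; exact: bmeasB.
(* For [n > 2 * p] one has [n - p >= n / 2], which accounts for the factor 2. *)
have close n : (2 * p < n)%N -> Ex nu (fun z => `|T n z - L n z|) <= 2 * `|C| * (Num.sqrt n%:R)^-1.
  move=> pn; have n0 : (0 : R) < n%:R by rewrite ltr0n; lia.
  have np0 : (0 : R) < (n - p)%:R by rewrite ltr0n; lia.
  pose E (z : cspace R idx) : R :=
    `|Gamma_n F l g (graph_of W (n := n) z) - Gamma_lim F W l g -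
      n%:R^-1 * \sum_(i < n) v (z (inl (i : nat)))|.
  have bE : bmeas E.
    apply: bmeas_norm; apply: bmeasB; last by apply: bmeasM => //; exact: bmeas_coord_sum.
    exact: (@bmeas_graph_of R W mW W01 n (fun G : rel 'I_n => Gamma_n F l g G - Gamma_lim F W l g)).
  rewrite (Ex_ext _ (g := fun z => Num.sqrt n%:R * E z)); last first.
    by move=> z; rewrite /T /L /E -mulrBr normrM (ger0_norm (sqrtr_ge0 _)).
  have pn' : (p < n)%N by lia.
  rewrite ExZ//; apply: le_trans (ler_wpM2l (sqrtr_ge0 _) (CP n pn')) _.
  apply: (@le_trans _ _ (Num.sqrt n%:R * (`|C| * (2 / n%:R)))).
    rewrite ler_wpM2l ?sqrtr_ge0//.
    apply: (@le_trans _ _ (`|C| / (n - p)%:R)).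
      by rewrite ler_wpM2r ?invr_ge0 ?(ltW np0)// ler_norm.
    rewrite ler_wpM2l// ler_pdivlMr// mulrC ler_pdivrMr//.
    by rewrite -natrM ler_nat; lia.
  have sE : (n%:R : R) = Num.sqrt n%:R * Num.sqrt n%:R by rewrite -expr2 sqr_sqrtr ?ltW.
  have s0 : Num.sqrt n%:R != 0 :> R by rewrite gt_eqF// sqrtr_gt0.
  by rewrite [X in 2 / X]sE le_eqVlt; apply/orP; left; apply/eqP; field.
have s20 : 0 <= s2 by rewrite -s2E -Ex_uniform01; [apply: Ex_ge0 => u; exact: sqr_ge0|exact: bmeasX].
have Lbound n : (0 < n)%N -> Ex nu (fun z => `|L n z|) <= Num.sqrt s2.
  move=> n0; have n0R : (0 : R) < n%:R by rewrite ltr0n.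
  have bcs : bmeas (fun z : cspace R idx => `|\sum_(i < n) v (z (inl (i : nat)))|).
    by apply: bmeas_norm; exact: bmeas_coord_sum.
  rewrite (Ex_ext _ (g := fun z : cspace R idx =>
      (Num.sqrt n%:R * n%:R^-1) * `|\sum_(i < n) v (z (inl (i : nat)))|)); last first.
    by move=> z; rewrite /L mulrA normrM ger0_norm// mulr_ge0 ?sqrtr_ge0 ?invr_ge0.
  rewrite ExZ//; apply: le_trans (ler_wpM2l _ (Ex_norm_csum nuP bv v0 s2E n)) _.
    by rewrite mulr_ge0 ?sqrtr_ge0 ?invr_ge0.
  rewrite sqrtrM ?ler0n//.
  have -> : Num.sqrt n%:R / n%:R * (Num.sqrt n%:R * Num.sqrt s2) =
      (Num.sqrt n%:R * Num.sqrt n%:R) / n%:R * Num.sqrt s2 by ring.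
  by rewrite -expr2 sqr_sqrtr ?ler0n// divff ?mul1r// gt_eqF.
have errC : (fun n => 2 * `|C| * (Num.sqrt n%:R)^-1) @ \oo --> 0.
  by rewrite -[0 in X in _ --> X](mulr0 (2 * `|C|)); apply: cvgMr; exact: cvg_inv_sqrt.
have err e : 0 < e -> \forall n \near \oo, Ex nu (fun z => `|T n z - L n z|) <= e.
  move=> e0; near=> n; have pn : (2 * p < n)%N by near: n; exact: nbhs_infty_gt.
  apply: le_trans (close n pn) _; apply: le_trans (ler_norm _) _; rewrite -normrN -sub0r.
  by near: n; move/cvgrPdist_le : errC; apply.
apply: (@cvg_bounded_continuous R _ _ nu T (Num.sqrt s2 + 1) (Num.sqrt s2) bT).
  near=> n; have n0 : (0 < n)%N by near: n; exact: nbhs_infty_gt.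
  apply: (@le_trans _ _ (Ex nu (fun z => `|L n z| + `|T n z - L n z|))).
    apply: Ex_le; [exact: bmeas_norm|by apply: bmeasD => //; exact: bmeas_norm|move=> z].
    by rewrite -{1}(subrK (L n z) (T n z)) addrC; exact: ler_normD.
  rewrite ExD//; last exact: bmeas_norm.
  by apply: lerD; [exact: Lbound|near: n; exact: err].
move=> a t.
have cL := @cvg_cos_csum R nu nuP v s2 bv v0 s2E a t.
apply/cvgrPdist_le => e e0.
have e2 : 0 < e / 2 by rewrite divr_gt0.
near=> n.
have bcos (S : cspace R idx -> R) : bmeas S -> bmeas (fun z => cos (a + t * S z)).
  by move=> [mS _]; apply: bmeas_cos; apply: measurable_funD => //; exact: measurable_funM.
have h1 : `|cos a * expR (- ((t * Num.sqrt s2) ^+ 2 / 2)) - Ex nu (fun z => cos (a + t * L n z))| <= e / 2.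
  by near: n; move/cvgrPdist_le : cL; apply.
have h2 : `|Ex nu (fun z => cos (a + t * L n z)) - Ex nu (fun z => cos (a + t * T n z))| <= e / 2.
  rewrite -ExB//; try exact: bcos.
  apply: le_trans (Ex_norm_le _ (bmeasB (bcos _ (bL n)) (bcos _ (bT n)))) _.
  apply: (@le_trans _ _ (Ex nu (fun z => `|t| * `|T n z - L n z|))).
    apply: Ex_le; [by apply: bmeas_norm; apply: bmeasB; exact: bcos|exact: bmeasM|move=> z].
    apply: le_trans (cos_lipschitz _ _) _.
    by rewrite -normrM distrC le_eqVlt; apply/orP; left; apply/eqP; congr `|_|; ring.
  rewrite ExZ//.
  apply: (@le_trans _ _ ((`|t| + 1) * (e / 2 / (`|t| + 1)))).
    apply: ler_pM => //; [exact: Ex_ge0|by rewrite lerDl|].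
    by near: n; apply: err; rewrite divr_gt0// ltr_wpDl.
  by rewrite mulrC divfK// gt_eqF// ltr_wpDl.
by apply: le_trans (ler_distD (Ex nu (fun z => cos (a + t * L n z))) _ _) _; rewrite [e]splitr; exact: lerD.
Unshelve. all: by end_near.
Qed.

End GammaCLT.

(** * Extension of the graphon by zero *)

Section CutGraphon.
Variables (R : realType) (W : R -> R -> R).

(** A graphon is arbitrary outside the unit square; this version is measurable, symmetric and
    bounded on the whole plane, as the sections above require, and agrees with [W] wherever
    [cube_int] looks. *)
Definition cut_graphon (x y : R) : R := if (0 <= x <= 1) && (0 <= y <= 1) then W x y else 0.

Hypothesis graphonW : graphon W.

Lemma measurable_cut_graphon : measurable_fun setT (fun z : R * R => cut_graphon z.1 z.2).
Proof.
have [mW _] := graphonW.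
have mI : measurable (`[0, 1]%classic : set R) by exact: measurable_itv.
have mD : measurable ((`[0, 1]%classic : set R) `*` (`[0, 1]%classic : set R)) by exact: measurableX.
rewrite (_ : (fun z => _) =
  ((fun z : R * R => W z.1 z.2) \_ ((`[0, 1]%classic : set R) `*` (`[0, 1]%classic : set R)))).
  by apply/(measurable_restrictT _ mD).
apply/funext => z; rewrite /cut_graphon patchE.
case: ifPn => [/andP[z1 z2]|zn]; first by rewrite mem_set//= !in_itv/= z1 z2.
rewrite memNset//= !in_itv/= => -[z1 z2].
by move/negP: zn; apply; rewrite z1 z2.
Qed.

Lemma cut_graphon01 x y : 0 <= cut_graphon x y <= 1.
Proof.
have [_ [_ W01]] := graphonW; rewrite /cut_graphon.
by case: ifP => [/andP[x01 y01]|_]; [exact: W01|rewrite lexx ler01].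
Qed.

Lemma cut_graphonC x y : cut_graphon x y = cut_graphon y x.
Proof.
have [_ [Wsym _]] := graphonW; rewrite /cut_graphon andbC.
by case: ifP => // /andP[y01 x01]; exact: Wsym.
Qed.

Lemma cut_graphonE x y : 0 <= x <= 1 -> 0 <= y <= 1 -> cut_graphon x y = W x y.
Proof. by rewrite /cut_graphon => -> ->. Qed.

Variables (d p : nat) (F : 'I_d -> rel 'I_p) (l : seq 'I_p).

Lemma edge_prod_cut (e : rel 'I_p) (y : 'I_p -> R) : (forall q, 0 <= y q <= 1) ->
  edge_prod cut_graphon e y = edge_prod W e y.
Proof. by move=> y01; apply: eq_bigr => i _; apply: eq_bigr => j _; rewrite cut_graphonE. Qed.

Lemma incube_assign (lam : seq 'I_p) (z w : nat -> R) q : incube z -> incube w ->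
  0 <= assign lam z w q <= 1.
Proof. by move=> z01 w01; rewrite /assign; case: ifP. Qed.

Lemma hat_t_x_cut x : incube x -> hat_t_x F cut_graphon l x = hat_t_x F W l x.
Proof. by move=> x01; apply: edge_prod_cut. Qed.

Lemma t_lab_cut lam z m : incube z -> t_lab F cut_graphon lam z m = t_lab F W lam z m.
Proof.
move=> z01; apply: eq_cube_int => w w01; apply: edge_prod_cut => q; exact: incube_assign.
Qed.

Lemma tilde_t_x_cut x : incube x -> tilde_t_x F cut_graphon l x = tilde_t_x F W l x.
Proof.
move=> x01; apply/rowP => m; rewrite !mxE; apply: eq_cube_int => w w01.
by apply: edge_prod_cut => q; exact: incube_assign.
Qed.

Lemma Gamma_lim_cut g : Gamma_lim F cut_graphon l g = Gamma_lim F W l g.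
Proof.
congr (_ + (1 - _) * _); apply: eq_cube_int => x x01; last exact: hat_t_x_cut.
by rewrite hat_t_x_cut ?tilde_t_x_cut.
Qed.

Lemma curlyU_cut g u : 0 <= u <= 1 -> curlyU F cut_graphon l g u = curlyU F W l g u.
Proof.
move=> u01; congr (_ + _); apply: eq_bigr => i _; apply: eq_cube_int => x x01.
  have xi := incube_setc i x01 u01.
  by rewrite hat_t_x_cut ?tilde_t_x_cut.
by apply: eq_bigr => m _; rewrite t_lab_cut ?tilde_t_x_cut//; exact: incube_setc.
Qed.

Lemma sigma2_cut g : sigma2 F cut_graphon l g = sigma2 F W l g.
Proof.
rewrite /sigma2.
have -> : Rintegral lebesgue_measure `[0, 1]%classic (curlyU F cut_graphon l g) =
    Rintegral lebesgue_measure `[0, 1]%classic (curlyU F W l g).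
  by apply: eq_Rintegral => u; rewrite inE/= in_itv/= => u01; exact: curlyU_cut.
have -> : Rintegral lebesgue_measure `[0, 1]%classic (fun u => curlyU F cut_graphon l g u ^+ 2) =
    Rintegral lebesgue_measure `[0, 1]%classic (fun u => curlyU F W l g u ^+ 2).
  by apply: eq_Rintegral => u; rewrite inE/= in_itv/= => u01; congr (_ ^+ 2); exact: curlyU_cut.
by [].
Qed.

End CutGraphon.

(** * Passage from the given variables to the coordinate space *)

Section Coordinates.
Variables (R : realType) (dT : measure_display) (T : measurableType dT) (P : probability T R).
Variables (X : nat -> T -> R) (Y : nat -> nat -> T -> R).

Definition coords (a : idx) : T -> R :=
  match a with inl i => X i | inr e => Y e.1 (e.1 + e.2).+1 end.

Lemma coords_edge i j : i != j -> coords (eix i j) = Y (minn i j) (maxn i j).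
Proof. by move=> ij; rewrite /coords /eix /=; congr (Y _ _); move/eqP: ij; lia. Qed.

(** The hypothesis covers pairs [(i, j)] with [i < j] only, whereas every index of [idx] must carry
    a variable. The map [phi] sends [(i, c)] to [(i, i + c + 1)], and its left inverse [psi]
    transports the measurable sets. *)
Lemma coords_independent :
  mutually_independent P
    (fun a : nat + (nat * nat) => match a with inl _ => True | inr ij => (ij.1 < ij.2)%N end)
    (fun a => match a with inl i => X i | inr ij => Y ij.1 ij.2 end) ->
  mutually_independent P setT coords.
Proof.
move=> indep J B uJ _ mB.
pose phi (a : idx) : nat + nat * nat := match a with inl i => inl i | inr e => inr (e.1, (e.1 + e.2).+1) end.
pose psi (a : nat + nat * nat) : idx := match a with inl i => inl i | inr e => inr (e.1, (e.2 - e.1).-1) end.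
have phiK : cancel phi psi.
  by case=> [i|[i c]] //=; congr (inr (_, _)); lia.
have := indep (map phi J) (B \o psi).
rewrite map_inj_uniq; last exact: can_inj phiK.
move=> /(_ uJ) H; rewrite !big_map in H.
transitivity (P (\big[setI/setT]_(j <- J)
  (match phi j with inl i => X i | inr ij => Y ij.1 ij.2 end @^-1` (B \o psi) (phi j)))).
  congr (P _); apply: eq_bigr => j _; rewrite /= phiK; by case: j.
rewrite H//.
- congr (_%:E); apply: eq_bigr => j _; rewrite /= phiK; by case: j.
- by move=> _ /mapP[[i|[i c]] _ ->] //=; lia.
- by move=> a; exact: mB.
Qed.

Lemma coords_uniform : (forall i, uniform01 P (X i)) -> (forall i j, (i < j)%N -> uniform01 P (Y i j)) ->
  forall a, uniform01 P (coords a).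
Proof. by move=> uX uY [i|[i c]]; [exact: uX|apply: uY => /=; lia]. Qed.

Lemma Gn_graph_of (W : R -> R -> R) n w : (forall i, 0 <= X i w <= 1) ->
  Gn W X Y n w = graph_of (cut_graphon W) (n := n) (coords^~ w).
Proof.
move=> X01; apply/funext => i; apply/funext => j; rewrite /Gn /graph_of.
case: eqVneq => //= ij; rewrite cut_graphonE//.
by rewrite -(coords_edge ij).
Qed.

Lemma uniform01_outside (Z : T -> R) : uniform01 P Z ->
  measurable (Z @^-1` (~` `[0, 1]%classic)) /\ P (Z @^-1` (~` `[0, 1]%classic)) = 0%E.
Proof.
move=> [mZ PZ].
have mI : measurable (~` (`[0, 1]%classic : set R)) by apply: measurableC; exact: measurable_itv.
split; first by rewrite -[X in measurable X]setTI; exact: mZ.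
by rewrite PZ// setICl measure0.
Qed.

End Coordinates.

Theorem theorem3p5 (R : realType) (W : R -> R -> R) (d p : nat)
  (F : 'I_d -> rel 'I_p) (l : seq 'I_p) (g : 'rV[R]_d -> R)
  (dT : measure_display) (T : measurableType dT) (P : probability T R)
  (X : nat -> T -> R) (Y : nat -> nat -> T -> R) :
  graphon W ->
  (1 <= d)%N -> (1 <= p)%N ->
  (forall m, simple_graph (F m)) ->
  uniq l -> (1 <= size l)%N ->
  compatible F l ->
  C2_cube g ->
  (* X_i (i >= 1 in the paper; all i here) and Y_{ij} (i < j) are independent uniforms *)
  mutually_independent P
    (fun a : nat + (nat * nat) => match a with inl _ => True | inr ij => (ij.1 < ij.2)%N end)
    (fun a => match a with inl i => X i | inr ij => Y ij.1 ij.2 end) ->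
  (forall i, uniform01 P (X i)) ->
  (forall i j, (i < j)%N -> uniform01 P (Y i j)) ->
  cvg_normal P
    (fun n w => Num.sqrt n%:R *
       (Gamma_n F l g (Gn W X Y n w) - Gamma_lim F W l g))
    (sigma2 F W l g).
Proof.
move=> gW d_gt0 p_gt0 simpleF ul l_gt0 compF C2g indep uX uY h ch [M hM].
have mW := measurable_cut_graphon gW.
have W01 := cut_graphon01 gW.
have Wsym := cut_graphonC gW.
have [nu [nuP nuE]] := iid_unif_law (coords_independent indep) (coords_uniform uX uY).
have clt := Gamma_n_clt mW W01 Wsym nuP p_gt0 ul compF simpleF C2g ch (ex_intro _ M hM).
rewrite Gamma_lim_cut sigma2_cut in clt.
(* Off [N] every type lies in [[0, 1]], so the graph built from [W] is the one built from
   [cut_graphon]; on [N] the values of [W] are uncontrolled and the statistic may be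
   non-measurable. *)
pose N := \bigcup_i (X i @^-1` (~` `[0, 1]%classic)).
have mN : measurable N by apply: bigcupT_measurable => i; case: (uniform01_outside (uX i)).
have PN : P N = 0%E.
  apply/negligibleP => //; apply: negligible_bigcup => i.
  by have [mi Pi] := uniform01_outside (uX i); apply/negligibleP.
rewrite (_ : (fun n => _) = (fun n => Ex nu (fun z => h (Num.sqrt n%:R *
  (Gamma_n F l g (graph_of (cut_graphon W) (n := n) z) - Gamma_lim F W l g))))).
  exact: clt.
apply/funext => n.
pose phi (G : rel 'I_n) := h (Num.sqrt n%:R * (Gamma_n F l g G - Gamma_lim F W l g)).
have bphi := bmeas_graph_of mW W01 phi.
rewrite -(nuE _ bphi); apply: (congr1 fine).
apply: (integral_eq_off_null mN PN).
  apply/measurable_EFinP.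
  apply: (measurableT_comp bphi.1).
  by apply: measurable_to_cspace => a; case: (coords_uniform uX uY a).
move=> w Nw; congr (_%:E); rewrite /phi Gn_graph_of// => i.
apply: contrapT => Xi; apply: Nw; by exists i.
Qed.
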